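(* Let $\omega\in\mathscr{G}$ be an even function and let $\mu$ be a nonzero even finite Borel measure on $\mathbb{R}^n$. If $\mu$ is not concentrated in any proper subspace of $\mathbb{R}^n$, $\mu$ has finite first moment (i.e. $\int_{\mathbb{R}^n}|x|\,d\mu(x)<\infty$), and $$\liminf_{t\to0^+}\Big(\mathcal{F}_\omega(t)\,e^{-\frac{\zeta_\mu}{2|\mu|t}}\Big)=0,$$ then there exists $f\in\mathrm{LC}_n$ such that $$\mu=\widetilde C^e_\omega(f,\cdot).$$
   Context: Fix $n\ge 1$. $\mathscr{G}$ is the set of continuous functions $\omega:\mathbb{R}^n\setminus\{o\}\to(0,\infty)$ such that: (A1) $\omega$ is locally integrable in $\mathbb{R}^n$; (A2) $\limsup_{|x|\to0}|x|^n\omega(x)<\infty$; (A3) $\limsup_{|x|\to\infty}\frac{\ln\omega(x)}{|x|}=0$. $\mathrm{LC}_n$ is the set of upper semi-continuous log-concave functions $f=e^{-\phi}:\mathbb{R}^n\to[0,\infty)$ ($\phi:\mathbb{R}^n\to\mathbb{R}\cup\{+\infty\}$ convex) with nonzero finite $L^1$ norm. For a log-concave function $f$, $\widetilde V_\omega(f)=\int_{\mathbb{R}^n}f(x)\omega(x)\,dx$. For $t>0$, $\mathcal{F}_\omega(t)=\widetilde V_\omega(e^{-t|x|})=\int_{\mathbb{R}^n}e^{-t|x|}\omega(x)\,dx$. For a nonzero even finite Borel measure $\mu$ on $\mathbb{R}^n$, $|\mu|=\mu(\mathbb{R}^n)$ and $\zeta_\mu=\inf_{v\in S^{n-1}}\int_{\mathbb{R}^n}|\langle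 x,v\rangle|\,d\mu(x)$. For $f=e^{-\phi}\in\mathrm{LC}_n$, the Euclidean dual $\omega$-Orlicz curvature measure is the Borel measure on $\mathbb{R}^n$ $$\widetilde C^e_\omega(f,E)=\int_{\{x\in\mathbb{R}^n:\nabla\phi(x)\in E\}}e^{-\phi(x)}\omega(x)\,dx$$ for Borel $E\subset\mathbb{R}^n$; here $\nabla\phi$ exists almost everywhere in the interior of $\{\phi<\infty\}$. *)

(* Defs.v *)
From HB Require Import structures.
From mathcomp Require Import all_boot all_order all_algebra.
From mathcomp Require Import all_classical all_reals all_analysis.
From mathcomp Require Import measurable_realfun.
Import Order.TTheory GRing.Theory Num.Theory.
Import numFieldNormedType.Exports.

Set Implicit Arguments.
Unset Strict Implicit.
Unset Printing Implicit Defensive.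

Local Open Scope classical_set_scope.
Local Open Scope ring_scope.

HB.instance Definition _ (R : realType) (n : nat) :=
  @isMeasurable.Build default_measure_display 'rV[R]_n
    <<s @open 'rV[R]_n >> (@sigma_algebra0 _ setT _)
    (@sigma_algebraC _ _) (@sigma_algebra_bigcup _ setT _).

Lemma coord_measurable (R : realType) (n : nat) (i : 'I_n) :
  measurable_fun setT (fun x : 'rV[R]_n => x ord0 i).
Proof.
apply: (measurability (@RGenOInfty.G R) (RGenOInfty.measurableE R)).
move=> _ [_ [a ->] <-]; rewrite setTI set_itvE.
apply: sub_sigma_algebra.
apply: (@open_comp _ _ (fun x : 'rV[R]_n => x ord0 i)); last exact: open_gt.
by move=> x _; exact: coord_continuous.
Qed.

Lemma measurable_fun_rowP d (T : measurableType d) (R : realType) (n : nat)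
    (f : T -> 'rV[R]_n) :
  (forall i, measurable_fun setT (fun t => f t ord0 i)) ->
  measurable_fun setT f.
Proof.
move=> mf; apply: (measurability (@open 'rV[R]_n)) => //.
move=> _ [U oU <-]; rewrite setTI.
pose box (q : {ffun 'I_n -> rat * rat}) : set 'rV[R]_n :=
  [set x | forall i, ratr (q i).1 < x ord0 i < ratr (q i).2].
pose D (q : {ffun 'I_n -> rat * rat}) : set T :=
  [set t | box q `<=` U /\ box q (f t)].
have -> : f @^-1` U = \bigcup_q D q.
  apply/seteqP; split => [t /= Uft|t [q _ [qU qt]]]; last exact: qU.
  have /nbhs_ballP[e /= e0 eU] : nbhs (f t) U by exact: open_nbhs_nbhs.
  have H i : exists q : rat * rat,
      f t ord0 i - e < ratr q.1 < f t ord0 i /\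
      f t ord0 i < ratr q.2 < f t ord0 i + e.
    have l1 : f t ord0 i - e < f t ord0 i by rewrite ltrBlDr ltrDl.
    have l2 : f t ord0 i < f t ord0 i + e by rewrite ltrDl.
    have [q1 h1] := rat_in_itvoo l1; rewrite in_itv/= in h1.
    have [q2 h2] := rat_in_itvoo l2; rewrite in_itv/= in h2.
    by exists (q1, q2).
  have [g Hg] := choice H.
  exists [ffun i => g i] => //; split.
  - move=> x /= bx; apply: eU; rewrite /ball/=; split => // a i; rewrite ord1 {a}.
    have := bx i; rewrite ffunE; have [] := Hg i.
    rewrite /ball/= => /andP[a1 a2] /andP[a3 a4] /andP[a5 a6].
    rewrite ltr_norml; apply/andP; split.
      by rewrite ltrBrDr addrC ltrBlDr; exact: lt_trans a4.
    by rewrite ltrBlDr -ltrBlDl; exact: lt_trans a5.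
  - move=> i; rewrite ffunE; have [] := Hg i.
    by move=> /andP[a1 a2] /andP[a3 a4]; rewrite a2.
apply: countable_bigcupT_measurable => // q; rewrite /D.
have [qU|nqU] := pselect (box q `<=` U); last first.
  rewrite [X in measurable X](_ : _ = set0); first exact: measurable0.
  by apply/seteqP; split => // t [].
rewrite [X in measurable X](_ : _ = \bigcap_(i in [set: 'I_n])
    (fun t => f t ord0 i) @^-1` `](ratr (q i).1 : R), (ratr (q i).2)[%classic).
  apply: fin_bigcap_measurable => [|i _]; first exact: finite_finset.
  by rewrite -[X in measurable X]setTI; exact: mf.
apply/seteqP; split => [t [_ bt] i _|t bt].
  by rewrite /= in_itv/=; exact: bt.
by split => // i; have := bt i I; rewrite /= in_itv/=.
Qed.

Definition row_cons (R : realType) (n : nat) (p : measurableTypeR R * 'rV[R]_n) :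
    'rV[R]_n.+1 := row_mx (p.1 : R)%:M p.2.

Lemma row_cons0 (R : realType) (n : nat) (p : measurableTypeR R * 'rV[R]_n) :
  row_cons p ord0 ord0 = p.1.
Proof.
have -> : @ord0 n = lshift n (@ord0 0) by exact: val_inj.
by etransitivity; [exact: row_mxEl | rewrite mxE eqxx].
Qed.

Lemma row_consS (R : realType) (n : nat) (p : measurableTypeR R * 'rV[R]_n) i :
  row_cons p ord0 (lift ord0 i) = p.2 ord0 i.
Proof.
have -> : lift ord0 i = rshift 1 i by exact: val_inj.
exact: row_mxEr.
Qed.

Lemma measurable_row_cons (R : realType) (n : nat) :
  measurable_fun setT (@row_cons R n).
Proof.
apply: measurable_fun_rowP => i; have [j ->|->] := unliftP ord0 i.
  under eq_fun do rewrite row_consS.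
  exact: (measurableT_comp (coord_measurable j) measurable_snd).
under eq_fun do rewrite row_cons0.
exact: measurable_fst.
Qed.

Definition row_uncons (R : realType) (n : nat) (x : 'rV[R]_n.+1) :
    measurableTypeR R * 'rV[R]_n :=
  (x ord0 ord0, \row_i x ord0 (lift ord0 i)).

Lemma row_consK (R : realType) (n : nat) :
  cancel (@row_cons R n) (@row_uncons R n).
Proof.
case=> a b; rewrite /row_uncons row_cons0; congr pair.
by apply/rowP => i; rewrite mxE row_consS.
Qed.

Lemma measurable_row_uncons (R : realType) (n : nat) :
  measurable_fun setT (@row_uncons R n).
Proof.
apply: measurable_fun_pair => /=; first exact: coord_measurable.
apply: measurable_fun_rowP => i; under eq_fun do rewrite mxE.
exact: coord_measurable.
Qed.

Section lebesgue_step.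
Local Open Scope ereal_scope.
Context (R : realType) (n : nat)
  (m : {sigma_finite_measure set 'rV[R]_n -> \bar R}).

Definition lebesgue_step : set 'rV[R]_n.+1 -> \bar R :=
  pushforward (lebesgue_measure \x m) (@row_cons R n).

Let lebesgue_step0 : lebesgue_step set0 = 0.
Proof. by rewrite /lebesgue_step /pushforward preimage_set0 measure0. Qed.

Let lebesgue_step_ge0 A : 0 <= lebesgue_step A.
Proof. by rewrite /lebesgue_step /pushforward measure_ge0. Qed.

Let lebesgue_step_sigma_additive : semi_sigma_additive lebesgue_step.
Proof.
have mrc A : measurable A -> measurable (@row_cons R n @^-1` A).
  by move=> mA; rewrite -[X in measurable X]setTI; exact: measurable_row_cons.
move=> F mF tF mUF; rewrite /lebesgue_step /pushforward preimage_bigcup.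
apply: measure_semi_sigma_additive => [k||]; first exact: mrc.
- apply/trivIsetP => /= i j _ _ ij; rewrite -preimage_setI.
  by move/trivIsetP : tF => /(_ _ _ _ _ ij) ->//; rewrite preimage_set0.
- by rewrite -preimage_bigcup; exact: mrc.
Qed.

HB.instance Definition _ := isMeasure.Build _ _ _ lebesgue_step
  lebesgue_step0 lebesgue_step_ge0 lebesgue_step_sigma_additive.

Let lebesgue_step_sigma_finite : sigma_finite setT lebesgue_step.
Proof.
have /sigma_finiteP[F [TF ndF Foo]] := sigma_finiteT (@lebesgue_measure R).
have /sigma_finiteP[G [TG ndG Goo]] := sigma_finiteT m.
exists (fun k => @row_uncons R n @^-1` (F k `*` G k)).
  rewrite -preimage_bigcup [X in _ @^-1` X](_ : _ = setT) ?preimage_setT//.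
  apply/seteqP; split => // -[x y] _.
  have [k _ Fx] : (\bigcup_k F k) x by rewrite -TF.
  have [l _ Gy] : (\bigcup_k G k) y by rewrite -TG.
  exists (maxn k l) => //; split => /=.
    by move: x Fx; exact/subsetPset/ndF/leq_maxl.
  by move: y Gy; exact/subsetPset/ndG/leq_maxr.
move=> k; have [? ?] := Foo k; have [? ?] := Goo k; split.
  rewrite -[X in measurable X]setTI; apply: measurable_row_uncons => //.
  exact: measurableX.
rewrite /lebesgue_step /pushforward -comp_preimage.
rewrite (_ : _ \o _ = id) ?preimage_id; last by apply/funext; exact: row_consK.
by rewrite product_measure1E// lte_mul_pinfty// ge0_fin_numE.
Qed.

HB.instance Definition _ := Measure_isSigmaFinite.Build _ _ _ lebesgue_step
  lebesgue_step_sigma_finite.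

End lebesgue_step.

(* On R^0, whose only point is the empty vector, this is the unit point mass. *)
Fixpoint lebesgue_rV (R : realType) (n : nat) :
    {sigma_finite_measure set 'rV[R]_n -> \bar R} :=
  match n with
  | 0 => \d_(0 : 'rV[R]_0)
  | k.+1 => lebesgue_step (lebesgue_rV R k)
  end.

Lemma lebesgue_rV_box (R : realType) (n : nat) (A : 'I_n -> set R) :
  (forall i, measurable (A i)) ->
  lebesgue_rV R n [set x : 'rV[R]_n | forall i, A i (x ord0 i)] =
  (\prod_(i < n) lebesgue_measure (A i))%E.
Proof.
elim: n A => [A _|n IH A mA].
  rewrite big_ord0 /= diracE mem_set//; by case.
rewrite big_ord_recl -IH//.
pose B := [set x : 'rV[R]_n | forall i, A (lift ord0 i) (x ord0 i)].
have mB : measurable B.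
  rewrite [X in measurable X](_ : _ = \bigcap_(i in [set: 'I_n])
     (fun x : 'rV[R]_n => x ord0 i) @^-1` A (lift ord0 i)).
    apply: fin_bigcap_measurable => [|i _]; first exact: finite_finset.
    by rewrite -[X in measurable X]setTI; exact: coord_measurable.
  by apply/seteqP; split => [x bx i _|x bx i]; [exact: bx|exact: bx].
suff E : @row_cons R n @^-1` [set x : 'rV[R]_n.+1 | forall i, A i (x ord0 i)] =
         A ord0 `*` B.
  by rewrite /= /lebesgue_step /pushforward E product_measure1E//; exact: mA.
apply/seteqP; split => [[a b] /= ab|[a b] /= [Aa Ab] i].
  split; first by have := ab ord0; rewrite row_cons0.
  by move=> i; have := ab (lift ord0 i); rewrite row_consS.
have [j ->|->] := unliftP ord0 i; first by rewrite row_consS; exact: Ab.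
by rewrite row_cons0.
Qed.

(* The norm [`|x|] that the library puts on ['rV[R]_n] is the sup norm; it
   induces the same topology and the same derivatives, but the Euclidean norm
   has to be introduced separately. *)

Definition inner (R : realType) (n : nat) (u v : 'rV[R]_n) : R :=
  \sum_i u ord0 i * v ord0 i.

Definition enorm (R : realType) (n : nat) (u : 'rV[R]_n) : R :=
  Num.sqrt (inner u u).

Definition esphere (R : realType) (n : nat) : set 'rV[R]_n :=
  [set v | enorm v = 1].

Definition at_infinity (R : realType) (n : nat) : set_system 'rV[R]_n :=
  [set V | exists M : R, forall x, M < enorm x -> V x].

Definition even_fun (R : realType) (n : nat) (w : 'rV[R]_n -> R) : Prop :=
  forall x, w (- x) = w x.

(* A weight lives on R^n minus the origin; it is encoded by a total function
   whose value at the origin is arbitrary. Nothing below depends on that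
   value: for n >= 1 the origin is a Lebesgue null set. *)
Record weight (R : realType) (n : nat) (w : 'rV[R]_n -> R) : Prop := Weight {
  weight_gt0 : forall x : 'rV[R]_n, x != 0 -> 0 < w x ;
  weight_continuous : forall x : 'rV[R]_n, x != 0 -> {for x, continuous w} ;
  weight_locally_integrable : forall K : set 'rV[R]_n, compact K ->
    (lebesgue_rV R n).-integrable K (EFin \o w) ;
  weight_origin :
    (limf_esup (fun x => (enorm x ^+ n * w x)%:E) (0%R : 'rV[R]_n)^' < +oo)%E ;
  weight_infinity :
    limf_esup (fun x => (ln (w x) / enorm x)%:E) (@at_infinity R n) = 0%E
}.

Definition neg_log (R : realType) (n : nat) (f : 'rV[R]_n -> R)
    (x : 'rV[R]_n) : \bar R :=
  (- lne (f x)%:E)%E.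

Lemma neg_logK (R : realType) (n : nat) (f : 'rV[R]_n -> R) :
  (forall x, 0 <= f x) -> forall x, expeR (- neg_log f x)%E = (f x)%:E.
Proof.
by move=> f0 x; rewrite /neg_log oppeK lneK// in_itv/= lee_fin f0 leey.
Qed.

(* Excluding -oo makes phi a function into R U {+oo}, so the sum on the right
   is never of the form +oo - oo. *)
Definition convex_efun (R : realType) (n : nat) (phi : 'rV[R]_n -> \bar R) :=
  (forall x, phi x != -oo%E) /\
  forall (x y : 'rV[R]_n) (t : R), 0 < t < 1 ->
    (phi (t *: x + (1 - t) *: y)%R <=
     t%:E * phi x + (1 - t)%:E * phi y)%E.

Definition log_concave (R : realType) (n : nat) (f : 'rV[R]_n -> R) : Prop :=
  (forall x, 0 <= f x) /\ convex_efun (neg_log f).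

Definition upper_semicontinuous (R : realType) (n : nat)
    (f : 'rV[R]_n -> R) : Prop :=
  lower_semicontinuous (fun x => (- f x)%:E).

Record LC (R : realType) (n : nat) (f : 'rV[R]_n -> R) : Prop := IsLC {
  LC_log_concave : log_concave f ;
  LC_usc : upper_semicontinuous f ;
  LC_norm : (0 < Lnorm (lebesgue_rV R n) 1 (EFin \o f) < +oo)%E
}.

Definition dual_volume (R : realType) (n : nat) (w f : 'rV[R]_n -> R) : \bar R :=
  (\int[lebesgue_rV R n]_x (f x * w x)%:E)%E.

Definition dual_volume_exp (R : realType) (n : nat) (w : 'rV[R]_n -> R)
    (t : R) : \bar R :=
  dual_volume w (fun x => expR (- (t * enorm x))).

(* [fine \o phi] is 0 where phi = +oo, hence the finiteness requirement around
   x in addition to the differentiability of [fine \o phi]. *)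
Definition has_gradient (R : realType) (n : nat) (phi : 'rV[R]_n -> \bar R)
    (x : 'rV[R]_n) : Prop :=
  (\forall y \near x, phi y \is a fin_num) /\ differentiable (fine \o phi) x.

Definition gradient (R : realType) (n : nat) (phi : 'rV[R]_n -> \bar R)
    (x : 'rV[R]_n) : 'rV[R]_n :=
  \row_i 'd (fine \o phi) x (delta_mx ord0 i).

Definition curvature_measure (R : realType) (n : nat) (w f : 'rV[R]_n -> R)
    (E : set 'rV[R]_n) : \bar R :=
  (\int[lebesgue_rV R n]_(x in [set x | has_gradient (neg_log f) x /\
                                        E (gradient (neg_log f) x)])
     (f x * w x)%:E)%E.

Section measure_conditions.
Context (R : realType) (n : nat)
  (mu : {finite_measure set 'rV[R]_n -> \bar R}).

Definition even_measure : Prop :=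
  forall A : set 'rV[R]_n, measurable A -> mu [set - x | x in A] = mu A.

Definition concentrated_in (W : {vspace 'rV[R]_n}) : Prop :=
  mu (~` [set x : 'rV[R]_n | x \in W]) = 0%E.

Definition finite_first_moment : Prop :=
  (\int[mu]_x (enorm x)%:E < +oo)%E.

Definition zeta : \bar R :=
  ereal_inf [set (\int[mu]_x `|inner x v|%:E)%E | v in @esphere R n].

End measure_conditions.

(* Main.v *)
Require Import Defs.
From HB Require Import structures.
From mathcomp Require Import all_boot all_order all_algebra.
From mathcomp Require Import all_classical all_reals all_analysis.
From mathcomp Require Import measurable_realfun ring lra.
Import Order.TTheory GRing.Theory Num.Theory.
Import numFieldNormedType.Exports.
Local Open Scope classical_set_scope.
Local Open Scope ring_scope.

Set Implicit Arguments.
Unset Strict Implicit.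
Unset Printing Implicit Defensive.

(* Put sigma = w dx. For an even potential psi >= 0 let phi be its Legendre
   conjugate and m(psi) its average over mu; the density e^(-phi) sought for is
   obtained by maximizing e^(-m(psi)) * int e^(-phi) dsigma. Evenness gives
   phi(x) >= (zeta / |mu|) |x| - m(psi), and the hypothesis on F_w then keeps the
   averages of a maximizing sequence bounded. Along such a sequence the sublevel
   sets of the conjugates are symmetric convex bodies of sigma-mass bounded below,
   hence contain a fixed neighbourhood of the origin, and a pointwise lower limit
   of the potentials is a maximizer psi. Add a constant to psi so that e^(-phi) has
   sigma-integral |mu|. Comparing psi with psi + g / k as k tends to infinity gives
   int g(grad phi) e^(-phi) dsigma <= int g dmu for all even continuous g with
   0 <= g <= 1; using 1 - g as well yields equality, so mu is the curvature
   measure of e^(-phi). *)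

(** Adding a constant to psi multiplies int e^(-phi) dsigma and e^(m(psi)) by the same factor, so
    phi >= 0 may be assumed. Then phi >= s phi for 0 < s <= 1, and with c = zeta / |mu| the integral
    is at most e^(s m) F_w(s c). If m > M, the choice s = 1 / (2 M) bounds the maximized quantity by
    e^(1/2) e^(-M) F_w(c / (2 M)); at t = c / (2 M) the factor e^(-M) is exp(-zeta / (2 |mu| t)),
    the origin of the 2 in the hypothesis. A lower limit provides only some large M, but a single M
    bounds the averages of all good competitors. Differentiability almost everywhere is tested along
    coordinate lines: on each line kinks and endpoints of the domain are countable, and convexity
    combines the partial derivatives into a Frechet derivative. The perturbation g / k only lowers
    phi, so the difference quotients of e^(-phi) are nonnegative and Fatou applies without a
    dominating function. It gives one inequality; equality of the total masses supplies the
    other. *)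

Lemma axisE (R : realType) n (x : 'rV[R]_n) (t : R) i k :
  (x + t *: delta_mx 0 i) ord0 k = x ord0 k + t * (k == i)%:R.
Proof. by rewrite !mxE eqxx. Qed.

Lemma row_cons_axis0 (R : realType) n (s t : R) (z : 'rV[R]_n) :
  row_cons ((s : measurableTypeR R), z) + t *: delta_mx 0 ord0 =
  row_cons ((s + t : measurableTypeR R), z).
Proof.
apply/rowP => i; rewrite axisE; have [j ->|->] := unliftP ord0 i.
  by rewrite !row_consS/= mulr0 addr0.
by rewrite !row_cons0/= mulr1.
Qed.

Lemma row_cons_axisS (R : realType) n (s t : R) (z : 'rV[R]_n) j :
  row_cons ((s : measurableTypeR R), z) + t *: delta_mx 0 (lift ord0 j) =
  row_cons ((s : measurableTypeR R), z + t *: delta_mx 0 j).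
Proof.
apply/rowP => i; rewrite axisE; have [k ->|->] := unliftP ord0 i.
  by rewrite !row_consS/= axisE (inj_eq lift_inj).
by rewrite !row_cons0/= mulr0 addr0.
Qed.

Lemma row_consN (R : realType) n (s : R) (z : 'rV[R]_n) :
  - row_cons ((s : measurableTypeR R), z) = row_cons ((- s : measurableTypeR R), - z).
Proof.
apply/rowP => i; rewrite mxE; have [k ->|->] := unliftP ord0 i.
  by rewrite !row_consS/= mxE.
by rewrite !row_cons0.
Qed.

(** * Lebesgue measure on row vectors *)

Section lebesgue_rV_basic.
Context (R : realType).
Local Open Scope ereal_scope.

Lemma measurable_row_cons_pre n (B : set 'rV[R]_n.+1) :
  measurable B -> measurable (@row_cons R n @^-1` B).
Proof. by move=> mB; rewrite -[X in measurable X]setTI; exact: measurable_row_cons. Qed.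

Lemma lebesgue_rV_xsection n (B : set 'rV[R]_n.+1) :
  lebesgue_rV R n.+1 B =
  \int[lebesgue_measure]_s lebesgue_rV R n (xsection (@row_cons R n @^-1` B) s).
Proof. by []. Qed.

Lemma lebesgue_rV_ysection n (B : set 'rV[R]_n.+1) : measurable B ->
  lebesgue_rV R n.+1 B =
  \int[lebesgue_rV R n]_z lebesgue_measure (ysection (@row_cons R n @^-1` B) z).
Proof.
move=> mB; have mA := measurable_row_cons_pre mB.
rewrite lebesgue_rV_xsection.
have := indic_fubini_tonelli lebesgue_measure (lebesgue_rV R n) mA.
by rewrite indic_fubini_tonelli_GE// indic_fubini_tonelli_FE.
Qed.

Lemma integral_le_cst_on d (T : measurableType d) (m : {measure set T -> \bar R})
   (f : T -> \bar R) (D : set T) (c : R) : measurable_fun setT f ->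
  (forall x, 0 <= f x) ->
  measurable D -> (0 <= c)%R -> (forall x, ~ D x -> f x = 0) -> (forall x, f x <= c%:E) ->
  \int[m]_x f x <= c%:E * m D.
Proof.
move=> mf f0 mD c0 fD fc; rewrite -integral_cst// [leRHS]integral_mkcond.
apply: ge0_le_integral => //.
- by apply/measurable_restrict => //; exact: measurable_cst.
- move=> x _; rewrite patchE; case: ifPn => // /negP; rewrite inE => nD.
  by rewrite fD.
Qed.

Definition cube n (r : R) := [set x : 'rV[R]_n | forall i, (- r <= x ord0 i <= r)%R].

Lemma measurable_cube n (r : R) : measurable (@cube n r).
Proof.
rewrite (_ : cube _ = \bigcap_(i in [set: 'I_n])
     (fun x : 'rV[R]_n => x ord0 i) @^-1` [set` `[(- r)%R, r]]).
  apply: fin_bigcap_measurable => [|i _]; first exact: finite_finset.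
  by rewrite -[X in measurable X]setTI; exact: coord_measurable.
by apply/seteqP; split => [x bx i _|x bx i]; have := bx i; rewrite /= in_itv/=; exact.
Qed.

Lemma lebesgue_measure_symitv (r : R) : (0 <= r)%R ->
  lebesgue_measure [set` `[(- r)%R, r]] = (2 * r)%:E.
Proof.
move=> r0; rewrite lebesgue_measure_itv/= lte_fin; case: ltP => h.
  by rewrite -EFinB opprK; congr EFin; lra.
by congr EFin; lra.
Qed.

Lemma lebesgue_cube n (r : R) : (0 <= r)%R -> lebesgue_rV R n (@cube n r) = ((2 * r) ^+ n)%:E.
Proof.
move=> r0.
have -> : @cube n r = [set x : 'rV[R]_n | forall i, [set` `[(- r)%R, r]] (x ord0 i)].
  by apply/seteqP; split => x bx i; have := bx i; rewrite /= in_itv/=; exact.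
rewrite (lebesgue_rV_box (A := fun=> [set` `[(- r)%R, r]]))// lebesgue_measure_symitv//.

by rewrite big_const_ord; elim: n => [|k IH]; rewrite ?expr0 //= IH exprS EFinM.
Qed.

(** Fubini with direction [i] innermost: the slice bound is integrated over a cube of dimension n -
    1. The measure is built by splitting off coordinate 0, so the induction lowers [i] until it is
    that coordinate. *)
Lemma lebesgue_rV_slice_le n (i : 'I_n) (B : set 'rV[R]_n) (r rho : R) :
  (0 <= r)%R -> (0 <= rho)%R -> measurable B -> B `<=` @cube n r ->
  (forall x, lebesgue_measure [set s : R | B (x + s *: delta_mx 0 i)%R] <= rho%:E) ->
  lebesgue_rV R n B <= (rho * (2 * r) ^+ n.-1)%:E.
Proof.
move=> r0 rho0; elim: n i B => [[]//|n IH] i B mB Bc Bs.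
have mA := measurable_row_cons_pre mB.
have [j ji|i0] := unliftP ord0 i; last first.
  rewrite lebesgue_rV_ysection// EFinM -lebesgue_cube//.
  apply: integral_le_cst_on => //.
  - exact: measurable_fun_ysection.
  - exact: measurable_cube.
  - move=> z nz; rewrite (_ : ysection _ _ = set0) ?measure0//.
    apply/seteqP; split => // s; rewrite /ysection/= inE/= => /Bc h.
    by apply: nz => k; have := h (lift ord0 k); rewrite row_consS.
  - move=> z; have := Bs (row_cons ((0%R : measurableTypeR R), z)); congr (_ <= _).
    congr lebesgue_measure; rewrite i0; apply/seteqP; split => s;
      by rewrite /ysection/= inE/= row_cons_axis0 add0r.
(* The index [j] exists, so the dimension is positive and the truncated predecessor in the exponent
   is a true one. *)
have n0 : (0 < n)%N by case: n j {IH B mB Bc Bs mA i ji} => // -[].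
rewrite lebesgue_rV_xsection.
have -> : ((rho * (2 * r) ^+ n.+1.-1)%:E =
   (rho * (2 * r) ^+ n.-1)%:E * lebesgue_measure [set` `[(- r)%R, r]] :> \bar R).
  by rewrite lebesgue_measure_symitv// -EFinM -mulrA -exprSr prednK.
apply: integral_le_cst_on => //.
- exact: measurable_fun_xsection.
- by rewrite mulr_ge0// exprn_ge0// mulr_ge0.
- move=> s ns; rewrite (_ : xsection _ _ = set0) ?measure0//.
  apply/seteqP; split => // z; rewrite /xsection/= inE/= => /Bc h.
  by apply: ns; have := h ord0; rewrite row_cons0/= in_itv.
- move=> s; apply: (IH j).
  + exact: measurable_xsection.
  + move=> z; rewrite /xsection/= inE/= => /Bc h k.
    by have := h (lift ord0 k); rewrite row_consS.
  + move=> z; have := Bs (row_cons ((s : measurableTypeR R), z)); congr (_ <= _).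
    congr lebesgue_measure; rewrite ji; apply/seteqP; split => t;
      by rewrite /xsection/= inE/= row_cons_axisS.
Qed.

Lemma measurable_axis_pre n (i : 'I_n) (B : set 'rV[R]_n) x : measurable B ->
  measurable [set s : R | B (x + s *: delta_mx 0 i)%R].
Proof.
move=> mB; rewrite -[X in measurable X]setTI.
suff : measurable_fun setT (fun s : R => (x + s *: delta_mx 0 i)%R) by exact.
apply: measurable_fun_rowP => k; under eq_fun do rewrite axisE.
by apply: measurable_funD => //; apply: measurable_funM.
Qed.

(** The slice bound asks for a bounded set, so [B] is cut by countably many cubes and the bound is
    used with [rho] = 0 on each piece. *)
Lemma lebesgue_rV_slice0 n (i : 'I_n) (B : set 'rV[R]_n) : measurable B ->
  (forall x, lebesgue_measure [set s : R | B (x + s *: delta_mx 0 i)%R] = 0) ->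
  lebesgue_rV R n B = 0.
Proof.
move=> mB Bs.
have -> : B = \bigcup_k (B `&` @cube n k%:R).
  apply/seteqP; split => [x Bx|x [k _ []]//].
  have [k xk] : exists k : nat, forall j, (`|x ord0 j| <= k%:R)%R.
    exists (Num.truncn (\sum_j `|x ord0 j|)).+1 => j.
    apply: ltW; apply: le_lt_trans (truncnS_gt _).
    by rewrite (bigD1 j)//= lerDl sumr_ge0.
  by exists k => //; split => // j; rewrite -ler_norml.
apply: measure_negligible; first by apply: bigcupT_measurable => k; apply: measurableI => //; exact: measurable_cube.
apply: negligible_bigcup => k; apply/negligibleP.
  by apply: measurableI => //; exact: measurable_cube.
have mc := measurableI _ _ mB (@measurable_cube n k%:R).
apply/eqP; rewrite eq_le measure_ge0 andbT.
apply: le_trans (lebesgue_rV_slice_le (i := i) (r := k%:R) (rho := 0) _ _ mc _ _) _ => //.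
  move=> x; apply: (@le_trans _ _ (lebesgue_measure [set s : R | B (x + s *: delta_mx 0 i)%R])); last by rewrite Bs.
  apply: le_measure; rewrite ?inE.
  - exact: measurable_axis_pre.
  - exact: measurable_axis_pre.
  - by move=> s [].
Qed.

Lemma integral_lebesgue_rVS n (f : 'rV[R]_n.+1 -> \bar R) :
  measurable_fun setT f -> (forall x, 0 <= f x) ->
  \int[lebesgue_rV R n.+1]_x f x =
  \int[lebesgue_measure]_s \int[lebesgue_rV R n]_z f (row_cons (s, z)).
Proof.
move=> mf f0.
transitivity (\int[lebesgue_measure \x lebesgue_rV R n]_p (f \o @row_cons R n) p).
  exact: (ge0_integral_pushforward (@measurable_row_cons R n)
    (lebesgue_measure \x lebesgue_rV R n) measurableT mf (fun x _ => f0 x)).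
rewrite fubini_tonelli1// => [|x]; last exact: f0.
by apply: measurableT_comp => //; exact: measurable_row_cons.
Qed.

Lemma integral_lebesgue_rV_prod n (g : R -> R) :
  measurable_fun setT g -> (forall s, 0 <= g s)%R ->
  \int[lebesgue_rV R n]_x (\prod_(i < n) g (x ord0 i))%:E =
  (\int[lebesgue_measure]_s (g s)%:E) ^+ n.
Proof.
move=> mg g0.
have mp k : measurable_fun setT (fun x : 'rV[R]_k => (\prod_(i < k) g (x ord0 i))%:E).
  apply/measurable_EFinP; apply: measurable_prod => i _.
  by apply: measurableT_comp => //; exact: coord_measurable.
have p0 k (x : 'rV[R]_k) : 0 <= (\prod_(i < k) g (x ord0 i))%:E.
  by rewrite lee_fin prodr_ge0.
elim: n => [|n IH].
  rewrite /= integral_dirac//; last exact: mp.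
  by rewrite diracE mem_set// mul1e big_ord0.
rewrite (integral_lebesgue_rVS (mp n.+1) (p0 n.+1)).
set I : \bar R := \int[lebesgue_measure]_s (g s)%:E; rewrite -/I in IH.
have I0 : 0 <= I by apply: integral_ge0 => s _; rewrite lee_fin.
transitivity (\int[lebesgue_measure]_s ((g s)%:E * I ^+ n)).
  apply: eq_integral => s _; rewrite -IH -ge0_integralZl_EFin//; last exact: mp.
  apply: eq_integral => z _; rewrite big_ord_recl row_cons0/= EFinM.
  by under eq_bigr do rewrite row_consS/=.
rewrite ge0_integralZr//.
- by rewrite expeS.
- exact/measurable_EFinP.
- by move=> s _; rewrite lee_fin.
- by rewrite expe_ge0.
Qed.

Lemma measurable_oppV n : measurable_fun setT (-%R : 'rV[R]_n -> 'rV[R]_n).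
Proof.
apply: measurable_fun_rowP => i; under eq_fun do rewrite mxE.
by apply: measurableT_comp => //; exact: coord_measurable.
Qed.

Lemma lebesgue_rVN n (A : set 'rV[R]_n) : measurable A ->
  lebesgue_rV R n (-%R @^-1` A) = lebesgue_rV R n A.
Proof.
elim: n A => [A _|n IH A mA].
  rewrite (_ : _ @^-1` _ = A)//; apply/seteqP.
  by split=> x /=; rewrite (_ : - x = x)%R//; apply/rowP => -[].
have mAN : measurable (-%R @^-1` A : set 'rV[R]_n.+1).
  by rewrite -[X in measurable X]setTI; exact: measurable_oppV.
have mA' := measurable_row_cons_pre mA.
rewrite !lebesgue_rV_xsection.
pose h (s : measurableTypeR R) := lebesgue_rV R n (xsection (@row_cons R n @^-1` A) s).
have mh : measurable_fun setT h := measurable_fun_xsection (lebesgue_rV R n) mA'.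
transitivity (\int[lebesgue_measure]_s h (- s)%R).
  apply: eq_integral => s _ /=; rewrite -[RHS]IH; last exact: measurable_xsection.
  congr (lebesgue_rV R n _); apply/seteqP.
  by split=> z; rewrite /xsection /= !inE /= row_consN.
have mN : measurable_fun setT (-%R : measurableTypeR R -> measurableTypeR R) by [].
have := ge0_integral_pushforward mN lebesgue_measure measurableT mh (fun s _ => measure_ge0 _ _).
rewrite preimage_setT => <-.
by apply: eq_measure_integral => /= B mB _; exact: lebesgue_measureN.
Qed.

End lebesgue_rV_basic.

(** * Measures with a density, and absolute continuity of the integral *)

Section density.
Local Open Scope ereal_scope.
Context d (T : measurableType d) (R : realType) (m : {measure set T -> \bar R}).

(** The proofs about [h] are arguments so that a measure structure can be attached to the term
    [density mh h0] itself. *)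
Definition density (h : T -> R) of measurable_fun setT h & (forall x, (0 <= h x)%R) :
  set T -> \bar R := fun A => \int[m]_(x in A) (h x)%:E.

Context (h : T -> R) (mh : measurable_fun setT h) (h0 : forall x, (0 <= h x)%R).
Local Notation nu := (density mh h0).

Let density0 : nu set0 = 0. Proof. exact: integral_set0. Qed.

Let density_ge0 A : 0 <= nu A.
Proof. by apply: integral_ge0 => x _; rewrite lee_fin. Qed.

Let density_sigma_additive : semi_sigma_additive nu.
Proof.
move=> F mF tF mUF; rewrite /density ge0_integral_bigcup//.
- by apply: is_cvg_ereal_nneg_natsum => k _; exact: density_ge0.
- by apply: measurable_funTS; exact/measurable_EFinP.
- by move=> x _; rewrite lee_fin.
Qed.

HB.instance Definition _ := isMeasure.Build _ _ _ nu
  density0 density_ge0 density_sigma_additive.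

Import HBNNSimple.

Lemma integral_density (f : T -> \bar R) : measurable_fun setT f ->
  (forall x, 0 <= f x) -> \int[nu]_x f x = \int[m]_x (f x * (h x)%:E).
Proof.
move=> mf f0; pose g := nnsfun_approx measurableT mf.
have mg n : measurable_fun setT (EFin \o g n) by apply/measurable_EFinP.
have mgh n : measurable_fun setT (fun x => (g n x)%:E * (h x)%:E).
  by apply: emeasurable_funM => //; exact/measurable_EFinP.
have fE x : f x = lim ((EFin \o g n) x @[n --> \oo]).
  by apply/esym/cvg_lim => //; apply: cvg_nnsfun_approx.
have fgE x : f x * (h x)%:E = lim ((g n x)%:E * (h x)%:E @[n --> \oo]).
  apply/esym/cvg_lim => //; apply: cvgeZr => //.
  by apply: cvg_nnsfun_approx.
have -> : \int[nu]_x f x = \int[nu]_x lim ((EFin \o g n) x @[n --> \oo]).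
  by apply: eq_integral => x _; exact: fE.
have -> : \int[m]_x (f x * (h x)%:E) = \int[m]_x lim ((g n x)%:E * (h x)%:E @[n --> \oo]).
  by apply: eq_integral => x _; exact: fgE.
suff E n : \int[nu]_x (EFin \o g n) x = \int[m]_x ((g n x)%:E * (h x)%:E).
  rewrite !monotone_convergence//.
  - by under eq_fun do rewrite E.
  - by move=> n x _; rewrite mule_ge0// lee_fin.
  - by move=> x _ a b ab; rewrite lee_wpmul2r ?lee_fin//; exact/lefP/nd_nnsfun_approx.
  - by move=> n x _; rewrite lee_fin.
  - by move=> x _ a b ab; rewrite lee_fin; exact/lefP/nd_nnsfun_approx.
transitivity (\int[nu]_x (\sum_(y \in range (g n)) (y * \1_(g n @^-1` [set y]) x)%:E)).
  by apply: eq_integral => t tE; rewrite /= fimfunE -fsumEFin.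
transitivity (\int[m]_x (\sum_(y \in range (g n)) (y * \1_(g n @^-1` [set y]) x)%:E * (h x)%:E)); last first.
  apply: eq_integral => t _; rewrite -ge0_mule_fsuml; last by move=> y; exact: nnfun_muleindic_ge0.
  by rewrite fsumEFin// -(fimfunE _ t).
have mi r : measurable_fun setT (fun x => (r * \1_(g n @^-1` [set r]) x)%:E).
  by apply/measurable_EFinP; apply: measurable_funM.
rewrite ge0_integral_fsum//; last by move=> y x _; exact: nnfun_muleindic_ge0.
rewrite ge0_integral_fsum//; last 2 first.
- move=> r; apply: emeasurable_funM => //; exact/measurable_EFinP.
- by move=> y x _; rewrite mule_ge0// ?lee_fin//; exact: nnfun_muleindic_ge0.
apply: eq_fsbigr => r _; rewrite integralZl_indic_nnsfun// integral_indic// setIT.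
have [r0|r0] := ltP r 0%R.
  rewrite preimage_nnfun0// measure0 mule0.
  by rewrite integral0_eq// => x _; rewrite indic0 mulr0 mul0e.
under eq_integral do rewrite EFinM -muleA.
rewrite ge0_integralZl ?lee_fin//; last 2 first.
- by apply: emeasurable_funM; exact/measurable_EFinP.
- by move=> x _; rewrite mule_ge0// lee_fin.
congr (_ * _); rewrite /= /density integral_mkcond; apply: eq_integral => x _.
by rewrite patchE indicE; case: ifPn => _; rewrite ?mul1e ?mul0e.
Qed.

(** Since [h] is finite everywhere, the sets h > k decrease to the empty set and one of them carries
    less than half of [e]; off it [h] is bounded. *)
Lemma integral_small_on_small : \int[m]_x (h x)%:E < +oo ->
  forall e : R, (0 < e)%R -> exists2 dl : R, (0 < dl)%R &
    forall A, measurable A -> m A <= dl%:E -> \int[m]_(x in A) (h x)%:E <= e%:E.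
Proof.
move=> hoo e e0; pose E k := [set x | (k%:R < h x)%R].
have mE k : measurable (E k).
  rewrite (_ : E k = setT `&` h @^-1` [set` `]k%:R, +oo[%R]); first exact: mh.
  by rewrite setTI; apply/seteqP; split => x /=; rewrite in_itv/= andbT.
have Ecvg : nu (E n) @[n --> \oo] --> nu (\bigcap_n E n).
  apply: nonincreasing_cvg_mu => //.
  - apply: le_lt_trans hoo; apply: ge0_subset_integral => //.
      exact/measurable_EFinP.
    by move=> x _; rewrite lee_fin.
  - exact: bigcap_measurable.
  - by move=> a b ab; apply/subsetPset => x; apply: le_lt_trans; rewrite ler_nat.
have E0 : \bigcap_n E n = set0.
  apply/seteqP; split => // x /(_ (Num.truncn (h x)).+1 I).
  by rewrite /E/= ltNge (ltW (truncnS_gt _)).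
rewrite E0 measure0 in Ecvg.
have e20 : 0 < (e / 2)%:E by rewrite lte_fin divr_gt0.
have := Ecvg _ (open_ereal_lt' e20).
move=> [k _ /(_ _ (leqnn k)) nuk].
(* Off [E k] the integrand is at most k; k + 1 replaces it so that the divisor is positive also for
   k = 0. *)
exists (e / 2 / k.+1%:R)%R; first by rewrite !divr_gt0.
move=> A mA mAd.
have mhE D : measurable D -> measurable_fun D (EFin \o h).
  by move=> mD; apply: measurable_funTS; exact/measurable_EFinP.
have h0E D x : D x -> 0 <= (EFin \o h) x by rewrite lee_fin.
apply: (@le_trans _ _ (nu (E k) + \int[m]_(x in A `\` E k) (h x)%:E)).
  rewrite -ge0_integral_setU//=; last 4 first.
  - exact: measurableD.
  - by apply: mhE; apply: measurableU => //; exact: measurableD.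
  - by move=> x _; rewrite lee_fin.
  - by apply/disj_setPS => x [Ek []].
  apply: ge0_subset_integral => //.
  - by apply: measurableU => //; exact: measurableD.
  - by apply: mhE; apply: measurableU => //; exact: measurableD.
  - by move=> x _; rewrite lee_fin.
  - by move=> x Ax; have [|] := pselect (E k x); [left|right].
rewrite [e in leRHS](splitr e) EFinD leeD ?(ltW nuk)//.
apply: (@le_trans _ _ (\int[m]_(x in A `\` E k) (k.+1%:R)%:E)).
  apply: ge0_le_integral => //.
  - exact: measurableD.
  - by move=> x _; rewrite lee_fin.
  - by apply: mhE; exact: measurableD.
  - by move=> x [_ /negP]; rewrite -leNgt lee_fin => /le_trans; apply; rewrite ler_nat.
rewrite integral_cst; last exact: measurableD.
apply: (@le_trans _ _ (k.+1%:R%:E * (e / 2 / k.+1%:R)%:E)).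
  rewrite lee_wpmul2l ?lee_fin//; apply: le_trans mAd.
  by apply: le_measure; rewrite ?inE//; exact: measurableD.
by rewrite -EFinM lee_fin mulrCA divff ?mulr1.
Qed.

End density.

(** * Euclidean inner product and norm in coordinates *)

Section euclidean.
Context (R : realType) (n : nat).
Implicit Types x y : 'rV[R]_n.

Lemma innerC x y : inner x y = inner y x.
Proof. by apply: eq_bigr => i _; rewrite mulrC. Qed.

Lemma innerDl x y z : inner (x + y) z = inner x z + inner y z.
Proof. by rewrite -big_split/=; apply: eq_bigr => i _; rewrite mxE mulrDl. Qed.

Lemma innerZl a x z : inner (a *: x) z = a * inner x z.
Proof. by rewrite mulr_sumr; apply: eq_bigr => i _; rewrite mxE mulrA. Qed.

Lemma innerNl x z : inner (- x) z = - inner x z.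
Proof. by rewrite -scaleN1r innerZl mulN1r. Qed.

Lemma inner0l z : inner (0 : 'rV[R]_n) z = 0.
Proof. by rewrite -(scale0r 0) innerZl mul0r. Qed.

Lemma inner_axisl i z : inner (delta_mx 0 i : 'rV[R]_n) z = z ord0 i.
Proof.
rewrite /inner (bigD1 i)//= mxE !eqxx mul1r big1 ?addr0// => j /negbTE ji.
by rewrite mxE ji andbF mul0r.
Qed.

Lemma inner_ge0 x : 0 <= inner x x.
Proof. by apply: sumr_ge0 => i _; rewrite -expr2 sqr_ge0. Qed.

Lemma enorm_ge0 x : 0 <= enorm x. Proof. exact: sqrtr_ge0. Qed.

Lemma enormZ a x : enorm (a *: x) = `|a| * enorm x.
Proof.
rewrite /enorm innerZl innerC innerZl mulrA -expr2 sqrtrM ?sqr_ge0//.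
by rewrite sqrtr_sqr.
Qed.

Lemma coord_le_enorm x i : `|x ord0 i| <= enorm x.
Proof.
rewrite -sqrtr_sqr ler_sqrt ?inner_ge0// /inner (bigD1 i)//= -expr2 lerDl.
by apply: sumr_ge0 => j _; rewrite -expr2 sqr_ge0.
Qed.

Lemma enorm0 : enorm (0 : 'rV[R]_n) = 0.
Proof. by rewrite /enorm inner0l sqrtr0. Qed.

Lemma measurable_inner z : measurable_fun setT (fun x => inner x z).
Proof.
apply: measurable_sum => i; apply: measurable_funM => //.
exact: coord_measurable.
Qed.

Lemma measurable_enorm : measurable_fun setT (@enorm R n).
Proof.
apply: measurableT_comp; first by apply: continuous_measurable_fun; exact: sqrt_continuous.
apply: measurable_sum => i; apply: measurable_funM; exact: coord_measurable.
Qed.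

Lemma enorm_le_sum x : enorm x <= \sum_i `|x ord0 i|.
Proof.
have s0 : 0 <= \sum_i `|x ord0 i| by apply: sumr_ge0.
rewrite -[leRHS]ger0_norm// -sqrtr_sqr ler_sqrt ?sqr_ge0// expr2 mulr_suml.
apply: ler_sum => i _; apply: le_trans (ler_norm _) _.
rewrite normrM ler_wpM2l// (bigD1 i)//= lerDl; exact: sumr_ge0.
Qed.

Lemma inner_le_sum x y : `|inner x y| <= \sum_i `|x ord0 i| * `|y ord0 i|.
Proof.
by apply: le_trans (ler_norm_sum _ _ _) _; apply: ler_sum => i _; rewrite normrM.
Qed.

Lemma inner_le_enorm x y : `|inner x y| <= n%:R * enorm y * enorm x.
Proof.
apply: le_trans (inner_le_sum _ _) _.
apply: (@le_trans _ _ (\sum_(i < n) enorm x * enorm y)).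
  by apply: ler_sum => i _; rewrite ler_pM ?coord_le_enorm.
by rewrite sumr_const card_ord -[leLHS]mulr_natl mulrA mulrAC.
Qed.

End euclidean.

(** * Integrability of exponentials of the norm *)

Section exp_integrable.
Context (R : realType).
Local Open Scope ereal_scope.

(** The integrand is dominated by 1 / c times the exponential density plus its reflection, each of
    mass 1. *)
Lemma integral_exp_abs_lty (c : R) : (0 < c)%R ->
  \int[lebesgue_measure]_s (expR (- (c * `|s|)))%:E < +oo.
Proof.
move=> c0; set p := exponential_pdf c.
have mp : measurable_fun setT (EFin \o p).
  by apply/measurable_EFinP; exact: measurable_exponential_pdf.
have mN : measurable_fun setT (-%R : measurableTypeR R -> measurableTypeR R) by [].
have p0 s : (0 <= p s)%R by apply: exponential_pdf_ge0; exact: ltW.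
have mpN : measurable_fun setT (fun s : measurableTypeR R => (p (- s)%R)%:E).
  exact: (measurableT_comp mp mN).
have I1 : \int[lebesgue_measure]_s (p s)%:E = 1 by exact: integral_exponential_pdf.
have I2 : \int[lebesgue_measure]_s (p (- s)%R)%:E = 1.
  have p0' : {in setT, forall s, 0 <= (EFin \o p) s} by move=> s _; rewrite lee_fin.
  have := ge0_integral_pushforward mN lebesgue_measure measurableT mp p0'.
  rewrite preimage_setT => /esym E; apply: (etrans E); rewrite -[RHS]I1.
  by apply: eq_measure_integral => /= B mB _; exact: lebesgue_measureN.
apply: (@le_lt_trans _ _ (\int[lebesgue_measure]_s (c^-1%:E * ((p s)%:E + (p (- s)%R)%:E)))).
  apply: ge0_le_integral => //.
  - apply/measurable_EFinP; apply: measurableT_comp => //.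
    apply: measurableT_comp => //; apply: measurable_funM => //.
  - by apply: measurable_funeM; apply: emeasurable_funD.
  - move=> s _; rewrite -EFinD -EFinM lee_fin /p /exponential_pdf !patchE.
    have [s0|s0] := leP 0%R s.
      rewrite ifT ?inE/= ?in_itv/= ?andbT//.
      rewrite mulrDr mulKf ?gt_eqF// mulNr ger0_norm// lerDl mulr_ge0 ?invr_ge0 ?(ltW c0)//.
      by case: ifP => _; rewrite ?mulr_ge0 ?expR_ge0 ?(ltW c0).
    rewrite [X in (_ + X)%R]ifT ?inE/= ?in_itv/= ?andbT ?oppr_ge0 ?(ltW s0)//.
    rewrite mulrDr mulKf ?gt_eqF//.
    have -> : (- c * - s = - (c * `|s|))%R by rewrite ltr0_norm// mulNr.
    rewrite lerDr mulr_ge0 ?invr_ge0 ?(ltW c0)//.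
    by case: ifP => _; rewrite ?mulr_ge0 ?expR_ge0 ?(ltW c0).
rewrite ge0_integralZl_EFin//; last 3 first.
- by move=> s _; rewrite -EFinD lee_fin addr_ge0.
- by apply: emeasurable_funD.
- by rewrite invr_ge0 ltW.
rewrite ge0_integralD//; last 2 first.
- by move=> s _; rewrite lee_fin.
- by move=> s _; rewrite lee_fin.
by rewrite I1 I2 -EFinD -EFinM ltry.
Qed.

Lemma measurable_exp_enorm n (t : R) :
  measurable_fun setT (fun x : 'rV[R]_n => expR (- (t * enorm x))).
Proof.
apply: measurableT_comp => //; apply: measurableT_comp => //.
by apply: measurable_funM => //; exact: measurable_enorm.
Qed.

(** Each |x_i| is at most |x|, so t |x| >= (t / (n + 1)) sum |x_i| and a product of one-dimensional
    integrals dominates. The n + 1 covers dimension 0. *)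
Lemma integral_exp_enorm_lty n (t : R) : (0 < t)%R ->
  \int[lebesgue_rV R n]_x (expR (- (t * enorm x)))%:E < +oo.
Proof.
move=> t0.
pose c : R := (t / n.+1%:R)%R; have c0 : (0 < c)%R by rewrite divr_gt0.
pose g (s : R) := expR (- (c * `|s|)).
have mg : measurable_fun setT g.
  apply: measurableT_comp => //; apply: measurableT_comp => //.
  by apply: measurable_funM => //; exact: measurableT_comp.
have g0 s : (0 <= g s)%R by exact: expR_ge0.
apply: (@le_lt_trans _ _ (\int[lebesgue_rV R n]_x (\prod_(i < n) g (x ord0 i))%:E)).
  apply: ge0_le_integral => //.
  - by apply/measurable_EFinP; exact: measurable_exp_enorm.
  - apply/measurable_EFinP; apply: measurable_prod => i _.
    by apply: measurableT_comp => //; exact: coord_measurable.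
  - move=> x _; rewrite lee_fin /g -expR_sum ler_expR sumrN lerN2 -mulr_sumr.
    rewrite /c -mulrA ler_wpM2l ?(ltW t0)// mulrC ler_pdivrMr//.
    apply: (@le_trans _ _ (\sum_(i < n) enorm x)%R).
      by apply: ler_sum => i _; exact: coord_le_enorm.
    by rewrite sumr_const card_ord -[leLHS]mulr_natr ler_wpM2l ?enorm_ge0// ler_nat.
rewrite integral_lebesgue_rV_prod//.
have := integral_exp_abs_lty c0.
have : 0 <= \int[lebesgue_measure]_s (g s)%:E.
  by apply: integral_ge0 => s _; rewrite lee_fin.
rewrite -/g; case: (integral _ _ _) => // r _ _.
by rewrite -EFin_expe ltry.
Qed.

End exp_integrable.

Lemma limf_esup_lt (R : realType) (T : choiceType) (X : filteredType T)
    (F : set_system X) (f : X -> \bar R) (a : \bar R) :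
  (limf_esup f F < a)%E -> exists2 V, F V & forall x, V x -> (f x < a)%E.
Proof.
move=> /ereal_inf_lt[_ [V FV <-] Va]; exists V => // x Vx.
by apply: le_lt_trans Va; apply: ereal_sup_ubound; exists x.
Qed.

Lemma limf_einf_lt (R : realType) (T : choiceType) (X : filteredType T)
    (F : set_system X) (f : X -> \bar R) (a : \bar R) :
  (limf_einf f F < a)%E -> forall V, F V -> exists2 x, V x & (f x < a)%E.
Proof.
rewrite limf_einfE => fa V FV.
have : (ereal_inf (f @` V) < a)%E.
  by apply: le_lt_trans fa; apply: ereal_sup_ubound; exists V.
by move=> /ereal_inf_lt[_ [x Vx <-] xa]; exists x.
Qed.

(** * The measure with density w *)

Section weighted_measure.
Context (R : realType) (n : nat) (w : 'rV[R]_n -> R) (hw : weight w).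
Local Notation V := 'rV[R]_n.
Local Notation leb := (lebesgue_rV R n).
Local Open Scope ereal_scope.

(* The weight with the irrelevant value at the origin set to 0, so that it is
   everywhere nonnegative. *)
Definition weight0 (x : V) : R := if x == 0%R then 0%R else w x.

Lemma weight0_ge0 x : (0 <= weight0 x)%R.
Proof.
by rewrite /weight0; case: eqVneq => // x0; exact: ltW (weight_gt0 hw x0).
Qed.

Lemma compact_cube (r : R) : compact (@cube R n r).
Proof.
have -> : @cube R n r = [set x : V | forall i, [set` `[(- r)%R, r]] (x ord0 i)].
  by apply/seteqP; split => x bx i; have := bx i; rewrite /= in_itv/=; exact.
by have := @rV_compact _ n (fun=> [set` `[(- r)%R, r]]) (fun=> @segment_compact _ _ _); exact.
Qed.

Lemma cube_cover : \bigcup_k (@cube R n k%:R) = setT.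
Proof.
apply/seteqP; split => // x _; exists (Num.truncn (enorm x)).+1 => // i.
rewrite -ler_norml; apply: le_trans (coord_le_enorm _ _) _.
exact: ltW (truncnS_gt _).
Qed.

Lemma measurable_set1V (x : V) : measurable [set x].
Proof.
rewrite (_ : [set x] = \bigcap_(i in [set: 'I_n]) (fun y : V => y ord0 i) @^-1` [set x ord0 i]).
  apply: fin_bigcap_measurable => [|i _]; first exact: finite_finset.
  by rewrite -[X in measurable X]setTI; exact: coord_measurable.
apply/seteqP; split => [_ -> i _//|y h].
by apply/rowP => i; exact: h.
Qed.

(** Read off from local integrability, which contains measurability on every compact cube;
    continuity would leave the origin to be treated apart. *)
Lemma measurable_weight : measurable_fun setT w.
Proof.
rewrite -cube_cover; apply/measurable_fun_bigcup => k; first exact: measurable_cube.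
apply/measurable_EFinP.
exact: measurable_int (weight_locally_integrable hw (@compact_cube _)).
Qed.

Lemma measurable_weight0 : measurable_fun setT weight0.
Proof.
apply: measurable_fun_ifT => //; last exact: measurable_weight.
apply: (measurable_fun_bool true); rewrite setTI.
rewrite (_ : _ @^-1` _ = [set 0%R : V]); first exact: measurable_set1V.
by apply/seteqP; split => x /=; [move/eqP|move=> ->; rewrite eqxx].
Qed.

Definition wmeasure : {measure set V -> \bar R} := density leb measurable_weight0 weight0_ge0.

Lemma integral_wmeasure (f : V -> \bar R) : measurable_fun setT f ->
  (forall x, 0 <= f x) -> \int[wmeasure]_x f x = \int[leb]_x (f x * (weight0 x)%:E).
Proof. exact: integral_density. Qed.

(** Absolute continuity with respect to Lebesgue measure, uniform only inside a fixed cube because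
    [w] is merely locally integrable. It will exclude thin sublevel sets. *)
Lemma wmeasure_small (r : R) (e : R) : (0 < e)%R -> exists2 dl : R, (0 < dl)%R &
  forall B, measurable B -> B `<=` @cube R n r -> leb B <= dl%:E -> wmeasure B <= e%:E.
Proof.
move=> e0.
pose h (x : V) := (weight0 x * \1_(@cube R n r) x)%R.
have mh : measurable_fun setT h.
  apply: measurable_funM; first exact: measurable_weight0.
  by apply: measurable_indic; exact: measurable_cube.
have h0 x : (0 <= h x)%R by rewrite mulr_ge0 ?weight0_ge0.
have hE B : measurable B -> B `<=` @cube R n r -> wmeasure B = \int[leb]_(x in B) (h x)%:E.
  move=> mB Br; apply: eq_integral => x; rewrite inE => Bx.
  by rewrite /h indicE mem_set ?mulr1//; exact: Br.
have hfin : \int[leb]_x (h x)%:E < +oo.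
  have -> : \int[leb]_x (h x)%:E = \int[leb]_(x in @cube R n r) (weight0 x)%:E.
    rewrite [RHS]integral_mkcond; apply: eq_integral => x _.
    by rewrite patchE /h indicE; case: ifPn => _; rewrite ?mulr1 ?mulr0.
  have /integrableP[mwi] := weight_locally_integrable hw (@compact_cube r).
  apply: le_lt_trans; apply: ge0_le_integral => //.
  - exact: measurable_cube.
  - by move=> x _; rewrite lee_fin weight0_ge0.
  - by apply: measurable_funTS; apply/measurable_EFinP; exact: measurable_weight0.
  - exact: measurableT_comp.
  - move=> x _; rewrite lee_fin /weight0; case: eqVneq => // _; exact: ler_norm.
have [dl dl0 H] := integral_small_on_small mh h0 hfin e0.
by exists dl => // B mB Br Bd; rewrite hE//; exact: H.
Qed.

(** Subexponential growth gives w(x) <= e^(t |x| / 2) far out, which costs half of the decay; on the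
    remaining cube local integrability suffices. *)
Lemma wmeasure_exp_lty (t : R) : (0 < t)%R ->
  \int[wmeasure]_x (expR (- (t * enorm x)))%:E < +oo.
Proof.
move=> t0.
have mexp s : measurable_fun setT (fun x : V => (expR (- (s * enorm x)))%:E).
  by apply/measurable_EFinP; exact: measurable_exp_enorm.
rewrite integral_wmeasure//.
have t20 : (0 < t / 2)%R by rewrite divr_gt0.
have : limf_esup (fun x => (ln (w x) / enorm x)%:E) (@at_infinity R n) < (t / 2)%:E.
  by rewrite (weight_infinity hw) lte_fin.
move=> /limf_esup_lt[D [M DM] Dw].
(* The maximum with 1 makes |x| > r imply |x| > 0, so that ln w(x) / |x| < t / 2 can be multiplied
   out. *)
pose r : R := Num.max M 1%R.
have mw0 : measurable_fun setT (EFin \o weight0) by apply/measurable_EFinP; exact: measurable_weight0.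
apply: (@le_lt_trans _ _ (\int[leb]_x ((EFin \o weight0) \_ (@cube R n r) x + (expR (- (t / 2 * enorm x)))%:E))).
  apply: ge0_le_integral => //.
  - by move=> x _; rewrite mule_ge0 ?lee_fin ?expR_ge0 ?weight0_ge0.
  - by apply: emeasurable_funM.
  - apply: emeasurable_funD => //; apply/measurable_restrict => //; first exact: measurable_cube.
    exact: measurable_funTS.
  - move=> x _; rewrite patchE; have [xr|xr] := leP (enorm x) r.
      rewrite ifT; last first.
        by rewrite inE => i; rewrite -ler_norml; exact: le_trans (coord_le_enorm _ _) xr.
      apply: (@le_trans _ _ (weight0 x)%:E); last by rewrite leeDl// lee_fin expR_ge0.
      rewrite -EFinM lee_fin ler_piMl ?weight0_ge0// -expR0 ler_expR oppr_le0.
      by rewrite mulr_ge0 ?enorm_ge0// ltW.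
    apply: (@le_trans _ _ (expR (- (t / 2 * enorm x)))%:E); last first.
      by rewrite leeDr//; case: ifP => _ //; rewrite lee_fin weight0_ge0.
    have x0 : (0 < enorm x)%R by apply: lt_trans xr; rewrite lt_max ltr01 orbT.
    have xn0 : x != 0%R by apply: contraTneq x0 => ->; rewrite enorm0 ltxx.
    have := Dw x (DM x _); rewrite lte_fin ltr_pdivrMr// => wx.
    rewrite -EFinM lee_fin /weight0 (negbTE xn0) -[w x]lnK; last first.
      by rewrite posrE (weight_gt0 hw).
    rewrite -expRD ler_expR.
    have := wx (le_lt_trans _ xr); rewrite le_max lexx => /(_ isT) h.
    by lra.
rewrite ge0_integralD//.
- apply: lte_add_pinfty.
  + rewrite -integral_mkcond.
    have /integrableP[mwi] := weight_locally_integrable hw (@compact_cube r).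
    apply: le_lt_trans; apply: ge0_le_integral => //.
    * exact: measurable_cube.
    * by move=> x _; rewrite lee_fin weight0_ge0.
    * exact: measurable_funTS.
    * exact: measurableT_comp.
    * move=> x _; rewrite lee_fin /weight0; case: eqVneq => // _; exact: ler_norm.
  + exact: integral_exp_enorm_lty.
- by move=> x _; rewrite patchE; case: ifP => // _; rewrite lee_fin weight0_ge0.
- apply/measurable_restrict => //; first exact: measurable_cube.
  exact: measurable_funTS.
Qed.

Lemma lebesgue_set0 : (0 < n)%N -> leb [set 0%R : V] = 0.
Proof.
move=> n0; apply: (@lebesgue_rV_slice0 _ _ (Ordinal n0)); first exact: measurable_set1V.
move=> x; set i := Ordinal n0.
apply/eqP; rewrite eq_le measure_ge0 andbT -(lebesgue_measure_set1 (- x ord0 i)%R).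
apply: le_measure; rewrite ?inE.
- by apply: measurable_axis_pre; exact: measurable_set1V.
- exact: measurable_set1.
- move=> s /= /(congr1 (fun v : V => v ord0 i)); rewrite axisE eqxx mulr1 mxE.
  by move=> /eqP; rewrite addrC addr_eq0 => /eqP.
Qed.

(** Otherwise the density would vanish almost everywhere on the cube, although it is positive off
    the origin, a null set for n >= 1. *)
Lemma wmeasure_cube_gt0 (r : R) : (0 < n)%N -> (0 < r)%R -> 0 < wmeasure (@cube R n r).
Proof.
move=> n0 r0; rewrite lt0e measure_ge0 andbT; apply/eqP => c0.
have mc := @measurable_cube R n r.
have mw0 : measurable_fun (@cube R n r) (EFin \o weight0).
  by apply: measurable_funTS; apply/measurable_EFinP; exact: measurable_weight0.
have : ae_eq leb (@cube R n r) (EFin \o weight0) (cst 0).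
  apply/(ae_eq_integral_abs _ mc mw0); rewrite -[RHS]c0.
  by apply: eq_integral => x _; rewrite gee0_abs// lee_fin weight0_ge0.
move=> [N [mN N0 cN]].
have : leb (@cube R n r) <= 0.
  apply: (@le_trans _ _ (leb (N `|` [set 0%R : V]))).
    apply: le_measure; rewrite ?inE//.
      by apply: measurableU => //; exact: measurable_set1V.
    move=> x cx; have [->|x0] := eqVneq x 0%R; [by right|left].
    apply: cN => /= /(_ cx)/eqP; rewrite eqe /weight0 (negbTE x0).
    by rewrite gt_eqF// (weight_gt0 hw).
  apply: (@le_trans _ _ (leb N + leb [set 0%R : V])).
    exact: measureU2 mN (@measurable_set1V _).
  by rewrite (lebesgue_set0 n0) N0 adde0.
by rewrite lebesgue_cube ?(ltW r0)// lee_fin leNgt exprn_gt0// mulr_gt0.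
Qed.

Lemma wmeasureN (A : set V) : even_fun w -> measurable A ->
  wmeasure (-%R @^-1` A) = wmeasure A.
Proof.
move=> ew mA.
have mN := @measurable_oppV R n.
have mAN : measurable (-%R @^-1` A : set V).
  by rewrite -[X in measurable X]setTI; exact: mN.
have mw : measurable_fun A (EFin \o weight0).
  by apply: measurable_funTS; apply/measurable_EFinP; exact: measurable_weight0.
have w0A : {in A, forall x, 0 <= (EFin \o weight0) x}.
  by move=> x _; rewrite lee_fin weight0_ge0.
have E := ge0_integral_pushforward mN leb mA mw w0A.
transitivity (\int[leb]_(x in -%R @^-1` A) ((EFin \o weight0) \o -%R) x).
  apply: eq_integral => x _ /=; congr EFin.
  by rewrite /weight0 oppr_eq0; case: eqVneq => // _; rewrite ew.
rewrite -E; apply: eq_measure_integral => B mB BA; exact: lebesgue_rVN.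
Qed.

End weighted_measure.

(** * Legendre conjugates *)

Section conjugate.
Context (R : realType) (n : nat).
Local Notation V := 'rV[R]_n.
Implicit Types (phi psi : V -> \bar R) (x y : V).

Definition legendre psi x : \bar R := ereal_sup [set ((inner x y)%:E - psi y)%E | y in [set: V]].

Lemma legendre_ub psi x y : ((inner x y)%:E - psi y <= legendre psi x)%E.
Proof. by apply: ereal_sup_ubound; exists y. Qed.

(** The working form of the conjugate: an upper bound at [x] is an affine minorant of [psi], which
    can be symmetrized, integrated and passed to lower limits. *)
Lemma legendre_leP psi x (r : R) :
  (legendre psi x <= r%:E)%E <-> forall y, ((inner x y - r)%:E <= psi y)%E.
Proof.
split=> [h y|h].
  have := le_trans (legendre_ub psi x y) h; case: (psi y) => [s| |]//=.
  - by rewrite !lee_fin; lra.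
  - by rewrite leey.
apply: ge_ereal_sup => _ [y _ <-]; have := h y; case: (psi y) => [s| |]//=.
- by rewrite -EFinB !lee_fin; lra.
- by rewrite leNye.
Qed.

(* Convexity of a function to [-oo, +oo] expressed through its epigraph, which
   avoids extended arithmetic altogether. *)
Definition epi_convex phi := forall x y (r s t : R), 0 <= t <= 1 ->
  (phi x <= r%:E)%E -> (phi y <= s%:E)%E ->
  (phi (t *: x + (1 - t) *: y)%R <= (t * r + (1 - t) * s)%:E)%E.

Lemma legendre_convex psi : epi_convex (legendre psi).
Proof.
move=> x y r s t /andP[t0 t1] /legendre_leP xr /legendre_leP ys; apply/legendre_leP => z.
rewrite innerDl !innerZl.
have := xr z; have := ys z; case: (psi z) => [q| |]//=; last by move=> *; rewrite leey.
rewrite !lee_fin => h1 h2.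
have := ler_wpM2l t0 h2; have t1' : 0 <= 1 - t by lra.
have := ler_wpM2l t1' h1; lra.
Qed.

Lemma epi_convex_efun phi : (forall x, phi x != -oo%E) -> epi_convex phi -> convex_efun phi.
Proof.
move=> phiN cphi; split => // x y t /andP[t0 t1].
have t1' : 0 < 1 - t by lra.
have := phiN x; have := phiN y; case Ex : (phi x) => [r| |]//; case Ey : (phi y) => [s| |]// _ _.
- rewrite -!EFinM -EFinD; apply: cphi; rewrite ?Ex ?Ey//; lra.
- by rewrite gt0_muley ?lte_fin// -EFinM addey// leey.
- by rewrite gt0_muley ?lte_fin// -EFinM addye// leey.
- by rewrite !gt0_muley ?lte_fin// leey.
Qed.

Lemma continuous_inner y : continuous (fun x : V => inner x y).
Proof.
move=> x; rewrite /inner; apply: (@cvg_big _ _ _ _ _ (@add_continuous R) _ (nbhs x) _ _ _ (nbhs_filter x)) => i _.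
by apply: cvgM; [exact: coord_continuous|exact: cvg_cst].
Qed.

Lemma legendre_lsc psi : lower_semicontinuous (legendre psi).
Proof.
move=> x a /ereal_sup_gt[_ [y _ <-]] ay.
suff : \forall z \near x, (a%:E < (inner z y)%:E - psi y)%E.
  move=> N; exists [set z | (a%:E < (inner z y)%:E - psi y)%E]; first exact: N.
  by move=> z /= /lt_le_trans; apply; exact: legendre_ub.
move: ay; case: (psi y) => [s| |]//=; last by move=> _; near=> z; rewrite ltry.
rewrite -EFinB lte_fin => h.
have h' : a + s < inner x y by lra.
apply: filterS (cvgr_gt _ (@continuous_inner y x) _ h') => z.
by rewrite -EFinB lte_fin; lra.
Unshelve. all: by end_near. Qed.

Lemma open_measurableV (U : set V) : open U -> measurable U.
Proof. exact: sub_sigma_algebra. Qed.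

Lemma lower_semicontinuous_measurableV (f : V -> \bar R) :
  lower_semicontinuous f -> measurable_fun setT f.
Proof.
move=> /lower_semicontinuousP fo.
apply: (measurability (@ErealGenOInfty.G R) (ErealGenOInfty.measurableE R)) => _ [_ [a ->] <-].
rewrite setTI; apply: open_measurableV; rewrite preimage_itvoy; exact: fo.
Qed.

Lemma measurable_legendre psi : measurable_fun setT (legendre psi).
Proof. exact: lower_semicontinuous_measurableV (@legendre_lsc psi). Qed.

Lemma legendre_even psi : (forall y, psi (- y) = psi y) ->
  forall x, legendre psi (- x) = legendre psi x.
Proof.
move=> ev x; congr ereal_sup; apply/seteqP; split => _ [y _ <-]; exists (- y) => //.
  by rewrite ev innerNl innerC innerNl innerC.
by rewrite ev innerNl innerC innerNl opprK innerC.
Qed.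

Lemma legendre_le psi psi' : (forall y, (psi y <= psi' y)%E) ->
  forall x, (legendre psi' x <= legendre psi x)%E.
Proof.
move=> h x; apply: ge_ereal_sup => _ [y _ <-]; apply: le_trans (legendre_ub psi x y).
exact: leeB.
Qed.

Lemma legendre_addr psi (t : R) x :
  legendre (fun y => psi y + t%:E)%E x = (legendre psi x - t%:E)%E.
Proof.
apply/eqP; rewrite eq_le; apply/andP; split.
  apply: ge_ereal_sup => _ [y _ <-]; rewrite leeBrDr//.
  have := legendre_ub psi x y; congr (_ <= _)%E.
  by case: (psi y) => [q| |]//=; congr EFin; lra.
rewrite leeBlDr//; apply: ge_ereal_sup => _ [y _ <-].
rewrite -leeBlDr//; have := legendre_ub (fun y => psi y + t%:E)%E x y; congr (_ <= _)%E.
by case: (psi y) => [q| |]//=; congr EFin; lra.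
Qed.

End conjugate.

(** * Convex functions on the line *)

Section convex_line.
Context (R : realType).
Implicit Types (h : R -> \bar R) (s t u r : R).

Definition epi_convex1 h := forall x y (r s t : R), 0 <= t <= 1 ->
  (h x <= r%:E)%E -> (h y <= s%:E)%E ->
  (h (t * x + (1 - t) * y)%R <= (t * r + (1 - t) * s)%:E)%E.

Lemma epi_convex1_chord h (s u t r q : R) : epi_convex1 h -> s < u -> s <= t <= u ->
  (h s <= r%:E)%E -> (h u <= q%:E)%E ->
  (h t <= (r + (q - r) / (u - s) * (t - s))%:E)%E.
Proof.
move=> ch su /andP[st tu] hs hu.
have us0 : u - s != 0 by rewrite gt_eqF// subr_gt0.
have us1 : 0 < u - s by rewrite subr_gt0.
have k01 : 0 <= (u - t) / (u - s) <= 1.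
  by rewrite divr_ge0 ?subr_ge0 ?(ltW su)//= ler_pdivrMr// mul1r lerD2l lerN2.
have := ch _ _ _ _ _ k01 hs hu; congr (h _ <= _)%E; last congr EFin; field.
all: exact: us0.
Qed.

Lemma epi_convex1_right h (a s d r c : R) : epi_convex1 h -> 0 < d -> 0 <= s <= d ->
  (h a <= r%:E)%E -> (h (a + d)%R <= (r + c * d)%:E)%E -> (h (a + s)%R <= (r + c * s)%:E)%E.
Proof.
move=> ch d0 /andP[s0 sd] ha hd.
have := @epi_convex1_chord h a (a + d) (a + s) _ _ ch _ _ ha hd.
rewrite ltrDl => /(_ d0); rewrite lerDl lerD2l s0 sd => /(_ isT).
rewrite (_ : a + d - a = d); last by lra.
rewrite (_ : a + s - a = s); last by lra.
rewrite (_ : (r + c * d - r) / d = c)//.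
by field; rewrite gt_eqF.
Qed.

Lemma epi_convex1_left h (a s d r c : R) : epi_convex1 h -> 0 < d -> 0 <= s <= d ->
  (h a <= r%:E)%E -> (h (a - d)%R <= (r - c * d)%:E)%E -> (h (a - s)%R <= (r - c * s)%:E)%E.
Proof.
move=> ch d0 /andP[s0 sd] ha hd.
have chN : epi_convex1 (h \o -%R).
  move=> x y r1 s1 t1 t01 h1 h2 /=; have := ch _ _ _ _ _ t01 h1 h2.
  by congr (h _ <= _)%E; lra.
have := @epi_convex1_right (h \o -%R) (- a) s d r (- c) chN d0.
rewrite s0 sd /= opprK !opprD !opprK => /(_ isT ha); rewrite !mulNr => /(_ hd).
exact.
Qed.

(* Points where the left and right derivatives of [h] differ by at least [e]. *)
Definition kink h (e : R) := [set s | (h s < +oo)%E /\ forall m : nat,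
  (h s + h s + (e / m.+1%:R)%:E <= h (s + m.+1%:R^-1)%R + h (s - m.+1%:R^-1)%R)%E].

(** At a kink inside the domain a rational lies strictly between the left and right derivatives and
    is the slope of a line touching [h] at that point only; such a slope determines the point.
    Otherwise the kink is one of the at most two endpoints of the domain. *)
Lemma kink_countable h (e : R) : (forall s, h s != -oo%E) -> epi_convex1 h -> 0 < e -> countable (kink h e).
Proof.
move=> hN ch e0.
pose dom := [set s | (h s < +oo)%E].
have domE s : dom s -> exists r, h s = r%:E.
  by move: (hN s); rewrite /dom/=; case: (h s) => // r _ _; exists r.
pose A1 := [set s | dom s /\ forall t, dom t -> s <= t].
pose A2 := [set s | dom s /\ forall t, dom t -> t <= s].
(* Strict support lines of slope q: for two distinct points of [B q] the two inequalities add up to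
   a contradiction. *)
pose B (q : rat) := [set s | dom s /\ forall t, t != s -> (h s + (ratr q * (t - s))%:E < h t)%E].
have sub1 (A : set R) : (forall s t, A s -> A t -> s = t) -> countable A.
  move=> A1'; have [[a Aa]|nA] := pselect (exists a, A a).
    apply: (@sub_countable _ _ _ [set a]); last exact: countable1.
    by apply: subset_card_le => s As; rewrite /= (A1' s a).
  rewrite (_ : A = set0)//; apply/seteqP; split => // s As.
  by apply: nA; exists s.
pose F (i : rat + bool) := match i with inl q => B q | inr b => if b then A1 else A2 end.
apply: (@sub_countable _ _ _ (\bigcup_i F i)); last first.
  apply: bigcup_countable => // -[q|[]] _; apply: sub1; rewrite /F; last first.
  - move=> s t [ds hs] [dt ht]; apply/eqP; rewrite eq_le.
    by rewrite hs ?ht.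
  - move=> s t [ds hs] [dt ht]; apply/eqP; rewrite eq_le.
    by rewrite hs ?ht.
  - move=> s t [ds hs] [dt ht]; apply/eqP; case: (eqVneq s t) => // st.
    have [r rE] := domE _ ds; have [r' r'E] := domE _ dt.
    have := ht _ st; rewrite eq_sym in st; have := hs _ st.
    by rewrite rE r'E -!EFinD !lte_fin; lra.
apply: subset_card_le => s [ds hs].
have [[a [da as_]]|na] := pselect (exists a, dom a /\ a < s); last first.
  exists (inr true) => //; split => // t dt; rewrite leNgt; apply/negP => ts.
  by apply: na; exists t.
have [[b [db sb]]|nb] := pselect (exists b, dom b /\ s < b); last first.
  exists (inr false) => //; split => // t dt; rewrite leNgt; apply/negP => ts.
  by apply: nb; exists t.
have [r rE] := domE _ ds.
(* Numbers not exceeding some left difference quotient at [s]; their supremum is the left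
   derivative. *)
pose SL := [set c : R | exists d, 0 < d /\ (h (s - d)%R <= (r - c * d)%:E)%E].
(* Difference quotients are monotone, so both steps may be shortened to a common 1 / (m + 1), where
   the kink inequality separates the slopes by [e]. *)
have gap c c' d' : SL c -> 0 < d' -> (h (s + d')%R <= (r + c' * d')%:E)%E -> c + e <= c'.
  move=> [d [d0 hd]] d'0 hd'.
  have dd0 : 0 < Num.min d d' by rewrite lt_min d0.
  pose m := Num.truncn (Num.min d d')^-1.
  have md : m.+1%:R^-1 <= Num.min d d'.
    rewrite -[leRHS]invrK lef_pV2 ?posrE ?invr_gt0//.
    exact: ltW (truncnS_gt _).
  have := hs m; set k : R := m.+1%:R^-1 in md *.
  have k0 : 0 < k by rewrite /k invr_gt0.
  have kd : 0 <= k <= d by rewrite (ltW k0) (le_trans md)// ge_min lexx.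
  have kd' : 0 <= k <= d' by rewrite (ltW k0) (le_trans md)// ge_min lexx orbT.
  have hsr : (h s <= r%:E)%E by rewrite rE.
  have h1 := epi_convex1_left ch d0 kd hsr hd.
  have h2 := epi_convex1_right ch d'0 kd' hsr hd'.
  rewrite rE => H; have := le_trans H (leeD h2 h1).
  rewrite -!EFinD lee_fin -/k => H'.
  have : k * (c + e) <= k * c' by lra.
  by rewrite ler_pM2l.
have SL0 : SL !=set0.
  have [q qE] := domE _ da.
  exists ((r - q) / (s - a)); exists (s - a); split; first by rewrite subr_gt0.
  rewrite opprB addrC subrK qE lee_fin divfK ?gt_eqF ?subr_gt0//; lra.
have [c' [d' [d'0 hd']]] : exists c' d', 0 < d' /\ (h (s + d')%R <= (r + c' * d')%:E)%E.
  have [q qE] := domE _ db.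
  exists ((q - r) / (b - s)), (b - s); split; first by rewrite subr_gt0.
  rewrite addrC subrK qE lee_fin divfK ?gt_eqF ?subr_gt0//; lra.
have SLub : has_ubound SL by exists (c' - e) => c Sc; have := gap _ _ _ Sc d'0 hd'; lra.
have lsup : sup SL < sup SL + e by rewrite ltrDl.
have [q] := rat_in_itvoo lsup; rewrite in_itv/= => /andP[q1 q2].
exists (inl q) => //; split => // t ts; rewrite ltNge; apply/negP => ht.
have {}ht : (h t <= (r + ratr q * (t - s))%:E)%E by rewrite EFinD -rE.
have [tles|st] := ltP t s.
  have : SL (ratr q).
    exists (s - t); split; first by rewrite subr_gt0.
    rewrite opprB addrC subrK; apply: le_trans ht _; rewrite lee_fin; lra.
  by move=> /(ub_le_sup SLub); rewrite leNgt q1.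
have st' : 0 < t - s by rewrite subr_gt0 lt_neqAle eq_sym ts.
have : sup SL <= ratr q - e.
  apply: ge_sup => // c Sc.
  have := gap _ (ratr q) _ Sc st'; rewrite addrC subrK => /(_ ht); lra.
lra.
Qed.

(** Left quotients lie below right quotients, and without a kink they come arbitrarily close; the
    left derivative is therefore both a subgradient and the two-sided derivative. *)
Lemma not_kink_derivative h (a : R) : (forall s, h s != -oo%E) -> epi_convex1 h -> (h a < +oo)%E ->
  (forall e : R, 0 < e -> exists m : nat,
    (h (a + m.+1%:R^-1)%R + h (a - m.+1%:R^-1)%R < h a + h a + (e / m.+1%:R)%:E)%E) ->
  exists c : R, (forall s, (h a + (s * c)%:E <= h (a + s)%R)%E) /\
    forall e : R, 0 < e -> exists2 d : R, 0 < d & forall s : R, `|s| <= d ->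
      (h (a + s)%R <= h a + (s * c + e * `|s|)%:E)%E.
Proof.
move=> hN ch ha nk.
have [r rE] : exists r, h a = r%:E.
  by move: (hN a) ha; case: (h a) => // r _ _; exists r.
have har : (h a <= r%:E)%E by rewrite rE.
pose SL := [set c : R | exists d, 0 < d /\ (h (a - d)%R <= (r - c * d)%:E)%E].
have gap c c' d' : SL c -> 0 < d' -> (h (a + d')%R <= (r + c' * d')%:E)%E -> c <= c'.
  move=> [d [d0 hd]] d'0 hd'.
  pose k := Num.min d d'.
  have k0 : 0 < k by rewrite lt_min d0.
  have kd : 0 <= k <= d by rewrite (ltW k0) ge_min lexx.
  have kd' : 0 <= k <= d' by rewrite (ltW k0) ge_min lexx orbT.
  have h1 := epi_convex1_left ch d0 kd har hd.
  have h2 := epi_convex1_right ch d'0 kd' har hd'.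
  have h01 : 0 <= (2^-1 : R) <= 1 by apply/andP; split; lra.
  have := ch _ _ _ _ _ h01 h1 h2; rewrite (_ : 2^-1 * (a - k) + (1 - 2^-1) * (a + k) = a); last by lra.
  rewrite rE lee_fin => H.
  have : k * c <= k * c' by lra.
  by rewrite ler_pM2l.
(* [c1] and [c2] are the left and right quotients at step 1 / (m + 1); failure of the kink
   inequality says c2 - c1 < e. *)
have two e : 0 < e -> exists d, 0 < d /\ exists c1 c2, [/\ c2 < c1 + e,
    (h (a - d)%R <= (r - c1 * d)%:E)%E & (h (a + d)%R <= (r + c2 * d)%:E)%E].
  move=> /nk[m]; set k : R := m.+1%:R^-1; have k0 : 0 < k by rewrite invr_gt0.
  have := hN (a + k); have := hN (a - k); rewrite rE.
  case E1 : (h (a - k)%R) => [p| |]//; case E2 : (h (a + k)%R) => [q| |]// _ _.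
  rewrite -!EFinD lte_fin => H; exists k; split => //.
  exists ((r - p) / k), ((q - r) / k); split.
  - rewrite ltr_pdivrMr// mulrDl divfK ?gt_eqF//; lra.
  - by rewrite E1 lee_fin divfK ?gt_eqF//; lra.
  - by rewrite E2 lee_fin divfK ?gt_eqF//; lra.
have [d1 [d10 [p1 [p2 [_ hp1 hp2]]]]] := two _ ltr01.
have SL0 : SL !=set0 by exists p1, d1.
have SLub : has_ubound SL by exists p2 => c Sc; exact: gap Sc d10 hp2.
exists (sup SL); split.
  move=> s; rewrite rE leNgt; apply/negP => hs.
  have [s0|s0|s0] := ltgtP s 0; last by move: hs; rewrite s0 mul0r addr0 adde0 rE ltxx.
  - have [q qE] : exists q, h (a + s) = q%:E.
      by move: (hN (a + s)) hs; case: (h (a + s)%R) => // q _ _; exists q.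
    move: hs; rewrite qE lte_fin => hs.
    have : SL ((r - q) / - s).
      exists (- s); rewrite oppr_gt0; split => //.
      by rewrite opprK qE lee_fin divfK ?oppr_eq0 ?lt_eqF//; lra.
    move=> /(ub_le_sup SLub); rewrite ler_pdivrMr ?oppr_gt0//; lra.
  - have [q qE] : exists q, h (a + s) = q%:E.
      by move: (hN (a + s)) hs; case: (h (a + s)%R) => // q _ _; exists q.
    move: hs; rewrite qE lte_fin => hs.
    have : sup SL <= (q - r) / s.
      apply: ge_sup => // c Sc; apply: (gap _ _ _ Sc s0).
      rewrite qE lee_fin divfK ?gt_eqF//; lra.
    rewrite ler_pdivlMr//; lra.
move=> e e0; have [d [d0 [c1 [c2 [c12 h1 h2]]]]] := two _ e0.
have c1s : c1 <= sup SL by apply: ub_le_sup => //; exists d.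
have sc2 : sup SL <= c2 by apply: ge_sup => // c Sc; exact: gap Sc d0 h2.
exists d => // s sd; rewrite rE.
have [s0|s0] := leP 0 s.
  have sd' : 0 <= s <= d by rewrite s0 -(ger0_norm s0).
  apply: le_trans (epi_convex1_right ch d0 sd' har h2) _.
  rewrite lee_fin ger0_norm//; have : s * c2 <= s * (sup SL + e).
    by rewrite ler_wpM2l//; lra.
  lra.
have sd' : 0 <= - s <= d by rewrite oppr_ge0 (ltW s0) -(ltr0_norm s0).
have := epi_convex1_left ch d0 sd' har h1; rewrite opprK => /le_trans; apply.
rewrite lee_fin ltr0_norm//; have : (- s) * (sup SL - e) <= (- s) * c1.
  by rewrite ler_wpM2l ?oppr_ge0 ?(ltW s0)//; lra.
lra.
Qed.

End convex_line.

(** * Differentiability of convex functions almost everywhere *)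

Section smooth_points.
Context (R : realType) (n : nat).
Local Notation V := 'rV[R]_n.
Local Notation e_ i := (delta_mx 0 i : V).
Implicit Types (phi : V -> \bar R) (x y z : V).

Lemma coord_le_norm (x : V) i : `|x ord0 i| <= `|x|.
Proof. by rewrite [leRHS]/Num.norm /= mx_normrE; apply/bigmax_geP; right => /=; exists (ord0, i). Qed.

Lemma epi_convex_line phi x i : epi_convex phi -> epi_convex1 (fun s => phi (x + s *: e_ i)%R).
Proof.
move=> ch a b r s t t01 ha hb; have := ch _ _ _ _ _ t01 ha hb.
congr (phi _ <= _)%E; apply/rowP => k; rewrite !mxE; ring.
Qed.

(** The steps 1 / (m + 1) suffice by monotonicity of difference quotients and make the set a
    countable intersection, hence measurable. *)
Definition axis_kink phi i (e : R) : set V := [set x | (phi x < +oo)%E /\ forall m : nat,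
  (phi x + phi x + (e / m.+1%:R)%:E <=
   phi (x + m.+1%:R^-1 *: e_ i)%R + phi (x + (- m.+1%:R^-1) *: e_ i)%R)%E].

Lemma measurable_shift (v : V) : measurable_fun setT (fun x : V => x + v).
Proof.
apply: measurable_fun_rowP => i; under eq_fun do rewrite mxE.
by apply: measurable_funD => //; exact: coord_measurable.
Qed.

Lemma measurable_lt_pinfty d (T : measurableType d) (f : T -> \bar R) :
  measurable_fun setT f -> measurable [set x | (f x < +oo)%E].
Proof. by move=> mf; rewrite -[X in measurable X]setTI; exact: emeasurable_fun_infty_o. Qed.

Lemma measurable_axis_kink phi i e : measurable_fun setT phi -> measurable (axis_kink phi i e).
Proof.
move=> mphi.
have mph v : measurable_fun setT (fun x => phi (x + v)).
  exact: measurableT_comp mphi (measurable_shift v).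
have -> : axis_kink phi i e = [set x | (phi x < +oo)%E] `&` \bigcap_m
    [set x | (phi x + phi x + (e / m.+1%:R)%:E <=
      phi (x + m.+1%:R^-1 *: e_ i)%R + phi (x + (- m.+1%:R^-1) *: e_ i)%R)%E].
  by apply/seteqP; split => x [h1 h2]; split => // m; [move=> _; exact: h2|exact: h2].
apply: measurableI; first exact: measurable_lt_pinfty.
apply: bigcapT_measurable => m; rewrite -[X in measurable X]setTI.
apply: measurable_lee => //.
  by apply: emeasurable_funD => //; exact: emeasurable_funD.
exact: emeasurable_funD.
Qed.

(** Each line parallel to axis [i] meets the set in countably many points, so all its slices are
    null. *)
Lemma lebesgue_axis_kink phi i e : (forall x, phi x != -oo%E) -> epi_convex phi ->
  measurable_fun setT phi -> 0 < e -> lebesgue_rV R n (axis_kink phi i e) = 0%E.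
Proof.
move=> phiN cphi mphi e0; apply: (@lebesgue_rV_slice0 _ _ i); first exact: measurable_axis_kink.
move=> x; apply: countable_lebesgue_measure0.
have := kink_countable (fun s => phiN _) (epi_convex_line (x := x) (i := i) cphi) e0.
congr countable; apply/seteqP; split => s [h1 h2]; split => // m; have := h2 m;
  by rewrite -!addrA -!scalerDl.
Qed.

(* Differentiability along the coordinate axes, in a form that is visibly
   measurable; for a convex function it is equivalent to differentiability. *)
Definition smooth phi : set V := [set x | (phi x < +oo)%E /\
  forall i (k : nat), ~ axis_kink phi i k.+1%:R^-1 x].

Lemma smoothE phi : smooth phi = [set x | (phi x < +oo)%E] `\`
  \bigcup_k \bigcup_(i in [set: 'I_n]) axis_kink phi i k.+1%:R^-1.
Proof.
apply/seteqP; split => [x [h1 h2]|x [h1 h2]]; split => //.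
  by move=> [k _ [i _]]; exact: h2.
by move=> i k h; apply: h2; exists k => //; exists i.
Qed.

Lemma measurable_smooth phi : measurable_fun setT phi -> measurable (smooth phi).
Proof.
move=> mphi; rewrite smoothE; apply: measurableD; first exact: measurable_lt_pinfty.
apply: bigcupT_measurable => k; apply: fin_bigcup_measurable => [|i _]; first exact: finite_finset.
exact: measurable_axis_kink.
Qed.

Lemma lebesgue_not_smooth phi : (forall x, phi x != -oo%E) -> epi_convex phi ->
  measurable_fun setT phi ->
  lebesgue_rV R n ([set x | (phi x < +oo)%E] `\` smooth phi) = 0%E.
Proof.
move=> phiN cphi mphi; apply: measure_negligible.
  by apply: measurableD; [exact: measurable_lt_pinfty|exact: measurable_smooth].
apply: (@negligibleS _ _ _ _ (\bigcup_k \bigcup_(i in [set: 'I_n]) axis_kink phi i k.+1%:R^-1)).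
  by rewrite smoothE setDD => x [].
apply: negligible_bigcup => k.
pose F (j : nat) := oapp (fun i : 'I_n => axis_kink phi i k.+1%:R^-1) set0 (insub j).
apply: (@negligibleS _ _ _ _ (\bigcup_j F j)).
  by move=> x [i _ ix]; exists (val i) => //; rewrite /F valK.
apply: negligible_bigcup => j; rewrite /F; case: insub => [i|]; last exact: negligible_set0.
apply/negligibleP; first exact: measurable_axis_kink.
exact: lebesgue_axis_kink.
Qed.

(** The coordinates of [y] are the partial derivatives, stated without division so that values +oo
    elsewhere on the axis need no care. The lower bound can be global because phi will be convex. *)
Definition axis_gradient phi x y := (phi x < +oo)%E /\ forall i,
  (forall s, (phi x + (s * y ord0 i)%:E <= phi (x + s *: e_ i)%R)%E) /\
  forall e : R, 0 < e -> exists2 d : R, 0 < d & forall s : R, `|s| <= d ->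
    (phi (x + s *: e_ i)%R <= phi x + (s * y ord0 i + e * `|s|)%:E)%E.

Lemma smooth_axis_gradient phi x : (forall x, phi x != -oo%E) -> epi_convex phi ->
  smooth phi x -> exists y, axis_gradient phi x y.
Proof.
move=> phiN cphi [xoo nk].
have H i : exists c, (forall s, (phi x + (s * c)%:E <= phi (x + s *: e_ i)%R)%E) /\
  forall e : R, 0 < e -> exists2 d : R, 0 < d & forall s : R, `|s| <= d ->
    (phi (x + s *: e_ i)%R <= phi x + (s * c + e * `|s|)%:E)%E.
  have x0 : x + 0 *: e_ i = x by rewrite scale0r addr0.
  have := @not_kink_derivative _ _ 0 (fun s => phiN _) (epi_convex_line (x := x) (i := i) cphi).
  rewrite x0 => /(_ xoo) [|c [c1 c2]].
    move=> e e0; pose k := Num.truncn e^-1.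
    have ke : k.+1%:R^-1 <= e.
      rewrite -[leRHS]invrK lef_pV2 ?posrE ?invr_gt0//; exact: ltW (truncnS_gt _).
    have /existsNP[m /negP] : ~ forall m : nat, (phi x + phi x + (k.+1%:R^-1 / m.+1%:R)%:E <=
   phi (x + m.+1%:R^-1 *: e_ i)%R + phi (x + (- m.+1%:R^-1) *: e_ i)%R)%E.
      by move=> h; apply: (nk i k); split.
    rewrite -ltNge => hm; exists m; rewrite add0r sub0r; apply: lt_le_trans hm _.
    by rewrite leeD2l// lee_fin ler_wpM2r ?invr_ge0.
  exists c; split => [s|e /c2[d d0 hd]]; first by have := c1 s; rewrite add0r.
  by exists d => // s /hd; rewrite add0r.
have [c hc] := choice H; exists (\row_i c i); split => // i.
by rewrite mxE; exact: hc.
Qed.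

Lemma epi_convex_mean phi k (p : nat -> V) (r : nat -> R) : epi_convex phi ->
  (forall j, (j < k.+1)%N -> (phi (p j) <= (r j)%:E)%E) ->
  (phi (k.+1%:R^-1 *: \sum_(j < k.+1) p j)%R <= (k.+1%:R^-1 * \sum_(j < k.+1) r j)%:E)%E.
Proof.
move=> cphi; elim: k => [|k IH] hp.
  by rewrite !big_ord_recl !big_ord0 !addr0 invr1 scale1r mul1r; exact: hp.
have k0 : (k.+1%:R : R) != 0 by rewrite pnatr_eq0.
have k20 : (k.+2%:R : R) != 0 by rewrite pnatr_eq0.
have t01 : 0 <= (k.+1%:R / k.+2%:R : R) <= 1.
  by rewrite divr_ge0//= ler_pdivrMr// mul1r ler_nat.
have := cphi _ _ _ _ _ t01 (IH (fun j jk => hp j (ltnW jk))) (hp k.+1 (ltnSn _)).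
have c1 : k.+1%:R / k.+2%:R * k.+1%:R^-1 = k.+2%:R^-1  :> R by rewrite mulrAC divff// mul1r.
have c2 : 1 - k.+1%:R / k.+2%:R = k.+2%:R^-1 :> R.
  rewrite [X in X - _](_ : 1 = k.+2%:R / k.+2%:R); last by rewrite divff.
  by rewrite -mulrBl -natrB// subSnn mul1r.
rewrite scalerA mulrA c1 c2 -scalerDr -mulrDr.
by rewrite [\sum_(j < k.+2) p j]big_ord_recr [\sum_(j < k.+2) r j]big_ord_recr.
Qed.

(** x + z is the mean of the n points x + n z_i e_i: bounds along the axes reach all directions at
    the cost of a factor n in the step. *)
Lemma epi_convex_axes phi x z (r : 'I_n -> R) : (0 < n)%N -> epi_convex phi ->
  (forall i, (phi (x + (n%:R * z ord0 i) *: e_ i)%R <= (r i)%:E)%E) ->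
  (phi (x + z)%R <= (n%:R^-1 * \sum_i r i)%:E)%E.
Proof.
move=> n0 cphi hp; have n0' : 0 < (n%:R : R) by rewrite ltr0n.
pose p (j : 'I_n) := x + (n%:R * z ord0 j) *: e_ j.
have nE : n = n.-1.+1 by rewrite prednK.
pose ord (j : nat) : 'I_n := insubd (Ordinal n0) j.
have := @epi_convex_mean phi n.-1 (p \o ord) (r \o ord) cphi (fun j _ => hp _).
rewrite -nE.
have sumE (T : nmodType) (f : 'I_n -> T) : \sum_(j < n) (f \o ord) j = \sum_j f j.
  by apply: eq_bigr => j _ /=; congr f; apply: val_inj; rewrite val_insubd ltn_ord.
rewrite (sumE _ p) (sumE _ r).
rewrite (_ : n%:R^-1 *: (\sum_j p j) = x + z)//.
rewrite big_split/= sumr_const card_ord scalerDr -[x *+ n]scaler_nat scalerA mulVf ?scale1r ?gt_eqF//.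
congr (_ + _); rewrite scaler_sumr [RHS]row_sum_delta.
by apply: eq_bigr => j _; rewrite scalerA mulrA mulVf ?mul1r ?gt_eqF.
Qed.

Lemma epi_convex_box phi z (rho b : R) : (0 < n)%N -> 0 < rho -> epi_convex phi ->
  (forall i, (phi (rho *: e_ i)%R <= b%:E)%E /\ (phi (- (rho *: e_ i))%R <= b%:E)%E) ->
  (forall i, `|z ord0 i| <= rho / n%:R) -> (phi z <= b%:E)%E.
Proof.
move=> n0 rho0 cphi hb zr; have n0' : 0 < (n%:R : R) by rewrite ltr0n.
rewrite -[z]add0r; have -> : b = n%:R^-1 * \sum_(i < n) b.
  by rewrite sumr_const card_ord -[b *+ n]mulr_natl mulKf ?gt_eqF.
apply: epi_convex_axes => // i; rewrite add0r; have [h1 h2] := hb i.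
have : - rho <= n%:R * z ord0 i <= rho.
  by rewrite -ler_norml normrM gtr0_norm// mulrC -ler_pdivlMr.
set u := _ * _ => /andP[u1 u2].
(* The weight that writes u e_i as a convex combination of rho e_i and - rho e_i. *)
have t01 : 0 <= (rho + u) / (2 * rho) <= 1.
  by rewrite divr_ge0 ?mulr_ge0 ?(ltW rho0)//= ?ler_pdivrMr ?mulr_gt0//; lra.
have := cphi _ _ _ _ _ t01 h1 h2; congr (phi _ <= _%:E)%E; last by ring.
rewrite scalerN -scalerBl scalerA; congr (_ *: _).
by field; rewrite gt_eqF.
Qed.

(** The upper bound comes from the axes by averaging. The lower one follows from the upper bound at
    -z, because x is the midpoint of x + z and x - z. *)
Lemma axis_gradient_frechet phi x y : (forall x, phi x != -oo%E) -> epi_convex phi ->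
  axis_gradient phi x y -> forall e : R, 0 < e -> exists2 d : R, 0 < d & forall z,
    (forall i, `|z ord0 i| <= d) ->
    (phi x + (inner z y - e * \sum_i `|z ord0 i|)%:E <= phi (x + z)%R)%E /\
    (phi (x + z)%R <= phi x + (inner z y + e * \sum_i `|z ord0 i|)%:E)%E.
Proof.
move=> phiN cphi [xoo ag] e e0.
have [r rE] : exists r, phi x = r%:E.
  by move: (phiN x) xoo; case: (phi x) => // r _ _; exists r.
have [n0|n0] := posnP n.
  exists 1 => // z _.
  have -> : z = 0 by apply/rowP => -[i ilt]; exfalso; move: ilt; rewrite n0.
  rewrite inner0l big1; last by move=> i _; rewrite mxE normr0.
  by rewrite !(mulr0, subr0, addr0, adde0); split.
have H i : exists d : R, 0 < d /\ forall s : R, `|s| <= d ->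
    (phi (x + s *: e_ i)%R <= phi x + (s * y ord0 i + e * `|s|)%:E)%E.
  by have [_ /(_ _ e0)[d d0 hd]] := ag i; exists d.
have [dd hdd] := choice H.
(* Averaging uses the points x + n z_j e_j, so a coordinate of size at most [d] must stay within
   [dd j] after multiplication by n. *)
pose d := \big[Num.min/1]_i dd i / n%:R.
have n0' : 0 < (n%:R : R) by rewrite ltr0n.
have d0 : 0 < d.
  by rewrite divr_gt0//; apply/bigmin_gtP; split => // i _; have [] := hdd i.
have up z : (forall i, `|z ord0 i| <= d) ->
    (phi (x + z)%R <= phi x + (inner z y + e * \sum_i `|z ord0 i|)%:E)%E.
  move=> zd.
  pose p (j : 'I_n) := x + (n%:R * z ord0 j) *: e_ j.
  pose q (j : 'I_n) := r + (n%:R * z ord0 j * y ord0 j + e * (n%:R * `|z ord0 j|)).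
  have pq j : (phi (p j) <= (q j)%:E)%E.
    have [_ h] := hdd j; have := h (n%:R * z ord0 j).
    rewrite normrM ger0_norm ?ler0n// rE -EFinD; apply.
    rewrite mulrC -ler_pdivlMr//; apply: le_trans (zd j) _.
    by rewrite ler_pM2r ?invr_gt0//; exact: bigmin_le_cond.
  have := epi_convex_axes n0 cphi pq.
  have -> : n%:R^-1 * (\sum_j q j) = r + (inner z y + e * \sum_i `|z ord0 i|).
    rewrite big_split/= sumr_const card_ord mulrDr -[r *+ n]mulr_natl mulrA mulVf ?gt_eqF// mul1r.
    congr (_ + _); rewrite big_split/= mulrDr; congr (_ + _).
      rewrite mulr_sumr; apply: eq_bigr => j _.
      by rewrite !mulrA mulVf ?gt_eqF// mul1r.
    rewrite !mulr_sumr; apply: eq_bigr => j _.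
    by rewrite mulrCA [n%:R^-1 * _]mulrA mulVf ?gt_eqF// mul1r.
  by rewrite rE EFinD.
exists d => // z zd; split; last exact: up.
rewrite leNgt; apply/negP => h1.
have [q qE] : exists q, phi (x + z) = q%:E.
  by move: (phiN (x + z)) h1; rewrite rE; case: (phi (x + z)) => // q _ _; exists q.
have zNd i : `|(- z) ord0 i| <= d by rewrite mxE normrN.
have := up _ zNd.
have -> : \sum_i `|(- z) ord0 i| = \sum_i `|z ord0 i|.
  by apply: eq_bigr => i _; rewrite mxE normrN.
rewrite innerNl rE -EFinD => h2.
have hq : (phi (x + z)%R <= q%:E)%E by rewrite qE.
have h01 : 0 <= (2^-1 : R) <= 1 by apply/andP; split; lra.
have := cphi _ _ _ _ _ h01 hq h2.
have -> : 2^-1 *: (x + z) + (1 - 2^-1) *: (x - z) = x.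
  by apply/rowP => k; rewrite !mxE; lra.
by move: h1; rewrite qE rE -EFinD lte_fin lee_fin; lra.
Qed.

Definition inner_form y z : R^o := inner z y.

Lemma inner_form_is_linear y : linear (inner_form y).
Proof. by move=> a u v; rewrite /inner_form innerDl innerZl. Qed.

HB.instance Definition _ y :=
  GRing.isLinear.Build R V R^o _ (inner_form y) (inner_form_is_linear y).

Lemma axis_gradient_has_gradient phi x y : (forall x, phi x != -oo%E) -> epi_convex phi ->
  axis_gradient phi x y -> has_gradient phi x /\ gradient phi x = y.
Proof.
move=> phiN cphi ag; have fr := axis_gradient_frechet phiN cphi ag.
have [xoo _] := ag.
have [r rE] : exists r, phi x = r%:E.
  by move: (phiN x) xoo; case: (phi x) => // r _ _; exists r.
have fin : \forall z \near (0 : V), phi (x + z) \is a fin_num.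
  have [d d0 hd] := fr _ ltr01.
  apply/nbhs_ballP; exists d => // z; rewrite mx_norm_ball /ball_/= sub0r normrN => zd.
  have [|h1 h2] := hd z; first by move=> i; apply: le_trans (coord_le_norm _ _) (ltW zd).
  move: h1 h2; rewrite rE -!EFinD; case: (phi (x + z)) => //.
pose L : {linear V -> R^o} := inner_form y.
have cL : continuous L by move=> z; exact: continuous_inner.
have dL : (fine \o phi) \o shift x = cst ((fine \o phi) x) + L +o_ (0 : V) id.
  apply/eqaddoP => e e0 /=.
  (* The error is controlled by the sum of the |z_i|, which is at most n times the sup norm. *)
  pose e' := e / n.+1%:R; have e'0 : 0 < e' by rewrite divr_gt0.
  have [d d0 hd] := fr _ e'0.
  apply/nbhs_ballP; exists d => // z; rewrite mx_norm_ball /ball_/= sub0r normrN => zd.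
  have [|h1 h2] := hd z; first by move=> i; apply: le_trans (coord_le_norm _ _) (ltW zd).
  have [q qE] : exists q, phi (x + z) = q%:E.
    by move: h1 h2; rewrite rE -!EFinD; case: (phi (x + z)) => // q; exists q.
  have -> : ((fine \o phi) \o shift x - (cst ((fine \o phi) x) + L)) z =
      q - (r + inner z y).
    by rewrite !fctE/= [z + x]addrC qE rE.
  move: h1 h2; rewrite qE rE -!EFinD !lee_fin => h1 h2.
  have : e' * (\sum_i `|z ord0 i|) <= e * `|z|.
    rewrite /e' -mulrA ler_pM2l// mulrC ler_pdivrMr//.
    apply: (@le_trans _ _ (\sum_(i < n) `|z|)).
      by apply: ler_sum => i _; exact: coord_le_norm.
    by rewrite sumr_const card_ord -[leLHS]mulr_natr ler_wpM2l// ler_nat.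
  by move=> h3; rewrite ler_norml; apply/andP; split; lra.
have dE := diff_unique cL dL.
have df : differentiable (fine \o phi) x.
  by apply/diff_locallyP; rewrite dE.
split.
  by split => //; apply/nbhs0P.
apply/rowP => i; rewrite mxE dE; exact: inner_axisl.
Qed.

End smooth_points.

(** * Measurability of the gradient, and near-maximizers in the conjugate *)

Section gradients.
Context (R : realType) (n : nat).
Local Notation V := 'rV[R]_n.
Local Notation e_ i := (delta_mx 0 i : V).
Implicit Types (phi psi : V -> \bar R) (x y z : V).

Lemma norm_axis_le (s : R) i : `|s *: e_ i| <= `|s|.
Proof.
rewrite [leLHS]/Num.norm /= mx_normrE; apply/bigmax_leP; split => //= -[a b] _ /=.
rewrite !mxE normrM; case: (_ && _); rewrite ?normr1 ?normr0 ?mulr1 ?mulr0//.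
Qed.

Lemma inv_nat_lt (d : R) : 0 < d -> exists m : nat, (m.+1%:R^-1 : R) < d.
Proof.
move=> d0; exists (Num.truncn d^-1).
by rewrite -[ltRHS]invrK ltf_pV2 ?posrE ?invr_gt0// truncnS_gt.
Qed.

(** Second differences of a differentiable function are o(s), too small for a kink. With the
    converse for convex functions this identifies the domain of integration in
    [curvature_measure]. *)
Lemma has_gradient_smooth phi x : has_gradient phi x -> smooth phi x.
Proof.
move=> [fin df]; have xfin := nbhs_singleton fin; split; first by rewrite ltey_eq xfin.
move=> i k [_ kk].
have /eqaddoP dL := diff_locally df.
(* The two remainders add up to at most 2 e s = s / (2 (k + 1)), below the gap s / (k + 1) required
   of a kink. *)
pose e : R := 4^-1 * k.+1%:R^-1; have e0 : 0 < e by rewrite mulr_gt0 ?invr_gt0.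
have /nbhs_ballP[d1 /= d10 hd1] := dL _ e0.
have /nbhs_ballP[d2 /= d20 hd2] := (nbhs0P _ _).1 fin.
have [m md] : exists m : nat, (m.+1%:R^-1 : R) < Num.min d1 d2.
  by apply: inv_nat_lt; rewrite lt_min d10.
set s : R := m.+1%:R^-1 in md; have s0 : 0 < s by rewrite /s invr_gt0.
pose g : R := 'd (fine \o phi) x (e_ i).
have H t : `|t| = s -> exists q : R, phi (x + t *: e_ i) = q%:E /\
    `|q - (fine (phi x) + t * g)| <= e * s.
  move=> ts; have td d : s < d -> ball (0 : V) d (t *: e_ i).
    rewrite mx_norm_ball /ball_/= sub0r normrN => sd.
    by apply: le_lt_trans (norm_axis_le _ _) _; rewrite ts.
  have := hd2 _ (td _ _); rewrite (lt_le_trans md) ?ge_min ?lexx ?orbT// => /(_ isT).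
  case E : (phi (x + t *: e_ i)) => [q| |]// _; exists q; split => //.
  have := hd1 _ (td _ _); rewrite (lt_le_trans md) ?ge_min ?lexx// => /(_ isT).
  rewrite !fctE/= [t *: _ + x]addrC E/= linearZ/=; move/le_trans; apply.
  by rewrite ler_pM2l// -ts norm_axis_le.
have [q1 [q1E h1]] := H s (gtr0_norm s0).
have [q2 [q2E h2]] : exists q : R, phi (x + - s *: e_ i) = q%:E /\
    `|q - (fine (phi x) + - s * g)| <= e * s.
  by apply: H; rewrite normrN gtr0_norm.
have := kk m; rewrite -/s q1E q2E -(fineK xfin) -!EFinD lee_fin.
move: h1 h2; rewrite !ler_norml => /andP[_ h1] /andP[_ h2].
have : e * s = 4^-1 * (k.+1%:R^-1 * s) by rewrite /e mulrA.
have : 0 < k.+1%:R^-1 * s by rewrite mulr_gt0 ?invr_gt0.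
rewrite -/s; move: h1 h2; rewrite mulNr.
move: (k.+1%:R^-1 * s) (e * s) (s * g) (fine (phi x)) => A B C D; lra.
Qed.

Lemma smooth_gradientP phi x : (forall x, phi x != -oo%E) -> epi_convex phi ->
  smooth phi x -> has_gradient phi x /\ axis_gradient phi x (gradient phi x).
Proof.
move=> phiN cphi /(smooth_axis_gradient phiN cphi)[y ay].
by have [hg gE] := axis_gradient_has_gradient phiN cphi ay; rewrite gE.
Qed.

(** The default 0 makes the gradient a total map; it is harmless because [gibbs_density] vanishes
    off the smooth points. *)
Definition smooth_gradient phi x := if x \in smooth phi then gradient phi x else 0.

(** At smooth points each coordinate is the limit of forward difference quotients with steps 1 / (m
    + 1). *)
Lemma measurable_smooth_gradient phi : (forall x, phi x != -oo%E) -> epi_convex phi ->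
  measurable_fun setT phi -> measurable_fun setT (smooth_gradient phi).
Proof.
move=> phiN cphi mphi; apply: measurable_fun_rowP => i.
have ms := measurable_smooth mphi.
pose D (m : nat) x := m.+1%:R * (fine (phi (x + m.+1%:R^-1 *: e_ i)) - fine (phi x)).
have mD m : measurable_fun setT (D m).
  apply: measurable_funM => //; apply: measurable_funB.
    by apply: measurableT_comp => //; exact: measurableT_comp mphi (measurable_shift _).
  exact: measurableT_comp.
pose D' (m : nat) x := if x \in smooth phi then D m x else 0.
have mD' m : measurable_fun setT (D' m).
  apply: measurable_fun_ifT => //; apply: (measurable_fun_bool true); rewrite setTI.
  rewrite (_ : _ @^-1` _ = smooth phi)//; apply/seteqP; split => x /=.
    by move=> /set_mem.
  by move=> sx; rewrite mem_set.
apply/measurable_EFinP; apply: (@emeasurable_fun_cvg _ _ _ _ (fun m => EFin \o D' m)).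
  by move=> m; apply/measurable_EFinP.
move=> x _; apply/fine_cvgP; split; first by near=> m.
rewrite /smooth_gradient; case: ifPn => [sx|nsx]; last first.
  by apply: cvg_near_cst; apply: nearW => m /=; rewrite mxE /D' (negbTE nsx).
have [[fin _] [xoo /(_ i)[lo up]]] := smooth_gradientP phiN cphi (set_mem sx).
have xfin := nbhs_singleton fin.
apply/cvgrPdist_le => e e0; have [d d0 hd] := up _ e0.
near=> m; rewrite /= /D' sx.
have m0 : 0 < (m.+1%:R : R) by rewrite ltr0n.
have sd : `|m.+1%:R^-1 : R| <= d.
  rewrite ger0_norm ?invr_ge0//; near: m.
  have [k kd] := inv_nat_lt d0; exists k => // m /= km.
  by apply: le_trans (ltW kd); rewrite lef_pV2 ?posrE// ler_nat.
have := hd _ sd; have := lo m.+1%:R^-1; rewrite /D -(fineK xfin) -!EFinD.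
case: (phi (x + _)) => [q| |]//; rewrite !lee_fin /= [`|_^-1|]ger0_norm ?invr_ge0//.
set g := gradient _ _ _ _; set c := fine _ => h1 h2.
have {}h1 : g <= m.+1%:R * (q - c).
  by rewrite -ler_pdivrMl//; move: (m.+1%:R^-1) h1 => k; lra.
have {}h2 : m.+1%:R * (q - c) <= g + e.
  by rewrite -ler_pdivlMl//; move: (m.+1%:R^-1) h2 => k; lra.
move: h1 h2; move: (_ * _) => D1 h1 h2.
by rewrite ler_norml; apply/andP; split; lra.
Unshelve. all: by end_near. Qed.

(** A near-maximizer y' of <x, .> - psi yields an affine minorant of the conjugate that almost
    touches it at x; comparison with the first-order upper bound at x + s e_i, for both signs of s,
    confines the slope y'. *)
Lemma legendre_near_max psi x y (eta : R) : axis_gradient (legendre psi) x y -> legendre psi x != -oo%E -> 0 < eta ->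
  exists2 dl : R, 0 < dl & forall y',
    (legendre psi x - dl%:E <= (inner x y')%:E - psi y')%E -> forall i, `|y' ord0 i - y ord0 i| <= eta.
Proof.
move=> [xoo ag] xN eta0.
have [r rE] : exists r, legendre psi x = r%:E.
  by move: xN xoo; case: (legendre psi x) => // r _ _; exists r.
have e0 : 0 < eta / 2 by rewrite divr_gt0.
have H i : exists d : R, 0 < d /\ forall s : R, `|s| <= d ->
    (legendre psi (x + s *: e_ i)%R <= legendre psi x + (s * y ord0 i + eta / 2 * `|s|)%:E)%E.
  by have [_ /(_ _ e0)[d d0 hd]] := ag i; exists d.
have [dd hdd] := choice H.
pose d := \big[Num.min/1]_i dd i.
have d0 : 0 < d by apply/bigmin_gtP; split => // i _; have [] := hdd i.
(* Half of the budget d eta goes to the defect of y', half to the first-order error (eta / 2) d. *)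
exists (d * (eta / 2)); first by rewrite mulr_gt0.
move=> y' hy' i.
have [q qE] : exists q, psi y' = q%:E.
  have := legendre_ub psi x y'; move: hy'; rewrite rE; case: (psi y') => //= q _ _.
  by exists q.
have key s : `|s| = d -> s * (y' ord0 i - y ord0 i) <= d * eta.
  move=> sd; have := (hdd i).2 s; rewrite sd bigmin_le_cond// => /(_ isT).
  move: hy'; rewrite qE rE -!EFinB -EFinD lee_fin => h1 h2.
  have := le_trans (legendre_ub psi (x + s *: e_ i) y') h2.
  rewrite qE -EFinB lee_fin innerDl innerZl inner_axisl => h3.
  lra.
have k1 := key _ (gtr0_norm d0).
have k2 : (- d) * (y' ord0 i - y ord0 i) <= d * eta by apply: key; rewrite normrN gtr0_norm.
rewrite ler_norml -(ler_pM2l d0) -[X in _ && X](ler_pM2l d0) mulrN.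
by apply/andP; split; lra.
Qed.

End gradients.

(** * Lower limits, diagonal extraction and a reverse Fatou lemma *)

Section extended_tools.
Context (R : realType).
Local Open Scope ereal_scope.

Lemma measurable_expeR : measurable_fun setT (@expeR R).
Proof.
apply: (measurability (@ErealGenOInfty.G R) (ErealGenOInfty.measurableE R)) => _ [_ [a ->] <-].
rewrite setTI.
have mgt (b : \bar R) : measurable [set x : \bar R | b < x].
  by rewrite -[X in measurable X]setTI; exact: emeasurable_fun_o_infty.
have [a0|a0|a0] := ltgtP a 0%R.
- rewrite (_ : _ @^-1` _ = setT)//; apply/seteqP; split => // x _ /=.
  by rewrite in_itv/= ?leey andbT (lt_le_trans _ (expeR_ge0 x))// lte_fin.
- rewrite (_ : _ @^-1` _ = [set x | (ln a)%:E < x])//; apply/seteqP; split => x /=;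
  by rewrite in_itv/= ?leey andbT -lte_expeR/= lnK.
- rewrite (_ : _ @^-1` _ = [set x | -oo < x])//; apply/seteqP; split => x /=;
  by rewrite in_itv/= ?leey andbT a0 -lte_expeR/=.
Qed.

Lemma measurable_limn_einf d (T : measurableType d) (f : (T -> \bar R)^nat) :
  (forall k, measurable_fun setT (f k)) ->
  measurable_fun setT (fun x => limn_einf (f ^~ x)).
Proof.
move=> mf; apply: measurableT_comp => //.
by apply: measurable_fun_limn_esup => k; exact: measurableT_comp.
Qed.

Lemma limn_einf_ge_eventually (u : (\bar R)^nat) (l : \bar R) j0 :
  (forall j, (j0 <= j)%N -> l <= u j) -> l <= limn_einf u.
Proof.
move=> ul; rewrite -[limn_einf u]/(limf_einf u \oo) limf_einfE.
apply: (@le_trans _ _ (ereal_inf (u @` [set j | (j0 <= j)%N]))).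
  by apply: le_ereal_inf_tmp => _ [j /= /ul ? <-].
by apply: ereal_sup_ubound; exists [set j | (j0 <= j)%N] => //; exists j0.
Qed.

Lemma limn_einf_gt_eventually (u : (\bar R)^nat) (l : \bar R) : l < limn_einf u ->
  exists j0, forall j, (j0 <= j)%N -> l < u j.
Proof.
rewrite -[limn_einf u]/(limf_einf u \oo) limf_einfE => /ereal_sup_gt[_ [A [j0 _ hA] <-] lA].
exists j0 => j jj; apply: lt_le_trans lA _.
by apply: ereal_inf_lbound; exists j => //; exact: hA.
Qed.

Lemma limn_einf_le_eventually (u : (\bar R)^nat) (l : \bar R) j0 :
  (forall j, (j0 <= j)%N -> u j <= l) -> limn_einf u <= l.
Proof.
move=> ul; rewrite -[limn_einf u]/(limf_einf u \oo) limf_einfE.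
apply: ge_ereal_sup => _ [A [j1 _ hA] <-].
apply: le_trans (ul (maxn j0 j1) (leq_maxl _ _)).
by apply: ereal_inf_lbound; exists (maxn j0 j1) => //; apply: hA; exact: leq_maxr.
Qed.

Lemma limn_einf_le (u : (\bar R)^nat) (l : \bar R) :
  (forall j, u j <= l) -> limn_einf u <= l.
Proof. by move=> ul; exact: (@limn_einf_le_eventually _ _ 0). Qed.

(* Diagonal extraction: intersecting members of an ultrafilter avoids nested
   subsequences. *)
Lemma dichotomy_subsequence (T : countType) (A : T -> set nat) :
  exists k : nat -> nat, (forall j, (j <= k j)%N) /\
  forall t, (exists j0, forall j, (j0 <= j)%N -> A t (k j)) \/
            (exists j0, forall j, (j0 <= j)%N -> ~ A t (k j)).
Proof.
have [U [UU sU]] := ultraFilterLemma (eventually_filter : ProperFilter \oo).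
(* Through its code [c] each [t] contributes whichever of [A t] and its complement belongs to [U];
   then [k j] is taken in the intersection of the first j + 1 of these sets. *)
pose B (c : nat) : set nat := if unpickle c is Some t then
  (if pselect (U (A t)) then A t else ~` A t) else setT.
have UB c : U (B c).
  rewrite /B; case: unpickle => [t|]; last exact: filterT.
  case: pselect => // nA; have [|//] := in_ultra_setVsetC (A t) UU.
  by move=> /nA.
have UBj j : U ([set i | forall c, (c <= j)%N -> B c i] `&` [set i | (j <= i)%N]).
  apply: filterI; last by apply: sU; exists j.
  elim: j => [|j IH]; first by apply: filterS (UB 0%N) => i B0 c; rewrite leqn0 => /eqP ->.
  apply: filterS (filterI IH (UB j.+1)) => i [h1 h2] c.
  by rewrite leq_eqVlt => /orP[/eqP -> //|]; exact: h1.
have [k hk] := choice (fun j => filter_ex (UBj j)).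
exists k; split => [j|t]; first by have [_] := hk j.
have H j : (pickle t <= j)%N -> B (pickle t) (k j).
  by move=> tj; have [h _] := hk j; exact: h.
move: H; rewrite /B pickleK; case: pselect => a /= H; [left|right]; exists (pickle t); exact: H.
Qed.

(** Fatou for G - g_j. The upper limit of g_j enters only through its bounds: every l > g0(x)
    eventually dominates g_j(x). *)
Lemma reverse_fatou d (T : measurableType d) (m : {measure set T -> \bar R})
    (g : nat -> T -> R) (G g0 : T -> R) (K : R) :
  (forall j, measurable_fun setT (g j)) -> measurable_fun setT G -> measurable_fun setT g0 ->
  (forall j x, 0 <= g j x <= G x)%R -> (forall x, 0 <= g0 x <= G x)%R ->
  \int[m]_x (G x)%:E < +oo ->
  (forall x l, (g0 x < l)%R -> exists j0, forall j, (j0 <= j)%N -> (g j x <= l)%R) ->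
  (exists j0, forall j, (j0 <= j)%N -> K%:E <= \int[m]_x (g j x)%:E) ->
  K%:E <= \int[m]_x (g0 x)%:E.
Proof.
move=> mg mG mg0 gG g0G Goo lim [j0 hK].
have G0 x : (0 <= G x)%R by have /andP[/le_trans] := g0G x; apply.
have int (h : T -> R) : measurable_fun setT h -> (forall x, 0 <= h x <= G x)%R ->
    m.-integrable setT (EFin \o h).
  move=> mh hG; apply/integrableP; split; first exact/measurable_EFinP.
  apply: le_lt_trans Goo; apply: ge0_le_integral => //.
  - by apply: measurableT_comp => //; exact/measurable_EFinP.
  - exact/measurable_EFinP.
  - by move=> x _; have /andP[h0 h1] := hG x; rewrite /= lee_fin ger0_norm.
have IG := int _ mG (fun x => introT andP (conj (G0 x) (lexx _))).
have diff (h : T -> R) : measurable_fun setT h -> (forall x, 0 <= h x <= G x)%R ->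
    \int[m]_x (G x - h x)%:E = \int[m]_x (G x)%:E - \int[m]_x (h x)%:E.
  by move=> mh hG; rewrite -integralB_EFin//; exact: int.
(* The shift by [j0] makes the lower bound on the integrals hold at every index. *)
have mGg j : measurable_fun setT (fun x => (G x - g (j + j0)%N x)%:E).
  by apply/measurable_EFinP; exact: measurable_funB.
have nGg j x : setT x -> 0 <= (G x - g (j + j0)%N x)%:E.
  by rewrite lee_fin subr_ge0; have /andP[] := gG (j + j0)%N x.
have := @fatou _ _ _ m setT measurableT _ mGg nGg.
have fin (h : T -> R) : measurable_fun setT h -> (forall x, 0 <= h x <= G x)%R ->
    \int[m]_x (h x)%:E \is a fin_num.
  by move=> mh hG; apply: integrable_fin_num => //; exact: int.
have finG := fin _ mG (fun x => introT andP (conj (G0 x) (lexx _))).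
have up : limn_einf (fun j => \int[m]_x (G x - g (j + j0)%N x)%:E) <= \int[m]_x (G x)%:E - K%:E.
  apply: limn_einf_le => j; rewrite diff//; apply: leeB => //.
  by apply: hK; exact: leq_addl.
have low : \int[m]_x (G x - g0 x)%:E <=
    \int[m]_x limn_einf (fun j => (G x - g (j + j0)%N x)%:E).
  apply: ge0_le_integral => //.
  - by move=> x _; rewrite lee_fin subr_ge0; have /andP[] := g0G x.
  - by apply/measurable_EFinP; exact: measurable_funB.
  - exact: measurable_limn_einf.
  - move=> x _; apply/lee_subgt0Pr => e e0.
    have [|j1 hj1] := lim x (g0 x + e)%R; first by rewrite ltrDl.
    apply: (@limn_einf_ge_eventually _ _ j1) => j jj.
    by rewrite -EFinB lee_fin; have := hj1 (j + j0)%N (leq_trans jj (leq_addr _ _)); lra.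
move=> f1; have := le_trans low (le_trans f1 up).
rewrite diff// -(fineK finG) -(fineK (fin _ mg0 g0G)) -!EFinB !lee_fin; lra.
Qed.

End extended_tools.

(** * The variational problem *)

Section potentials.
Context (R : realType) (n : nat) (n0 : (0 < n)%N).
Local Notation V := 'rV[R]_n.
Local Notation e_ i := (delta_mx 0 i : V).
Context (sigma : {measure set V -> \bar R}) (mu : {finite_measure set V -> \bar R}).
Context (sexp : forall t : R, 0 < t ->
    (\int[sigma]_x (expR (- (t * enorm x)))%:E < +oo)%E)
  (ssmall : forall r e : R, 0 < e -> exists2 dl : R, 0 < dl &
    forall B, measurable B -> B `<=` @cube R n r ->
      (lebesgue_rV R n B <= dl%:E)%E -> (sigma B <= e%:E)%E)
  (scube : (0 < sigma (@cube R n 1))%E)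
  (mu_neq0 : mu setT != 0%E) (mu1 : finite_first_moment mu)
  (c : R) (c0 : 0 < c)
  (hc : forall x, ((fine (mu setT) * (c * enorm x))%:E <= \int[mu]_y `|inner y x|%:E)%E).

(** This is F_w(t) when sigma has density w. *)
Definition exp_integral (t : R) : R := fine (\int[sigma]_x (expR (- (t * enorm x)))%:E)%E.

Context (hlim : forall e T : R, 0 < e -> exists2 M, T < M &
  exp_integral (c / (2 * M)) * expR (- M) < e).

Local Notation a := (fine (mu setT)).

Lemma mass_gt0 : 0 < a.
Proof.
rewrite fine_gt0// ltey_eq fin_num_measure// andbT.
by rewrite lt0e mu_neq0 measure_ge0.
Qed.

Lemma massE : mu setT = a%:E. Proof. by rewrite fineK// fin_num_measure. Qed.

Lemma integral_mass (r : R) : (\int[mu]_y r%:E = (r * a)%:E)%E.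
Proof. by rewrite integral_cst// EFinM -massE. Qed.

Definition even_potential (psi : V -> \bar R) := [/\ forall y, psi (- y) = psi y,
  measurable_fun setT psi, forall y, (0 <= psi y)%E & (\int[mu]_y psi y < +oo)%E].

Definition mean (psi : V -> \bar R) : R := fine (\int[mu]_y psi y)%E / a.

Definition gibbs (psi : V -> \bar R) : R :=
  fine (\int[sigma]_x expeR (- legendre psi x))%E.

Lemma integral_mean (psi : V -> \bar R) : even_potential psi -> (\int[mu]_y psi y = (a * mean psi)%:E)%E.
Proof.
move=> [_ _ psi0 psioo]; rewrite /mean mulrC divfK ?gt_eqF ?mass_gt0// fineK//.
by rewrite ge0_fin_numE//; apply: integral_ge0.
Qed.

Lemma mean_ge0 psi : even_potential psi -> 0 <= mean psi.
Proof.
move=> [_ _ psi0 _]; rewrite divr_ge0 ?(ltW mass_gt0)//.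
by apply: fine_ge0; apply: integral_ge0.
Qed.

Lemma measurable_gibbs (psi : V -> \bar R) : measurable_fun setT (fun x : V => expeR (- legendre psi x))%E.
Proof.
apply: measurableT_comp; first exact: measurable_expeR.
by apply: measurableT_comp => //; exact: measurable_legendre.
Qed.

(** If r bounds the conjugate at x, then psi(y) >= <x, y> - r, and by evenness psi(y) >= |<x, y>| -
    r; integrating against mu and using [hc] bounds r from below. *)
Lemma legendre_ge (psi : V -> \bar R) (x : V) : even_potential psi ->
  ((c * enorm x - mean psi)%:E <= legendre psi x)%E.
Proof.
move=> ep; have [ev mpsi psi0 psioo] := ep.
suff H (r : R) : (legendre psi x <= r%:E)%E -> c * enorm x - mean psi <= r.
  case E : (legendre psi x) H => [r| |] H.
  - by rewrite lee_fin H.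
  - by rewrite leey.
  - by have := H (c * enorm x - mean psi - 1); rewrite leNye => /(_ isT); rewrite leNgt ltrBlDr ltrDl ltr01.
move=> /legendre_leP hr.
(* Moving the negative part of r to the other side keeps both integrands nonnegative. *)
pose rp := Num.max r 0; pose rn := Num.max (- r) 0.
have rE : r = rp - rn by rewrite /rp /rn; case: (leP r 0) => ?; case: (leP (- r) 0) => ?; lra.
have rp0 : 0 <= rp by rewrite le_max lexx orbT.
have rn0 : 0 <= rn by rewrite le_max lexx orbT.
have mi : measurable_fun setT (fun y : V => `|inner y x|%:E%E).
  by apply/measurable_EFinP; apply: measurableT_comp => //; exact: measurable_inner.
have : (\int[mu]_y (`|inner y x|%:E + rn%:E) <= \int[mu]_y (psi y + rp%:E))%E.
  apply: ge0_le_integral => //.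
  - by move=> y _; rewrite -EFinD lee_fin addr_ge0.
  - by apply: emeasurable_funD.
  - by apply: emeasurable_funD.
  - move=> y _; have h1 := hr y; have h2 := hr (- y); rewrite ev in h2.
    move: h1 h2; rewrite [inner x (- y)]innerC innerNl [inner x y]innerC.
    case: (psi y) => [q| |]//=; last by move=> _ _; rewrite addye// leey.
    by rewrite -!EFinD !lee_fin => h1 h2; case: (ger0P (inner y x)) => _; lra.
rewrite !ge0_integralD//.
rewrite !integral_mass (integral_mean ep) -EFinD => h.
have := le_trans (leeD2r (rn * a)%:E (hc x)) h.
rewrite -EFinD lee_fin rE => h'.
rewrite -(ler_pM2l mass_gt0); lra.
Qed.

Lemma legendre_neqNy (psi : V -> \bar R) (x : V) : even_potential psi -> legendre psi x != -oo%E.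
Proof. by move=> /(legendre_ge x); case: (legendre psi x). Qed.

Lemma exp_integralE t : 0 < t ->
  (\int[sigma]_x (expR (- (t * enorm x)))%:E = (exp_integral t)%:E)%E.
Proof.
move=> t0; rewrite fineK// ge0_fin_numE ?sexp//.
by apply: integral_ge0 => x _; rewrite lee_fin expR_ge0.
Qed.

Lemma exp_integral_ge0 t : 0 <= exp_integral t.
Proof. by apply: fine_ge0; apply: integral_ge0 => x _; rewrite lee_fin expR_ge0. Qed.

Lemma integral_gibbs_le (psi : V -> \bar R) (s : R) : 0 < s ->
  (forall x, ((s * (c * enorm x - mean psi))%:E <= legendre psi x)%E) ->
  (\int[sigma]_x expeR (- legendre psi x) <= (expR (s * mean psi) * exp_integral (s * c))%:E)%E.
Proof.
move=> s0 hs; rewrite EFinM -exp_integralE ?mulr_gt0//.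
have mE : measurable_fun setT (fun x : V => (expR (- (s * c * enorm x)))%:E).
  by apply/measurable_EFinP; exact: measurable_exp_enorm.
rewrite -ge0_integralZl_EFin//.
apply: ge0_le_integral => //.
- by move=> x _; exact: expeR_ge0.
- exact: measurable_gibbs.
- exact: measurable_funeM.
- move=> x _; rewrite -EFinM -expRD.
  have -> : (expR (s * mean psi - s * c * enorm x))%:E = expeR (s * mean psi - s * c * enorm x)%:E by [].
  rewrite lee_expeR leeNl -EFinN; apply: le_trans (hs x).
  by rewrite lee_fin; lra.
Qed.

Lemma integral_gibbs (psi : V -> \bar R) : even_potential psi ->
  (\int[sigma]_x expeR (- legendre psi x) = (gibbs psi)%:E)%E.
Proof.
move=> ep; rewrite fineK// ge0_fin_numE; last first.
  by apply: integral_ge0 => x _; exact: expeR_ge0.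
apply: le_lt_trans (integral_gibbs_le ltr01 _) _; last by rewrite ltry.
by move=> x; rewrite mul1r; exact: legendre_ge.
Qed.

Lemma gibbs_ge0 psi : 0 <= gibbs psi.
Proof. by apply: fine_ge0; apply: integral_ge0 => x _; exact: expeR_ge0. Qed.

Definition admissible psi := even_potential psi /\ forall x, (0 <= legendre psi x)%E.

Definition score psi : R := gibbs psi * expR (- mean psi).

(* Since the conjugate is nonnegative it dominates its own multiples by
   s <= 1, which trades decay of the Gibbs weight for the factor e^(s m). *)
Lemma admissible_gibbs_le (psi : V -> \bar R) (s : R) : admissible psi -> 0 < s <= 1 ->
  gibbs psi <= expR (s * mean psi) * exp_integral (s * c).
Proof.
move=> [ep psi0] /andP[s0 s1]; rewrite -lee_fin -integral_gibbs//.
apply: integral_gibbs_le => // x; have := psi0 x; have := legendre_ge x ep.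
case: (legendre psi x) => [r| |]//; rewrite ?leey// !lee_fin => h1 h2.
have [h|h] := leP 0 (c * enorm x - mean psi).
  by apply: le_trans h1; rewrite ler_piMl.
by apply: le_trans h2; rewrite pmulr_rle0// ltW.
Qed.

(* By symmetry and convexity the chord through the origin is the longest one in
   its direction: were it short, the sublevel set would be thin and its
   sigma-measure, hence the Gibbs integral, would be too small. *)
Lemma nondegenerate (a0 M0 : R) : 0 < a0 -> exists rho b : R, 0 < rho /\
  forall psi, admissible psi -> mean psi <= M0 -> a0 <= gibbs psi ->
    forall i, (legendre psi (rho *: e_ i) <= b%:E)%E.
Proof.
move=> a00.
pose M1 := Num.max M0 0; pose K := expR (M1 / 2) * exp_integral (2^-1 * c) + 1.
have M10 : 0 <= M1 by rewrite le_max lexx orbT.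
have K1 : expR (M1 / 2) * exp_integral (2^-1 * c) <= K by rewrite lerDl.
have K0 : 0 < K by rewrite ltr_wpDl// mulr_ge0 ?expR_ge0 ?exp_integral_ge0.
have aK : 0 < a0 / (4 * K) by rewrite divr_gt0// mulr_gt0.
(* Above level b the weight e^(-phi) is at most e^(-b / 2) e^(-phi / 2); this [b] makes the tail
   integrate to at most a0 / 4. *)
pose b := Num.max 0 (- (2 * ln (a0 / (4 * K)))).
have b0 : 0 <= b by rewrite le_max lexx.
have eb : expR (- (b / 2)) * K <= a0 / 4.
  apply: (@le_trans _ _ (a0 / (4 * K) * K)); last first.
    by rewrite invfM mulrA divfK ?gt_eqF.
  rewrite ler_pM2r// -[leRHS]lnK ?posrE// ler_expR.
  have : - (2 * ln (a0 / (4 * K))) <= b by rewrite le_max lexx orbT.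
  lra.
(* Radius of a cube containing the sublevel set, from phi(x) >= c |x| - m(psi). *)
pose r := (b + M1) / c; have r0 : 0 <= r by rewrite divr_ge0 ?addr_ge0// ltW.
have a20 : 0 < a0 / 2 by rewrite divr_gt0.
have [dl dl0 hdl] := ssmall r a20.
pose Q : R := (2 * r) ^+ n.-1 + 1.
have Q0 : 0 < Q by rewrite ltr_wpDl// exprn_ge0// mulr_ge0.
(* Slices will lie in intervals of length 4 rho, so the volume is at most 4 rho (2 r)^(n-1) <=
   dl. *)
pose rho := dl / (4 * Q); have rho0 : 0 < rho by rewrite divr_gt0// mulr_gt0.
exists rho, b; split => // psi [ep psi0] mM aI i.
rewrite leNgt; apply/negP => hb.
pose A := [set x | (legendre psi x <= b%:E)%E].
have mA : measurable A.
  by rewrite -[A]setTI; apply: measurable_lee => //; exact: measurable_legendre.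
have mM1 : mean psi <= M1 by rewrite le_max mM.
have Ar : A `<=` @cube R n r.
  move=> x Ax j; rewrite -ler_norml; apply: le_trans (coord_le_enorm _ _) _.
  have := le_trans (legendre_ge x ep) Ax; rewrite lee_fin => h.
  by rewrite ler_pdivlMr//; lra.
have [ev _ _ _] := ep.
have AN x : A x -> A (- x) by rewrite /A/= legendre_even.
have Amid (x y : V) (t : R) : 0 <= t <= 1 -> A x -> A y -> A (t *: x + (1 - t) *: y).
  move=> t01 Ax Ay; have := legendre_convex t01 Ax Ay.
  by rewrite (_ : t * b + (1 - t) * b = b)//; ring.
(* Averaging one endpoint with the reflection of the other moves half of the chord to the origin,
   inside [A]; a half-length above rho would put rho e_i in [A]. *)
have chord (x : V) (s t : R) : A (x + s *: e_ i) -> A (x + t *: e_ i) -> t - s <= 2 * rho.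
  move=> As At; rewrite leNgt; apply/negP => st.
  pose h := (t - s) / 2; have rh : rho < h by rewrite /h; lra.
  have h0 : 0 < h by exact: lt_trans rh.
  have h2 : 0 <= (2^-1 : R) <= 1 by apply/andP; split; lra.
  have Ah : A (h *: e_ i).
    have := Amid _ _ _ h2 At (AN _ As); congr A.
    by apply/rowP => k; rewrite !mxE /h; lra.
  have A0 : A 0.
    have := Amid _ _ _ h2 Ah (AN _ Ah); congr A.
    by apply/rowP => k; rewrite !mxE; lra.
  have : A (rho *: e_ i).
    have t01 : 0 <= rho / h <= 1.
      by rewrite divr_ge0 ?(ltW rho0) ?(ltW h0)//= ler_pdivrMr// mul1r ltW.
    have := Amid _ _ _ t01 Ah A0; congr A.
    by rewrite scaler0 addr0 scalerA divfK ?gt_eqF.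
  by rewrite /A/= leNgt hb.
have lebA : (lebesgue_rV R n A <= dl%:E)%E.
  apply: (@le_trans _ _ (4 * rho * (2 * r) ^+ n.-1)%:E).
    apply: (@lebesgue_rV_slice_le _ _ i) => //; first by rewrite mulr_ge0// ltW.
    move=> x; set T := [set s | _].
    have [[p Tp]|nT] := pselect (exists p, T p); last first.
      have -> : T = set0 by apply/seteqP; split => // s Ts; apply: nT; exists s.
      by rewrite measure0 lee_fin mulr_ge0// ltW.
    apply: (@le_trans _ _ (lebesgue_measure [set` `[p - 2 * rho, p + 2 * rho]])).
      apply: le_measure; rewrite ?inE//; first exact: measurable_axis_pre.
      move=> s Ts /=; rewrite in_itv/=; apply/andP.
      by have := chord x _ _ Tp Ts; have := chord x _ _ Ts Tp; split; lra.
    rewrite lebesgue_measure_itv/= lte_fin ifT; last by lra.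
    by rewrite -EFinB lee_fin; lra.
  rewrite lee_fin; apply: (@le_trans _ _ (4 * rho * Q)).
    by rewrite ler_wpM2l ?lerDl// mulr_ge0// ltW.
  by rewrite -mulrA mulrCA divfK// gt_eqF// mulr_gt0.
have sA := hdl _ mA Ar lebA.
have : ((gibbs psi)%:E <= (a0 / 2)%:E + (a0 / 4)%:E)%E.
  rewrite -integral_gibbs//.
  (* On [A] the weight is at most 1 because phi >= 0; off [A] one half of phi is at least b / 2 and
     the other half obeys the linear bound. *)
  apply: (@le_trans _ _ (\int[sigma]_x ((\1_A x)%:E + (expR (- (b / 2)) * expR (M1 / 2))%:E * (expR (- (2^-1 * c * enorm x)))%:E))%E).
    have mE : measurable_fun setT (fun x : V => (expR (- (2^-1 * c * enorm x)))%:E).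
      by apply/measurable_EFinP; exact: measurable_exp_enorm.
    apply: ge0_le_integral => //.
    - by move=> x _; exact: expeR_ge0.
    - exact: measurable_gibbs.
    - apply: emeasurable_funD; last exact: measurable_funeM.
      by apply/measurable_EFinP; exact: measurable_indic.
    - move=> x _; rewrite -EFinM -EFinD -!expRD indicE.
      case: (boolP (x \in A)) => [/set_mem Ax|/negP Ax].
        have := psi0 x; case: (legendre psi x) => [q| |]//=.
        rewrite !lee_fin => q0; apply: (@le_trans _ _ 1); last by rewrite lerDl expR_ge0.
        by rewrite -expR0 ler_expR oppr_le0.
      rewrite add0r; have {Ax} : (b%:E < legendre psi x)%E.
        by rewrite ltNge; apply/negP => h; apply: Ax; rewrite inE.
      have := legendre_ge x ep; case: (legendre psi x) => [q| |]//=.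
      by rewrite lee_fin lte_fin lee_fin ler_expR; lra.
  have mE : measurable_fun setT (fun x : V => (expR (- (2^-1 * c * enorm x)))%:E).
    by apply/measurable_EFinP; exact: measurable_exp_enorm.
  rewrite ge0_integralD//; last 2 first.
  - by apply/measurable_EFinP; exact: measurable_indic.
  - exact: measurable_funeM.
  rewrite integral_indic// setIT ge0_integralZl_EFin//.
  rewrite exp_integralE ?mulr_gt0// -EFinM; apply: leeD => //.
  rewrite lee_fin -mulrA; apply: le_trans eb.
  by rewrite ler_wpM2l ?expR_ge0.
by rewrite -EFinD lee_fin; lra.
Qed.

(** The conjugate of sum |y_i| is at most 0 on the unit cube, so the Gibbs integral is at least
    sigma of that cube. *)
Lemma abs_potential_score : exists psi, admissible psi /\ 0 < score psi.
Proof.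
pose psi (y : V) := (\sum_i `|y ord0 i|)%:E.
have mpsi : measurable_fun setT psi.
  apply/measurable_EFinP; apply: measurable_sum => i.
  by apply: measurableT_comp => //; exact: coord_measurable.
have ep : even_potential psi.
  split => //.
  - by move=> y; congr EFin; apply: eq_bigr => i _; rewrite mxE normrN.
  - by move=> y; rewrite lee_fin sumr_ge0.
  - apply: (@le_lt_trans _ _ (\int[mu]_y (n%:R%:E * (enorm y)%:E))%E).
      apply: ge0_le_integral => //.
      + by move=> y _; rewrite lee_fin sumr_ge0.
      + by apply: measurable_funeM; apply/measurable_EFinP; exact: measurable_enorm.
      + move=> y _; rewrite -EFinM lee_fin.
        apply: (@le_trans _ _ (\sum_(i < n) enorm y)).
          by apply: ler_sum => i _; exact: coord_le_enorm.
        by rewrite sumr_const card_ord -[leLHS]mulr_natl.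
    rewrite ge0_integralZl_EFin//; last 2 first.
    + by move=> y _; rewrite lee_fin enorm_ge0.
    + by apply/measurable_EFinP; exact: measurable_enorm.
    rewrite lte_mul_pinfty// lee_fin//.
have psi0 x : (0 <= legendre psi x)%E.
  apply: le_trans (legendre_ub psi x 0).
  rewrite innerC inner0l /psi big1 ?sube0// => i _.
  by rewrite mxE normr0.
exists psi; split; first by split.
rewrite /score mulr_gt0 ?expR_gt0// -lte_fin -integral_gibbs//.
apply: lt_le_trans scube _.
rewrite -[leLHS]mul1e -integral_cst; last exact: measurable_cube.
rewrite integral_mkcond; apply: ge0_le_integral => //.
- by move=> x _; rewrite patchE; case: ifP.
- by apply/measurable_restrict => //; exact: measurable_cube.
- exact: measurable_gibbs.
- move=> x _; rewrite patchE; case: ifPn => [/set_mem cx|_]; last exact: expeR_ge0.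
  rewrite -[leLHS]expeR0 lee_expeR oppe_ge0; apply/legendre_leP => y.
  rewrite subr0 lee_fin; apply: le_trans (ler_norm _) _; apply: le_trans (inner_le_sum _ _) _.
  by apply: ler_sum => i _; rewrite ler_piMl// ler_norml; exact: cx.
Qed.

Definition scores : set R := [set score psi | psi in admissible].

Lemma score_le psi : admissible psi -> score psi <= exp_integral c.
Proof.
move=> ap; have h01 : 0 < (1 : R) <= 1 by rewrite ltr01 lexx.
have := admissible_gibbs_le ap h01; rewrite !mul1r => h.
rewrite /score expRN ler_pdivrMr ?expR_gt0//; apply: le_trans h _.
by rewrite mulrC.
Qed.

Lemma scores_has_sup : has_sup scores.
Proof.
have [psi [ap _]] := abs_potential_score.
split; first by exists (score psi), psi.
by exists (exp_integral c) => _ [phi ap' <-]; exact: score_le.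
Qed.

Definition best : R := sup scores.

Lemma score_le_best psi : admissible psi -> score psi <= best.
Proof. by move=> ap; apply: ub_le_sup; [exact: scores_has_sup.2|exists psi]. Qed.

Lemma best_gt0 : 0 < best.
Proof.
have [psi [ap s0]] := abs_potential_score.
exact: lt_le_trans (score_le_best ap).
Qed.

Lemma mean_bounded : exists M0 : R, forall psi, admissible psi ->
  best / 2 < score psi -> mean psi <= M0.
Proof.
(* The factor e^(1/2) compensates s M = 1/2 below; asking for M > 1 keeps s = 1 / (2 M) at most
   1. *)
have e0 : 0 < best / 2 / expR (2^-1).
  by rewrite !divr_gt0 ?expR_gt0// best_gt0.
have [M M1 hM] := hlim 1 e0; exists M => psi ap; apply: contraTle => Mm.
rewrite -leNgt.
have M0 : 0 < M by exact: lt_trans M1.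
pose s := (2 * M)^-1.
have s01 : 0 < s <= 1.
  rewrite invr_gt0 mulr_gt0//= invf_le1 ?mulr_gt0//; lra.
have := admissible_gibbs_le ap s01; set F := exp_integral _ => h.
have FE : F = exp_integral (c / (2 * M)) by rewrite /F mulrC.
apply: (@le_trans _ _ (F * expR (- M) * expR (2^-1))); last first.
  by rewrite -ler_pdivlMr ?expR_gt0// FE ltW.
rewrite /score; apply: (@le_trans _ _ (expR (s * mean psi) * F * expR (- mean psi))).
  by rewrite ler_wpM2r ?expR_ge0.
rewrite mulrAC -expRD mulrC -mulrA -expRD ler_wpM2l ?exp_integral_ge0// ler_expR.
have sM : s * M = 2^-1 by rewrite /s invfM mulfVK ?gt_eqF.
have /andP[s0 s1] := s01.
have : s <= 2^-1 by rewrite /s lef_pV2 ?posrE ?mulr_gt0//; lra.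
move=> s2; have : (1 - s) * M <= (1 - s) * mean psi by rewrite ler_wpM2l ?(ltW Mm)//; lra.
rewrite !mulrBl !mul1r sM; lra.
Qed.

(* Subtracting [inf psi] makes a potential admissible without changing its score. *)
Lemma gibbs_le_best psi : even_potential psi -> gibbs psi <= best * expR (mean psi).
Proof.
move=> ep; have [ev mpsi psi0 psioo] := ep.
have l0 : (legendre psi 0 <= 0)%E.
  by apply/legendre_leP => y; rewrite inner0l subr0.
(* r = - inf psi. It is also the minimum of the conjugate, which is even and convex. *)
have [r rE] : exists r, legendre psi 0 = r%:E.
  by move: (legendre_neqNy 0 ep) l0; case: (legendre psi 0) => // r _ _; exists r.
pose psi' y := (psi y + r%:E)%E.
have rpsi y : (- r%:E <= psi y)%E.
  have /legendre_leP/(_ y) : (legendre psi 0 <= r%:E)%E by rewrite rE.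
  by rewrite inner0l sub0r.
have r_le0 : r <= 0 by rewrite -lee_fin -rE.
have legE x : legendre psi' x = (legendre psi x - r%:E)%E by exact: legendre_addr.
have leg0 x : (0 <= legendre psi' x)%E.
  rewrite legE leeBrDr// add0e -rE.
  have : (legendre psi 0 <= legendre psi x)%E.
    case E : (legendre psi x) => [q| |]; last by have := legendre_neqNy x ep; rewrite E.
    - have h01 : 0 <= (2^-1 : R) <= 1 by apply/andP; split; lra.
      have h1 : (legendre psi x <= q%:E)%E by rewrite E.
      have h2 : (legendre psi (- x)%R <= q%:E)%E by rewrite legendre_even// E.
      have := legendre_convex h01 h1 h2.
      rewrite (_ : 2^-1 *: x + _ = 0); last by apply/rowP => k; rewrite !mxE; lra.
      by rewrite (_ : 2^-1 * q + _ = q)//; lra.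
    - by rewrite leey.
  by [].
have intE : (\int[mu]_y psi' y = (a * (mean psi + r))%:E)%E.
  rewrite mulrDr EFinD -(integral_mean ep).
  have m' : measurable_fun setT psi' by apply: emeasurable_funD.
  have p0' y : (0 <= psi' y)%E by rewrite /psi' -leeBlDr// sub0e.
  have : (\int[mu]_y (psi' y + (- r)%:E) = \int[mu]_y psi y)%E.
    by apply: eq_integral => y _; rewrite /psi' EFinN addeK.
  rewrite ge0_integralD//; last by move=> y _; rewrite lee_fin oppr_ge0.
  rewrite integral_mass => <-.
  by rewrite mulNr EFinN [(a * r)%R]mulrC subeK.
have ep' : even_potential psi'.
  split => //.
  - by move=> y; rewrite /psi' ev.
  - exact: emeasurable_funD.
  - by move=> y; rewrite /psi' -leeBlDr// sub0e.
  - by rewrite intE ltry.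
have mE : mean psi' = mean psi + r.
  by rewrite {1}/mean intE/= mulrAC divff ?mul1r// gt_eqF// mass_gt0.
have gE : gibbs psi' = expR r * gibbs psi.
  apply/EFin_inj; rewrite -integral_gibbs// EFinM -integral_gibbs//.
  rewrite -ge0_integralZl_EFin//.
  - apply: eq_integral => x _; rewrite legE; have := legendre_neqNy x ep.
    case: (legendre psi x) => [q| |]//= _; last by rewrite mule0.
    by rewrite -EFinM -expRD opprB.
  - by move=> x _; exact: expeR_ge0.
  - exact: measurable_gibbs.
have := score_le_best (conj ep' leg0).
rewrite /score mE gE mulrAC -expRD mulrC.
rewrite (_ : r - (mean psi + r) = - mean psi); last by lra.
by rewrite expRN ler_pdivrMr ?expR_gt0.
Qed.

(** The offset k + 2 keeps every score above best / 2, which bounds the means; the Gibbs integrals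
    are at least the scores because means are nonnegative. *)
Lemma maximizing_sequence : exists psi_ : nat -> V -> \bar R, exists M0 : R, forall k,
  [/\ admissible (psi_ k), best * (1 - k.+2%:R^-1) < score (psi_ k),
      best / 2 <= gibbs (psi_ k) & mean (psi_ k) <= M0].
Proof.
have [M0 hM0] := mean_bounded.
have H (k : nat) : exists psi, [/\ admissible psi, best * (1 - k.+2%:R^-1) < score psi,
    best / 2 <= gibbs psi & mean psi <= M0].
  have k0 : (0 : R) < k.+2%:R^-1 by rewrite invr_gt0.
  have ek : 0 < best / k.+2%:R by rewrite divr_gt0 ?best_gt0.
  have [_ [psi ap <-] hs] := sup_adherent ek scores_has_sup.
  have hs' : best * (1 - k.+2%:R^-1) < score psi by rewrite mulrBr mulr1.
  have s2 : best / 2 < score psi.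
    apply: le_lt_trans hs'; rewrite ler_pM2l ?best_gt0//.
    have : (k.+2%:R^-1 : R) <= 2^-1 by rewrite lef_pV2 ?posrE// ler_nat.
    by move: (k.+2%:R^-1) => t; lra.
  exists psi; split => //; last exact: hM0.
  apply: le_trans (ltW s2) _; rewrite /score ler_piMr ?gibbs_ge0//.
  by rewrite -expR0 ler_expR oppr_le0 mean_ge0//; case: ap.
by have [psi_ h] := choice H; exists psi_, M0.
Qed.

(* The maximizer is the pointwise lower limit psi0 of a maximizing sequence along
   which the conjugates converge at all rational points. Its conjugate lies below
   the lower limit of the conjugates at every point: they are uniformly bounded on
   a neighbourhood of the origin, so convexity transfers the bound from x to
   rational points q close to x, and the conjugate of psi0 is lower
   semicontinuous. *)
Lemma maximizer : exists psi0, even_potential psi0 /\ best * expR (mean psi0) <= gibbs psi0.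
Proof.
have [psi_ [M0 hpsi]] := maximizing_sequence.
have ap k : admissible (psi_ k) by have [] := hpsi k.
have ep k : even_potential (psi_ k) by have [] := ap k.
have mM k : mean (psi_ k) <= M0 by have [] := hpsi k.
have b20 : 0 < best / 2 by rewrite divr_gt0 ?best_gt0.
have [rho [b [rho0 hb]]] := nondegenerate M0 b20.
have box k (z : V) : (forall i, `|z ord0 i| <= rho / n%:R) ->
    (legendre (psi_ k) z <= b%:E)%E.
  have hbk := hb _ (ap k) (mM k) _.
  apply: (epi_convex_box n0 rho0); first exact: legendre_convex.
  have [_ _ hg _] := hpsi k.
  move=> i; split; first exact: hbk.
  by rewrite legendre_even; [exact: hbk|have [] := ep k].
(* Countably many questions: is the conjugate at a rational point at most a rational level? Along
   [kk] the answer to each is eventually constant. *)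
pose qv (q : {ffun 'I_n -> rat}) : V := \row_i ratr (q i).
pose A (t : {ffun 'I_n -> rat} * rat) : set nat :=
  [set k | (legendre (psi_ k) (qv t.1) <= (ratr t.2)%:E)%E].
have [kk [jk dich]] := dichotomy_subsequence A.
pose psi0 (y : V) := limn_einf (fun j => psi_ (kk j) y).
have psi00 y : (0 <= psi0 y)%E.
  by apply: (@limn_einf_ge_eventually _ _ _ 0) => j _; have [] := ep (kk j).
have mpsi0 : measurable_fun setT psi0.
  by apply: measurable_limn_einf => j; have [] := ep (kk j).
have fatou_psi : (\int[mu]_y psi0 y <= limn_einf (fun j => (a * mean (psi_ (kk j)))%:E))%E.
  have -> : (fun j => (a * mean (psi_ (kk j)))%:E) = (fun j => \int[mu]_y psi_ (kk j) y)%E.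
    by apply/funext => j; rewrite integral_mean.
  apply: fatou => //; first by move=> j; have [] := ep (kk j).
  by move=> j y _; have [] := ep (kk j).
have intM : (\int[mu]_y psi0 y <= (a * M0)%:E)%E.
  apply: le_trans fatou_psi _; apply: limn_einf_le => j.
  by rewrite lee_fin ler_pM2l ?mass_gt0.
have ep0 : even_potential psi0.
  split => //; last by apply: le_lt_trans intM _; rewrite ltry.
  move=> y; congr limn_einf; apply/funext => j.
  by have [] := ep (kk j).
have mM0 : mean psi0 <= M0.
  by rewrite -(ler_pM2l mass_gt0) -lee_fin -integral_mean.
(* A bound that holds infinitely often holds eventually at each rational level above it, and the
   affine minorants then pass to the lower limit. *)
have frq l q : (forall j0, exists2 j, (j0 <= j)%N & (legendre (psi_ (kk j)) (qv q) <= l%:E)%E) ->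
    (legendre psi0 (qv q) <= l%:E)%E.
  move=> hl; apply/lee_addgt0Pr => e e0.
  have le : l < l + e by rewrite ltrDl.
  have [r] := rat_in_itvoo le; rewrite in_itv/= => /andP[lr re].
  apply: (@le_trans _ _ (ratr r)%:E); last by rewrite -EFinD lee_fin ltW.
  have [[j0 ev]|[j0 ev]] := dich (q, r); last first.
    have [j jj h] := hl j0; case: (ev j jj) => /=.
    by apply: le_trans h _; rewrite lee_fin ltW.
  apply/legendre_leP => y; apply: (@limn_einf_ge_eventually _ _ _ j0) => j jj.
  exact: (legendre_leP _ _ _).1 (ev j jj) y.
have frx l x : (forall j0, exists2 j, (j0 <= j)%N & (legendre (psi_ (kk j)) x <= l%:E)%E) ->
    (legendre psi0 x <= l%:E)%E.
  move=> hl; rewrite leNgt; apply/negP => lx.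
  have [l' ll' l'x] : exists2 l' : R, l < l' & (l'%:E < legendre psi0 x)%E.
    move: lx; case: (legendre psi0 x) => [p| |]// lx.
    - by rewrite lte_fin in lx; exists ((l + p) / 2); rewrite ?lte_fin; lra.
    - by exists (l + 1); rewrite ?ltry ?ltrDl ?ltr01.
  have [U /nbhs_ballP[d /= d0 hd] hU] := legendre_lsc l'x.
  pose N := `|x| + rho + 1; have N0 : 0 < N by rewrite ltr_wpDl// addr_ge0// ltW.
  pose B := `|b - l| + 1; have B0 : 0 < B by rewrite ltr_wpDl.
  (* The three constraints make 1 - th a convex weight, keep the convex combination of the bounds l
     and b at most l', and keep q within d of x. *)
  pose th := Num.min 2^-1 (Num.min ((l' - l) / B) (d / N)).
  have th0 : 0 < th.
    by rewrite !lt_min; apply/and3P; split; rewrite ?invr_gt0 ?divr_gt0 ?subr_gt0.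
  have th1 : th <= 2^-1 by rewrite ge_min lexx.
  have th2 : th * B <= l' - l by rewrite -ler_pdivlMr// !ge_min lexx !orbT.
  have th3 : th * N <= d by rewrite -ler_pdivlMr// !ge_min lexx !orbT.
  have n0' : 0 < (n%:R : R) by rewrite ltr0n.
  have rn0 : 0 < rho / n%:R by rewrite divr_gt0.
  (* The rational point is so close to (1 - th) x that the remainder divided by th lies in the box
     where [b] bounds all conjugates. *)
  have H i : exists r : rat, `|(ratr r : R) - (1 - th) * x ord0 i| < th * (rho / n%:R).
    have w0 : (1 - th) * x ord0 i < (1 - th) * x ord0 i + th * (rho / n%:R).
      by rewrite ltrDl mulr_gt0.
    have [r] := rat_in_itvoo w0; rewrite in_itv/= => /andP[r1 r2].
    by exists r; rewrite ger0_norm; lra.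
  have [r hr] := choice H.
  pose q : {ffun 'I_n -> rat} := [ffun i => r i].
  have qE i : qv q ord0 i = ratr (r i) by rewrite mxE ffunE.
  pose z := th^-1 *: (qv q - (1 - th) *: x).
  have zr i : `|z ord0 i| <= rho / n%:R.
    rewrite /z !mxE ffunE normrM gtr0_norm ?invr_gt0//.
    by rewrite ler_pdivrMl// ltW.
  have qz : qv q = (1 - th) *: x + (1 - (1 - th)) *: z.
    have -> : 1 - (1 - th) = th by ring.
    by rewrite /z scalerA divff ?gt_eqF// scale1r addrC subrK.
  have : (legendre psi0 (qv q) <= l'%:E)%E.
    apply: frq => j0; have [j jj h] := hl j0; exists j => //.
    have t01 : 0 <= 1 - th <= 1 by apply/andP; split; lra.
    have := legendre_convex t01 h (box _ _ zr); rewrite -qz => /le_trans; apply.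
    rewrite lee_fin; apply: (@le_trans _ _ (l + th * (b - l))); first lra.
    have : th * (b - l) <= th * B.
      by rewrite ler_pM2l// /B; apply: le_trans (ler_norm _) _; rewrite lerDl.
    lra.
  rewrite leNgt hU//; apply: hd; rewrite mx_norm_ball /ball_/=.
  rewrite [`|_|](_ : _ = mx_norm (x - qv q))// mx_normrE.
  apply/bigmax_ltP; split => // -[i' i] _ /=; rewrite ord1 !mxE ffunE.
  apply: (@lt_le_trans _ _ (th * N)) => //.
  have xi := coord_le_norm x i.
  have h1 : `|th * x ord0 i| <= th * `|x| by rewrite normrM gtr0_norm// ler_pM2l.
  have h2 : th * (rho / n%:R) <= th * rho.
    by rewrite ler_pM2l// ler_pdivrMr// ler_peMr ?(ltW rho0)// ler1n.
  have := hr i; move: h1; rewrite !ltr_norml ler_norml => /andP[a1 a2] /andP[a3 a4].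
  by rewrite /N; apply/andP; split; lra.
have mg (psi : V -> \bar R) : measurable_fun setT (fun x => fine (expeR (- legendre psi x))).
  by apply: measurableT_comp => //; exact: measurable_gibbs.
have fineE (psi : V -> \bar R) x : even_potential psi ->
    (fine (expeR (- legendre psi x)))%:E = expeR (- legendre psi x).
  by move=> /(legendre_neqNy x); case: (legendre psi x).
pose G (x : V) := expR M0 * expR (- (c * enorm x)).
have GE (psi : V -> \bar R) x : even_potential psi -> mean psi <= M0 ->
    0 <= fine (expeR (- legendre psi x)) <= G x.
  move=> ep1 m1; rewrite fine_ge0 ?expeR_ge0//= /G -expRD.
  have := legendre_ge x ep1; case: (legendre psi x) => [p| |]//=.
  by rewrite lee_fin ler_expR; lra.
(* [dl] is lost twice: in the scores, which eventually exceed best (1 - dl), and in the means, which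
   by Fatou eventually exceed mean psi0 - dl. *)
have key dl : 0 < dl < 1 -> best * (1 - dl) * expR (mean psi0 - dl) <= gibbs psi0.
  move=> /andP[dl0 dl1]; rewrite -lee_fin -integral_gibbs//.
  under eq_integral do rewrite -fineE//.
  apply: (@reverse_fatou _ _ _ sigma (fun j x => fine (expeR (- legendre (psi_ (kk j)) x))) G).
  - by move=> j; exact: mg.
  - by apply: measurable_funM => //; exact: measurable_exp_enorm.
  - exact: mg.
  - by move=> j x; exact: GE.
  - by move=> x; exact: GE.
  - under eq_integral do rewrite EFinM.
    rewrite ge0_integralZl_EFin ?expR_ge0//.
      by rewrite exp_integralE// -EFinM ltry.
    by apply/measurable_EFinP; exact: measurable_exp_enorm.
  (* Weights above l infinitely often mean conjugates at most - ln l infinitely often, and [frx]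
     carries this to the limit. *)
  - move=> x l hl; apply: contrapT => nev.
    have l0 : 0 < l by apply: le_lt_trans hl; have /andP[] := GE _ x ep0 mM0.
    suff : (legendre psi0 x <= (- ln l)%:E)%E.
      move: hl; have := legendre_neqNy x ep0; case: (legendre psi0 x) => [p| |]//= _.
      rewrite lee_fin => h1 h2; have : ln l <= - p by lra.
      by rewrite -ler_expR lnK// leNgt h1.
    apply: frx => j0; apply: contrapT => nfr; apply: nev; exists j0 => j jj.
    rewrite leNgt; apply/negP => hlt; apply: nfr; exists j => //.
    move: hlt; have := legendre_neqNy x (ep (kk j)).
    case: (legendre _ x) => [p| |]//= _; last by rewrite ltNge (ltW l0).
    rewrite lee_fin => h; have : ln l <= - p by rewrite -ler_expR lnK// ltW.
    lra.
  - have : (( a * (mean psi0 - dl))%:E < limn_einf (fun j => (a * mean (psi_ (kk j)))%:E))%E.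
      apply: lt_le_trans fatou_psi; rewrite (integral_mean ep0) lte_fin ltr_pM2l ?mass_gt0//.
      lra.
    move=> /limn_einf_gt_eventually[j0 hj0].
    have [m hm] := inv_nat_lt dl0.
    exists (maxn j0 m) => j; rewrite geq_max => /andP[j0j mj].
    under eq_integral do rewrite fineE//.
    rewrite integral_gibbs// lee_fin.
    have := hj0 j j0j; rewrite lte_fin ltr_pM2l ?mass_gt0// => hmean.
    have [_ hs _ _] := hpsi (kk j).
    have -> : gibbs (psi_ (kk j)) = score (psi_ (kk j)) * expR (mean (psi_ (kk j))).
      by rewrite /score expRN divfK// gt_eqF// expR_gt0.
    apply: ler_pM; rewrite ?expR_ge0 ?mulr_ge0 ?(ltW best_gt0)//; first lra; last first.
      by rewrite ler_expR; lra.
    apply: le_trans (ltW hs); rewrite ler_pM2l ?best_gt0// lerD2l lerN2.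
    apply: le_trans (ltW hm); rewrite lef_pV2 ?posrE// ler_nat.
    by rewrite ltnS (leq_trans mj)// (leq_trans (jk j)).
exists psi0; split => //; apply/ler_addgt0Pr => e e0.
set X := best * _; have X0 : 0 < X by rewrite mulr_gt0 ?best_gt0 ?expR_gt0.
have X20 : 0 < 2 * X by exact: mulr_gt0.
(* The loss is X - X (1 - dl)^2 <= 2 X dl, after e^(-dl) >= 1 - dl. *)
pose dl := Num.min 2^-1 (e / (2 * X)).
have dl0 : 0 < dl by rewrite lt_min invr_gt0 ltr0n divr_gt0.
have dl1 : dl <= 2^-1 by rewrite ge_min lexx.
have dl2 : dl * (2 * X) <= e by rewrite -ler_pdivlMr// ge_min lexx orbT.
have d01 : 0 < dl < 1 by rewrite dl0/=; lra.
have := key _ d01; rewrite expRD mulrACA -/X => h.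
have h2 : (1 - dl) * (1 - dl) <= (1 - dl) * expR (- dl).
  by rewrite ler_wpM2l ?expR_ge1Dx//; lra.
have h3 : X * ((1 - dl) * (1 - dl)) <= X * ((1 - dl) * expR (- dl)) by rewrite ler_pM2l.
have h4 : 0 <= X * (dl * dl).
  by apply: mulr_ge0; [exact: ltW|apply: mulr_ge0; exact: ltW].
lra.
Qed.
End potentials.

(** * Gradients of even convex functions *)

Section symmetric_gradient.
Context (R : realType) (n : nat).
Local Notation V := 'rV[R]_n.
Local Notation e_ i := (delta_mx 0 i : V).
Implicit Types (phi : V -> \bar R) (x y : V).

Lemma axis_gradientN phi x y : (forall x, phi (- x) = phi x) ->
  axis_gradient phi x y -> axis_gradient phi (- x) (- y).
Proof.
move=> ev [xoo ag]; split; first by rewrite ev.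
have E i s : phi (- x + s *: e_ i) = phi (x + (- s) *: e_ i).
  by rewrite -ev opprD opprK scaleNr.
move=> i; have [h1 h2] := ag i; split.
  by move=> s; rewrite E ev mxE mulrN -mulNr; exact: h1.
move=> e /h2[d d0 hd]; exists d => // s sd.
by rewrite E ev mxE mulrN -mulNr -(normrN s); apply: hd; rewrite normrN.
Qed.

Lemma smooth_gradientN phi x : (forall x, phi x != -oo%E) -> epi_convex phi ->
  (forall x, phi (- x) = phi x) -> smooth phi x ->
  smooth phi (- x) /\ gradient phi (- x) = - gradient phi x.
Proof.
move=> phiN cphi ev sx.
have [hg ag] := smooth_gradientP phiN cphi sx.
have [hgN gN] := axis_gradient_has_gradient phiN cphi (axis_gradientN ev ag).
by split=> //; exact: has_gradient_smooth.
Qed.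

End symmetric_gradient.

(** * Approximation of open sets by continuous functions *)

Section open_sets.
Context (R : realType) (n : nat).
Local Notation V := 'rV[R]_n.

Definition dist_compl (U : set V) (x : V) : R := inf [set `|x - z| | z in ~` U].

Lemma dist_compl_ge0 (U : set V) x : 0 <= dist_compl U x.
Proof.
have [[z zU]|nz] := pselect (exists z, (~` U) z).
  by apply: lb_le_inf; [exists `|x - z|, z|move=> _ [y _ <-]].
rewrite /dist_compl; have -> : ~` U = set0.
  by apply/seteqP; split => // z zU; apply: nz; exists z.
by rewrite image_set0 inf0.
Qed.

Lemma dist_compl_le (U : set V) x z : ~ U z -> dist_compl U x <= `|x - z|.
Proof.
by move=> zU; apply: ge_inf; [exists 0; move=> _ [y _ <-]|exists z].
Qed.

Lemma dist_compl_lip (U : set V) x y : ~` U !=set0 ->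
  dist_compl U x <= dist_compl U y + `|x - y|.
Proof.
move=> [z0 z0U]; rewrite -lerBlDr; apply: lb_le_inf.
  by exists `|y - z0|, z0.
move=> _ [z zU <-]; rewrite lerBlDr.
apply: le_trans (dist_compl_le x zU) _.
by rewrite -[x - z](subrKA y) addrC ler_normD.
Qed.

Lemma continuous_dist_compl (U : set V) : ~` U !=set0 -> continuous (dist_compl U).
Proof.
move=> U0 x; apply/(@cvgrPdist_le _ _ _ _ (nbhs_filter x)) => e e0.
apply/nbhs_ballP; exists e => // y; rewrite -ball_normE /= => xy.
apply: le_trans (ltW xy).
have h1 := dist_compl_lip x y U0; have := dist_compl_lip y x U0.
by rewrite distrC => h2; rewrite ler_norml; apply/andP; split; lra.
Qed.

Lemma dist_compl_gt0 (U : set V) x : open U -> ~` U !=set0 -> U x -> 0 < dist_compl U x.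
Proof.
move=> oU [z0 z0U] Ux; have /nbhs_ballP[e /= e0 he] : nbhs x U by exact: open_nbhs_nbhs.
apply: lt_le_trans e0 _; apply: lb_le_inf; first by exists `|x - z0|, z0.
move=> _ [z zU <-]; rewrite leNgt; apply/negP => xz; apply: zU; apply: he.
by rewrite -ball_normE.
Qed.

(** Increases with [m] to the indicator of an open [U] with nonempty complement. For the whole space
    the infimum runs over the empty set and is 0, so that case is treated apart. *)
Definition open_approx (U : set V) (m : nat) (x : V) : R :=
  Num.min 1 (m%:R * dist_compl U x).

(** Open sets are a generating pi-system, and monotone convergence passes from [open_approx] to
    their indicators. *)
Lemma measure_eq_open (m1 m2 : {measure set V -> \bar R}) :
  (m1 setT < +oo)%E ->
  (forall g : V -> R, continuous g -> (forall x, 0 <= g x <= 1) ->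
    (\int[m1]_x (g x)%:E = \int[m2]_x (g x)%:E)%E) ->
  forall E, measurable E -> m1 E = m2 E.
Proof.
move=> fin H E mE.
have HT : m1 setT = m2 setT.
  rewrite -[LHS]mul1e -[RHS]mul1e -!integral_cst//.
  apply: (H (cst 1)); first exact: cst_continuous.
  by move=> x; rewrite ler01 lexx.
apply: (@measure_unique _ _ _ (@open V) (fun=> setT)) => //.
- by move=> A B; exact: openI.
- by move=> _; exact: openT.
- by apply/seteqP; split => // x _; exists 0%N.
move=> U oU; have [U0|nU] := pselect (~` U !=set0); last first.
  rewrite (_ : U = setT)//; apply/seteqP; split => // x _.
  by apply: contrapT => Ux; apply: nU; exists x.
pose g := open_approx U.
have cg m : continuous (g m).
  move=> x; apply: (@continuous_min _ _ (cst 1) (fun x => m%:R * dist_compl U x)).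
    exact: cst_continuous.
  by apply: continuousM; [exact: cst_continuous|exact: continuous_dist_compl].
have g01 m x : 0 <= g m x <= 1.
  by rewrite le_min ler01 mulr_ge0 ?dist_compl_ge0//= ge_min lexx.
have mg m : measurable_fun setT (EFin \o g m).
  apply/measurable_EFinP; apply: (measurability (@RGenOInfty.G R) (RGenOInfty.measurableE R)).
  move=> _ [_ [r ->] <-]; rewrite setTI set_itvE; apply: open_measurableV.
  by apply: open_comp; [move=> x _; exact: cg|exact: open_gt].
have lim x : EFin (g m x) @[m --> \oo] --> (\1_U x)%:E.
  apply: cvg_EFin; first exact: nearW.
  rewrite /=; have [Ux|nUx] := pselect (U x).
    rewrite indicE mem_set//; have d0 := dist_compl_gt0 oU U0 Ux.
    apply: cvg_near_cst; have [k hk] := inv_nat_lt d0.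
    exists k.+1 => // m /= km; rewrite /g /open_approx min_l//.
    have m0 : 0 < (m%:R : R) by rewrite ltr0n (leq_trans _ km).
    rewrite -ler_pdivrMl// mulr1; apply: le_trans (ltW hk).
    by rewrite lef_pV2 ?posrE// ler_nat.
  have d0 : dist_compl U x = 0.
    apply/eqP; rewrite eq_le dist_compl_ge0 andbT.
    by have := dist_compl_le x nUx; rewrite subrr normr0.
  rewrite indicE memNset//; apply: cvg_near_cst; apply: nearW => m.
  by rewrite /= /g /open_approx d0 mulr0 min_r.
have nd x : {homo (fun m => (g m x)%:E) : i j / (i <= j)%N >-> (i <= j)%E}.
  move=> i j ij; rewrite lee_fin /g /open_approx le_min ge_min lexx/=.
  rewrite ge_min; apply/orP; right.
  by rewrite ler_wpM2r ?dist_compl_ge0// ler_nat.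
have key (m : {measure set V -> \bar R}) :
    (\int[m]_x (g k x)%:E)%E @[k --> \oo] --> m U.
  have -> : m U = (\int[m]_x (\1_U x)%:E)%E.
    by rewrite integral_indic ?setIT//; exact: open_measurableV.
  have -> : (\int[m]_x (\1_U x)%:E = \int[m]_x limn (fun k => (g k x)%:E))%E.
    by apply: eq_integral => x _; apply/esym/cvg_lim => //; exact: lim.
  apply: cvg_monotone_convergence => //.
  - by move=> k x _; rewrite lee_fin; have /andP[] := g01 k x.
have h1 := key m1; have h2 := key m2.
have E12 : (fun k => \int[m1]_x (g k x)%:E)%E = (fun k => \int[m2]_x (g k x)%:E)%E.
  by apply/funext => k; exact: H.
by rewrite E12 in h1; exact: (cvg_unique _ h1 h2).
Qed.

End open_sets.

(** * The Euler-Lagrange equation *)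

Section euler_lagrange.
Context (R : realType) (n : nat).
Local Notation V := 'rV[R]_n.
Context (sigma : {measure set V -> \bar R}) (mu : {finite_measure set V -> \bar R}).
Context (sac : forall N : set V, measurable N -> lebesgue_rV R n N = 0%E -> sigma N = 0%E)
  (sN : forall A : set V, measurable A -> sigma (-%R @^-1` A) = sigma A)
  (muN : even_measure mu) (mu_neq0 : mu setT != 0%E).
Local Notation a := (fine (mu setT)).
(** [mass] is the normalization of the potential; [opt] compares a maximizer with psi + g / (m + 1),
    whose mean is larger by int g dmu / (a (m + 1)). *)
Context (psi : V -> \bar R) (psiN : forall y, psi (- y) = psi y)
  (legN : forall x, legendre psi x != -oo%E)
  (mass : (\int[sigma]_x expeR (- legendre psi x))%E = a%:E)
  (opt : forall g : V -> R, continuous g -> (forall x, g (- x) = g x) ->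
    (forall x, 0 <= g x <= 1) -> forall m : nat,
    (\int[sigma]_x expeR (- legendre (fun y => psi y + (g y / m.+1%:R)%:E) x) <=
     (a * expR (fine (\int[mu]_y (g y)%:E) / a / m.+1%:R))%:E)%E).

Local Notation Phi := (legendre psi).
Let cPhi : epi_convex Phi := @legendre_convex _ _ psi.
Let mPhi : measurable_fun setT Phi := @measurable_legendre _ _ psi.
Let msm : measurable (smooth Phi) := measurable_smooth mPhi.
Let msg : measurable_fun setT (smooth_gradient Phi) :=
  measurable_smooth_gradient legN cPhi mPhi.

Definition gibbs_density (x : V) : R := fine (expeR (- Phi x)) * \1_(smooth Phi) x.

Lemma gibbs_density_ge0 x : 0 <= gibbs_density x.
Proof. by rewrite mulr_ge0// fine_ge0// expeR_ge0. Qed.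

Lemma measurable_gibbs_density : measurable_fun setT gibbs_density.
Proof.
apply: measurable_funM; last exact: measurable_indic.
by apply: measurableT_comp => //; exact: measurable_gibbs.
Qed.

Definition gibbs_measure : {measure set V -> \bar R} :=
  density sigma measurable_gibbs_density gibbs_density_ge0.

(** The curvature measure of e^(-phi) as a push-forward, the form in which test functions are
    integrated. *)
Definition gradient_measure : {measure set V -> \bar R} :=
  measure_function_pushforward__canonical__measure_function_Measure gibbs_measure msg.

Lemma integral_gradient_measure (g : V -> R) : measurable_fun setT g ->
  (forall y, 0 <= g y) ->
  (\int[gradient_measure]_y (g y)%:E =
   \int[sigma]_x (g (smooth_gradient Phi x) * gibbs_density x)%:E)%E.
Proof.
move=> mg g0; have mg' : measurable_fun setT (EFin \o g) by apply/measurable_EFinP.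
have := ge0_integral_pushforward msg gibbs_measure measurableT mg' (fun y _ => g0 y).
rewrite preimage_setT => E; apply: (etrans E); rewrite integral_density//.
- by apply/measurable_EFinP; exact: measurableT_comp.
- by move=> x; rewrite lee_fin.
Qed.

Lemma continuous_measurableV (g : V -> R) : continuous g -> measurable_fun setT g.
Proof.
move=> cg; apply: (measurability (@RGenOInfty.G R) (RGenOInfty.measurableE R)).
move=> _ [_ [r ->] <-]; rewrite setTI set_itvE; apply: open_measurableV.
by apply: open_comp; [move=> x _; exact: cg|exact: open_gt].
Qed.

Lemma gibbsE x : (fine (expeR (- Phi x)))%:E = expeR (- Phi x).
Proof. by move: (legN x); case: (legendre psi x). Qed.

(** Non-smooth points of the domain are sigma-null and e^(-phi) vanishes outside the domain, so no
    mass is lost. *)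
Lemma gradient_measure_setT : gradient_measure setT = mu setT.
Proof.
have -> : mu setT = a%:E by rewrite fineK// fin_num_measure.
rewrite -mass -[LHS]mul1e -integral_cst//.
have -> : (\int[gradient_measure]_y cst 1%E y = \int[gradient_measure]_y (cst 1 y)%:E)%E by [].
rewrite integral_gradient_measure//.
have null : sigma ([set x | (Phi x < +oo)%E] `\` smooth Phi) = 0%E.
  apply: sac; last exact: lebesgue_not_smooth.
  by apply: measurableD => //; exact: measurable_lt_pinfty.
apply: ge0_ae_eq_integral => //.
- by apply/measurable_EFinP; apply: measurable_funM => //; exact: measurable_gibbs_density.
- exact: measurable_gibbs.
- by move=> x _; rewrite lee_fin mulr_ge0// gibbs_density_ge0.
- by move=> x _; exact: expeR_ge0.
exists ([set x | (Phi x < +oo)%E] `\` smooth Phi); split => //.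
  by apply: measurableD => //; exact: measurable_lt_pinfty.
move=> x /=; apply: contra_notP => nx _.
rewrite mul1r /gibbs_density -gibbsE; congr EFin.
have [sx|nsx] := pselect (smooth Phi x); first by rewrite indicE mem_set// mulr1.
rewrite indicE memNset// mulr0; move: (legN x) nx.
case E : (legendre psi x) => [r| |]//= _ nx.
by exfalso; apply: nx; split => //=; rewrite ?E ltry.
Qed.

(* A difference quotient of the Gibbs weight in the direction g, bounded from
   below: near-maximizers of <x,y> - psi y are close to the gradient. *)
Lemma perturbation_lower (g : V -> R) x (e : R) : continuous g -> (forall x, 0 <= g x <= 1) ->
  smooth Phi x -> 0 < e -> exists m0 : nat, forall m, (m0 <= m)%N ->
  (legendre (fun y => psi y + (g y / m.+1%:R)%:E)%E x <=
     Phi x - ((g (gradient Phi x) - e) / m.+1%:R)%:E)%E.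
Proof.
move=> cg g01 sx e0.
have [_ ag] := smooth_gradientP legN cPhi sx.
move: (gradient _ _) ag => y0 ag.
have : \forall y \near y0, `|g y0 - g y| < e.
  exact: (cvgr_dist_lt _ _ (cg y0)).
move=> /nbhs_ballP[eta /= eta0 heta].
have eta20 : 0 < eta / 2 by rewrite divr_gt0.
have [dl dl0 hdl] := legendre_near_max ag (legN x) eta20.
have [m0 hm0] := inv_nat_lt dl0.
have [xoo _] := ag.
have [r rE] : exists r, Phi x = r%:E.
  by move: (legN x) xoo; case: (legendre psi x) => // r _ _; exists r.
exists m0 => m mm; set k : R := m.+1%:R^-1.
have k0 : 0 < k by rewrite /k invr_gt0.
have kdl : k <= dl.
  by apply: le_trans (ltW hm0); rewrite lef_pV2 ?posrE// ler_nat.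
rewrite rE -EFinB; apply/legendre_leP => y.
have /andP[gy0 gy1] := g01 y; have /andP[gz0 gz1] := g01 y0.
have ub := legendre_ub psi x y; move: ub (hdl y); rewrite rE.
case: (psi y) => [q| |]//=; last by rewrite leey.
rewrite -!EFinB !lee_fin => h1 h2.
have gk : 0 <= g y * k by rewrite mulr_ge0// ltW.
(* Away from near-maximizers the loss [dl] >= 1 / (m + 1) covers any change due to g <= 1; near them
   y is close to the gradient, and continuity of g applies. *)
have [near_|far] := leP (r - dl) (inner x y - q); last first.
  have : (g y0 - e) * k <= k by rewrite ler_piMl ?(ltW k0)//; lra.
  lra.
have : ball y0 eta y.
  rewrite mx_norm_ball /ball_ /= [`|_|](_ : _ = mx_norm (y0 - y))// mx_normrE.
  apply/bigmax_ltP; split => // -[i' i] _ /=; rewrite ord1 !mxE.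
  by rewrite distrC; apply: le_lt_trans (h2 near_ i) _; rewrite ltr_pdivrMr// ltr_pMr// ltr1n.
move=> /heta; rewrite ltr_norml => /andP[_ h3].
have : (g y0 - e) * k <= g y * k by rewrite ler_pM2r//; lra.
lra.
Qed.

(** Fatou for (m + 1) (e^(-phi_m) - e^(-phi)) >= 0, where phi_m is the conjugate of psi + g / (m +
    1). The pointwise lower limit is at least g(grad phi) e^(-phi) at smooth points, and [opt]
    bounds the integrals by (m + 1) a (e^(u / (m + 1)) - 1), which tends to a u = int g dmu. *)
Lemma gradient_measure_le (g : V -> R) : continuous g -> (forall x, g (- x) = g x) ->
  (forall x, 0 <= g x <= 1) ->
  (\int[gradient_measure]_y (g y)%:E <= \int[mu]_y (g y)%:E)%E.
Proof.
move=> cg gN g01.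
have g0 x : 0 <= g x by have /andP[] := g01 x.
have mg := continuous_measurableV cg.
have gle : (\int[mu]_y (g y)%:E <= a%:E)%E.
  have -> : a%:E = mu setT by rewrite fineK// fin_num_measure.
  rewrite -[leRHS]mul1e -integral_cst//; apply: ge0_le_integral => //.
  - by move=> y _; rewrite lee_fin.
  - by apply/measurable_EFinP.
  - by move=> y _; rewrite lee_fin; have /andP[] := g01 y.
have gge : (0 <= \int[mu]_y (g y)%:E)%E by apply: integral_ge0 => y _; rewrite lee_fin.
have [I IE] : exists I : R, (\int[mu]_y (g y)%:E)%E = I%:E.
  by move: gle gge; case: (integral _ _ _) => // r _ _; exists r.
rewrite IE in gle gge *; rewrite !lee_fin in gle gge.
have a0 : 0 < a := mass_gt0 mu_neq0.
pose u := I / a; have u0 : 0 <= u by rewrite divr_ge0// ltW.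
have u1 : u <= 1 by rewrite ler_pdivrMr// mul1r.
pose psim m y := (psi y + (g y / m.+1%:R)%:E)%E.
have lem m x : (legendre (psim m) x <= Phi x)%E.
  by apply: legendre_le => y; rewrite leeDl// lee_fin divr_ge0.
have leg m x : (Phi x - (m.+1%:R^-1)%:E <= legendre (psim m) x)%E.
  rewrite -legendre_addr; apply: legendre_le => y; apply: leeD => //.
  rewrite lee_fin -[leRHS]mul1r ler_wpM2r//; by have /andP[] := g01 y.
have legmN m x : legendre (psim m) x != -oo%E.
  have := leg m x; move: (legN x); case: (legendre psi x) => [r| |]//= _;
    by case: (legendre (psim m) x).
pose hm m x := m.+1%:R * (fine (expeR (- legendre (psim m) x)) - fine (expeR (- Phi x))).
have mfe (phi : V -> \bar R) : measurable_fun setT (fun x => fine (expeR (- legendre phi x))).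
  by apply: measurableT_comp => //; exact: measurable_gibbs.
have diff0 m x : 0 <= fine (expeR (- legendre (psim m) x)) - fine (expeR (- Phi x)).
  rewrite subr_ge0 fine_le//.
  - by move: (legN x); case: (legendre psi x).
  - by move: (legmN m x); case: (legendre _ x).
  - by rewrite lee_expeR leeN2.
have hm0 m x : 0 <= hm m x by rewrite mulr_ge0.
have mhm m : measurable_fun setT (EFin \o hm m).
  by apply/measurable_EFinP; apply: measurable_funM => //; apply: measurable_funB; exact: mfe.
have intPhi : sigma.-integrable setT (fun x => (fine (expeR (- Phi x)))%:E).
  apply/integrableP; split; first by apply/measurable_EFinP; exact: mfe.
  under eq_integral do rewrite gee0_abs ?lee_fin ?fine_ge0 ?expeR_ge0// gibbsE.
  by rewrite mass ltry.
have fmE m x : (fine (expeR (- legendre (psim m) x)))%:E = expeR (- legendre (psim m) x).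
  by move: (legmN m x); case: (legendre _ x).
have intm m : sigma.-integrable setT (fun x => (fine (expeR (- legendre (psim m) x)))%:E).
  apply/integrableP; split; first by apply/measurable_EFinP; exact: mfe.
  under eq_integral do rewrite gee0_abs ?lee_fin ?fine_ge0 ?expeR_ge0// fmE.
  by apply: le_lt_trans (opt cg gN g01 m) _; rewrite ltry.
have idiff m : (\int[sigma]_x (fine (expeR (- legendre (psim m) x)) - fine (expeR (- Phi x)))%:E =
    \int[sigma]_x expeR (- legendre (psim m) x) - a%:E)%E.
  apply: etrans (integralB_EFin measurableT (intm m) intPhi) _; rewrite -mass.
  by congr (_ - _)%E; apply: eq_integral => x _; rewrite ?fmE ?gibbsE.
have ihm m : (\int[sigma]_x (hm m x)%:E <= (m.+1%:R * (a * expR (u / m.+1%:R) - a))%:E)%E.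
  under eq_integral do rewrite EFinM.
  rewrite ge0_integralZl_EFin//; last 2 first.
  - by move=> x _; rewrite lee_fin.
  - by apply/measurable_EFinP; apply: measurable_funB; exact: mfe.
  rewrite idiff EFinM; apply: lee_wpmul2l; first by rewrite lee_fin.
  rewrite EFinB; apply: leeB => //.
  by have := opt cg gN g01 m; rewrite IE.
have := @fatou _ _ _ sigma setT measurableT (fun m x => (hm m x)%:E) mhm (fun m x _ => hm0 m x).
have up : (limn_einf (fun m => \int[sigma]_x (hm m x)%:E) <= I%:E)%E.
  apply/lee_addgt0Pr => e e0.
  (* The first bound is the range of the estimate of e^v, the second absorbs the remainder 2 a / (m
     + 1). *)
  pose dl := Num.min 2^-1 (e / (2 * a + 1)).
  have a20 : 0 < 2 * a + 1 by rewrite addr_gt0// mulr_gt0.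
  have dl0 : 0 < dl by rewrite lt_min invr_gt0 ltr0n divr_gt0.
  have [M hM] := inv_nat_lt dl0.
  apply: (@limn_einf_le_eventually _ _ _ M) => m Mm.
  apply: le_trans (ihm m) _; rewrite -EFinD lee_fin.
  set k : R := m.+1%:R; have k0 : 0 < k by rewrite ltr0n.
  have kdl : k^-1 <= dl.
    by apply: le_trans (ltW hM); rewrite lef_pV2 ?posrE// ler_nat.
  have k2 : k^-1 <= 2^-1 by apply: le_trans kdl _; rewrite ge_min lexx.
  have ke : k^-1 * (2 * a + 1) <= e.
    by rewrite -ler_pdivlMr//; apply: le_trans kdl _; rewrite ge_min lexx orbT.
  set v := u / k; have v0 : 0 <= v by rewrite divr_ge0// ltW.
  have vk : v <= k^-1 by rewrite /v ler_piMl// invr_ge0 ltW.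
  (* [e^v <= 1 / (1 - v) <= 1 + v + 2 v^2] for [v <= 1/2] *)
  have ev : expR v <= 1 + v + 2 * (v * v).
    have v2 : v <= 2^-1 := le_trans vk k2.
    have v1 : 0 < 1 - v by move: v2; move: (v) => z; lra.
    have h1 : 1 - v <= expR (- v) by exact: expR_ge1Dx.
    have h2 : (1 - v) * expR v <= 1.
      by rewrite -[leRHS](expRxMexpNx_1 v) mulrC ler_wpM2l ?expR_ge0.
    have h3 : 1 <= (1 - v) * (1 + v + 2 * (v * v)).
      have : 0 <= (v * v) * (1 - 2 * v) by apply: mulr_ge0; [exact: mulr_ge0|move: v2; move: (v) => z; lra].
      by move: (v) => z; lra.
    by have := le_trans h2 h3; rewrite ler_pM2l.
  have kv : k * v = u by rewrite /v mulrC divfK// gt_eqF.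
  have aI : a * u = I by rewrite /u mulrC divfK// gt_eqF.
  have h4 : k * (a * (expR v - 1)) <= k * (a * (v + 2 * (v * v))).
    by rewrite ler_pM2l// ler_pM2l//; lra.
  have h5 : k * (a * (v + 2 * (v * v))) = I + a * u * (2 * v) by rewrite -aI -kv; ring.
  have h6 : a * u * (2 * v) <= a * (2 * k^-1).
    apply: ler_pM.
    - by rewrite mulr_ge0// ltW.
    - by rewrite mulr_ge0.
    - by rewrite ler_piMr// ltW.
    - by rewrite ler_pM2l.
  have k1 : 0 < k^-1 by rewrite invr_gt0.
  have -> : k * (a * expR v - a) = k * (a * (expR v - 1)) by ring.
  by move: h4 h5 h6 ke k1; move: (k^-1) (expR v) => p q; lra.
have low : (\int[gradient_measure]_y (g y)%:E <=
    \int[sigma]_x limn_einf (fun m => (hm m x)%:E))%E.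
  rewrite integral_gradient_measure//; apply: ge0_le_integral => //.
  - by move=> x _; rewrite lee_fin mulr_ge0// gibbs_density_ge0.
  - apply/measurable_EFinP; apply: measurable_funM; last exact: measurable_gibbs_density.
    exact: measurableT_comp.
  - exact: measurable_limn_einf.
  - move=> x _; rewrite /gibbs_density /smooth_gradient.
    have [sx|nsx] := pselect (smooth Phi x); last first.
      rewrite [X in _ * (_ * X)]indicE memNset// mulr0 mulr0.
      by apply: (@limn_einf_ge_eventually _ _ _ 0) => m _; rewrite lee_fin.
    rewrite indicE mem_set// mulr1; apply/lee_subgt0Pr => e e0.
    have [xoo _] := sx.
    have [r rE] : exists r, Phi x = r%:E.
      by move: (legN x) xoo; case: (legendre psi x) => // r _ _; exists r.
    (* The error is divided by e^(-phi(x)) in advance because the difference quotient carries that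
       factor. *)
    have e'0 : 0 < e / expR (- r) by rewrite divr_gt0// expR_gt0.
    have [m0 hm0'] := perturbation_lower cg g01 sx e'0.
    apply: (@limn_einf_ge_eventually _ _ _ m0) => m mm.
    rewrite -EFinB lee_fin /hm; have := hm0' m mm.
    have := legmN m x; rewrite rE; case: (legendre _ x) => [p| |]//= _.
    set k : R := m.+1%:R; have k0 : 0 < k by rewrite ltr0n.
    rewrite -EFinB lee_fin; set t := g _ - _ => hp.
    have h1 : t / k <= r - p by move: hp; move: (t / k) => q; lra.
    have h2 : 1 + (r - p) <= expR (r - p) by exact: expR_ge1Dx.
    have h3 : expR (- p) = expR (- r) * expR (r - p) by rewrite -expRD; congr expR; ring.
    rewrite h3; have h4 : expR (- r) * (1 + t / k) <= expR (- r) * expR (r - p).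
      by rewrite ler_pM2l ?expR_gt0//; apply: le_trans h2; rewrite lerD2l.
    apply: (@le_trans _ _ (k * (expR (- r) * (1 + t / k) - expR (- r)))); last first.
      by rewrite ler_pM2l// lerD2r.
    have -> : k * (expR (- r) * (1 + t / k) - expR (- r)) = expR (- r) * t.
      by field; rewrite gt_eqF.
    suff -> : expR (- r) * t = g (gradient Phi x) * expR (- r) - e by [].
    by rewrite mulrC mulrBl divfK// gt_eqF// expR_gt0.
by move=> /(le_trans low)/le_trans; exact.
Qed.

(** Both measures have total mass [a], so the inequality for 1 - g is the reverse one for g. *)
Lemma gradient_measure_eq_even (g : V -> R) : continuous g -> (forall x, g (- x) = g x) ->
  (forall x, 0 <= g x <= 1) ->
  (\int[gradient_measure]_y (g y)%:E = \int[mu]_y (g y)%:E)%E.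
Proof.
move=> cg gN g01.
have fin (m : {measure set V -> \bar R}) : m setT = a%:E ->
    exists I, (\int[m]_y (g y)%:E)%E = I%:E /\ (\int[m]_y (1 - g y)%:E)%E = (a - I)%:E.
  move=> ma.
  have mg := continuous_measurableV cg.
  have i1 : m.-integrable setT (EFin \o cst (1 : R)).
    apply/integrableP; split; first exact/measurable_EFinP.
    apply: (@le_lt_trans _ _ (\int[m]_x 1%:E)%E); last by rewrite integral_cst// mul1e ma ltry.
    by rewrite (@eq_integral _ _ _ _ _ (cst 1%:E))// => x _ /=; rewrite normr1.
  have ig : m.-integrable setT (EFin \o g).
    apply: le_integrable i1 => //; first exact/measurable_EFinP.
    move=> x _ /=; have /andP[h0 h1] := g01 x.
    by rewrite lee_fin normr1 ger0_norm.
  have := integrable_fin_num measurableT ig; case E : (integral _ _ _) => [I| |]// _.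
  exists I; split => //.
  apply: etrans (integralB_EFin measurableT i1 ig) _.
  by rewrite [X in (_ - X)%E]E [X in (X - _)%E](integral_cst m measurableT 1%:E) mul1e ma.
have amu : mu setT = a%:E by rewrite fineK// fin_num_measure.
have [I1 [h1 h1']] := fin gradient_measure (etrans gradient_measure_setT amu).
have [I2 [h2 h2']] := fin mu amu.
have le1 := gradient_measure_le cg gN g01.
have c1 : continuous (fun x => 1 - g x).
  by move=> x; apply: continuousB; [exact: cst_continuous|exact: cg].
have N1 x : 1 - g (- x) = 1 - g x by rewrite gN.
have b1 x : 0 <= 1 - g x <= 1 by have /andP[? ?] := g01 x; apply/andP; split; lra.
have le2 := gradient_measure_le c1 N1 b1.
move: le1 le2; rewrite h1 h1' h2 h2' !lee_fin => le1 le2.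
by congr EFin; lra.
Qed.

Lemma gibbs_densityN x : gibbs_density (- x) = gibbs_density x.
Proof.
have PN := legendre_even psiN.
rewrite /gibbs_density PN; congr (_ * _); rewrite !indicE; congr ((nat_of_bool _)%:R).
have sN' y : smooth Phi y -> smooth Phi (- y).
  by move=> sy; have [] := smooth_gradientN legN cPhi PN sy.
by apply/idP/idP => /set_mem h; apply/mem_set; [rewrite -[x]opprK|]; exact: sN'.
Qed.

Lemma gradient_measureN (A : set V) : measurable A ->
  gradient_measure (-%R @^-1` A) = gradient_measure A.
Proof.
move=> mA; have PN := legendre_even psiN.
have mN := @measurable_oppV R n.
pose B := smooth_gradient Phi @^-1` A.
have mB : measurable B by rewrite -[B]setTI; exact: msg.
have mh : measurable_fun B (EFin \o gibbs_density).
  by apply: measurable_funTS; apply/measurable_EFinP; exact: measurable_gibbs_density.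
have E := ge0_integral_pushforward mN sigma mB mh (fun x _ => gibbs_density_ge0 x).
transitivity (\int[sigma]_(x in -%R @^-1` B) ((EFin \o gibbs_density) \o -%R) x)%E.
  rewrite /gradient_measure /= /pushforward /= /density.
  rewrite [LHS]integral_mkcond [RHS]integral_mkcond; apply: eq_integral => x _.
  rewrite !patchE /= gibbs_densityN.
  have [sx|nsx] := pselect (smooth Phi x); last first.
    have -> : gibbs_density x = 0 by rewrite /gibbs_density indicE memNset ?mulr0.
    by do 2 case: ifP.
  have [sNx gN] := smooth_gradientN legN cPhi PN sx.
  congr (if _ then _ else _); rewrite /B /smooth_gradient; apply/idP/idP => /set_mem/=.
    by rewrite mem_set// => h; apply/mem_set; rewrite /= mem_set// gN.
  by rewrite mem_set// gN => h; apply/mem_set; rewrite /= mem_set.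
by rewrite -E; apply: eq_measure_integral => C mC CB; exact: sN.
Qed.

Lemma integral_symm (m : {measure set V -> \bar R}) (g : V -> R) :
  (forall A : set V, measurable A -> m (-%R @^-1` A) = m A) ->
  measurable_fun setT g -> (forall x, 0 <= g x) ->
  (\int[m]_x (g (- x)%R)%:E = \int[m]_x (g x)%:E)%E.
Proof.
move=> mNm mg g0.
have mg' : measurable_fun setT (EFin \o g) by apply/measurable_EFinP.
have := ge0_integral_pushforward (@measurable_oppV R n) m measurableT mg' (fun x _ => g0 x).
rewrite preimage_setT => /esym E; apply: (etrans E).
by apply: eq_measure_integral => [|mN C mC _]; [exact: measurable_oppV|exact: mNm].
Qed.

(** Both measures are invariant under reflection, so a test function may be replaced by its even
    part. *)
Lemma gradient_measure_eq (E : set V) : measurable E -> gradient_measure E = mu E.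
Proof.
move=> mE; apply: measure_eq_open mE; first by rewrite gradient_measure_setT ltey_eq fin_num_measure.
move=> g cg g01.
have mg := continuous_measurableV cg.
have g0 x : 0 <= g x by have /andP[] := g01 x.
pose h x := 2^-1 * (g x + g (- x)).
have cgN : continuous (fun x : V => g (- x)).
  by move=> x; apply: continuous_comp; [exact: opp_continuous|exact: cg].
have ch : continuous h.
  move=> x; apply: (@continuousM R V (fun=> 2^-1) (fun x => g x + g (- x)) x).
    exact: cst_continuous.
  by apply: continuousD; [exact: cg|exact: cgN].
have hN x : h (- x) = h x by rewrite /h opprK addrC.
have h01 x : 0 <= h x <= 1.
  have /andP[? ?] := g01 x; have /andP[? ?] := g01 (- x).
  by rewrite /h; apply/andP; split; lra.
have key (m : {measure set V -> \bar R}) : (forall A : set V, measurable A -> m (-%R @^-1` A) = m A) ->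
    (\int[m]_x (h x)%:E = \int[m]_x (g x)%:E)%E.
  move=> mNm; have mgN := continuous_measurableV cgN.
  under eq_integral do rewrite EFinM.
  rewrite ge0_integralZl_EFin//; last 2 first.
  - by move=> x _; rewrite lee_fin addr_ge0.
  - by apply/measurable_EFinP; exact: measurable_funD.
  under eq_integral do rewrite EFinD.
  rewrite ge0_integralD//; last 4 first.
  - by move=> x _; rewrite lee_fin.
  - exact/measurable_EFinP.
  - by move=> x _; rewrite lee_fin.
  - exact/measurable_EFinP.
  rewrite integral_symm//.
  case: (integral _ _ _) => [I| |].
  - by rewrite -EFinD -EFinM; congr EFin; lra.
  - by rewrite gt0_muley// lte_fin invr_gt0.
  - by rewrite gt0_muleNy// lte_fin invr_gt0.
rewrite -(key gradient_measure) -?(key mu); first exact: gradient_measure_eq_even.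
- move=> A mA; rewrite -[RHS]muN//; congr (mu _); apply/seteqP; split => x /=.
    by move=> Ax; exists (- x); rewrite ?opprK.
  by move=> [y Ay <-]; rewrite opprK.
- exact: gradient_measureN.
Qed.

End euler_lagrange.

(** * The constant zeta *)

Section zeta.
Context (R : realType) (n : nat) (n_ge1 : (1 <= n)%N).
Local Notation V := 'rV[R]_n.
Context (mu : {finite_measure set V -> \bar R}) (mu1 : finite_first_moment mu).

Let measurable_abs_inner x : measurable_fun setT (fun y : V => `|inner y x|%:E).
Proof.
by apply/measurable_EFinP; apply: measurableT_comp => //; exact: measurable_inner.
Qed.

Lemma zeta_ge0 : (0 <= zeta mu)%E.
Proof.
apply: le_ereal_inf_tmp => _ [v _ <-].
by apply: integral_ge0 => y _; rewrite lee_fin.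
Qed.

(** The sphere is nonempty for n >= 1 and the first moment bounds the integrals, so [fine (zeta mu)]
    is the true infimum and not a default value. *)
Lemma zeta_fin_num : zeta mu \is a fin_num.
Proof.
rewrite ge0_fin_numE ?zeta_ge0//.
pose v : V := delta_mx 0 (Ordinal n_ge1).
have v1 : enorm v = 1.
  by rewrite /enorm inner_axisl mxE !eqxx sqrtr1.
apply: (@le_lt_trans _ _ (\int[mu]_y `|inner y v|%:E)%E).
  by apply: ereal_inf_lbound; exists v.
apply: (@le_lt_trans _ _ (\int[mu]_y (n%:R * enorm y)%:E)%E).
  apply: ge0_le_integral => //.
  - by apply/measurable_EFinP; apply: measurable_funM => //; exact: measurable_enorm.
  - by move=> y _; rewrite lee_fin; have := inner_le_enorm y v; rewrite v1 mulr1.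
under eq_integral do rewrite EFinM.
rewrite ge0_integralZl_EFin//; last 2 first.
- by move=> y _; rewrite lee_fin enorm_ge0.
- by apply/measurable_EFinP; exact: measurable_enorm.
by rewrite lte_mul_pinfty// lee_fin.
Qed.

Lemma zeta_enorm_le x : ((fine (zeta mu) * enorm x)%:E <= \int[mu]_y `|inner y x|%:E)%E.
Proof.
have [x0|x0] := eqVneq (enorm x) 0.
  by rewrite x0 mulr0; apply: integral_ge0 => y _; rewrite lee_fin.
have xp : 0 < enorm x by rewrite lt0r x0 enorm_ge0.
pose v := (enorm x)^-1 *: x.
have v1 : enorm v = 1 by rewrite enormZ ger0_norm ?invr_ge0 ?enorm_ge0// mulVf.
have xE : x = enorm x *: v by rewrite /v scalerA divff// scale1r.
have iE y : `|inner y x| = enorm x * `|inner y v|.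
  by rewrite {1}xE innerC innerZl innerC normrM ger0_norm ?enorm_ge0.
rewrite (@eq_integral _ _ _ _ _ (fun y => (enorm x)%:E * `|inner y v|%:E)%E); last first.
  by move=> y _; rewrite iE EFinM.
rewrite ge0_integralZl_EFin ?enorm_ge0// mulrC EFinM.
apply: lee_wpmul2l; first by rewrite lee_fin enorm_ge0.
by rewrite fineK ?zeta_fin_num//; apply: ereal_inf_lbound; exists v.
Qed.

End zeta.

(** * The hypothesis on F_w in terms of sigma *)

Section weight_integrals.
Context (R : realType) (n : nat) (n_ge1 : (1 <= n)%N).
Local Notation V := 'rV[R]_n.
Local Notation leb := (lebesgue_rV R n).
Context (w : V -> R) (hw : weight w).

Lemma integral_weight0 (D : set V) (f : V -> R) : measurable D -> measurable_fun setT f ->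
  (\int[leb]_(x in D) (f x * w x)%:E = \int[leb]_(x in D) (f x * weight0 w x)%:E)%E.
Proof.
move=> mD mf; apply: ae_eq_integral => //.
- apply: measurable_funTS; apply/measurable_EFinP; apply: measurable_funM => //.
  exact: measurable_weight.
- apply: measurable_funTS; apply/measurable_EFinP; apply: measurable_funM => //.
  exact: measurable_weight0.
exists [set 0]; split; [exact: measurable_set1V|exact: lebesgue_set0|].
move=> x /= h; apply: contrapT => /eqP x0; apply: h => _.
by rewrite /weight0 (negbTE x0).
Qed.

Lemma wmeasure_null (N : set V) : measurable N -> leb N = 0%E -> wmeasure hw N = 0%E.
Proof.
move=> mN N0; rewrite /wmeasure /= /density; apply: null_set_integral => //.
by apply: measurable_funTS; apply/measurable_EFinP; exact: measurable_weight0.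
Qed.

Lemma dual_volume_expE (t : R) : 0 < t ->
  dual_volume_exp w t = (exp_integral (wmeasure hw) t)%:E.
Proof.
move=> t0; rewrite /exp_integral fineK; last first.
  rewrite ge0_fin_numE; first exact: wmeasure_exp_lty.
  by apply: integral_ge0 => x _; rewrite lee_fin expR_ge0.
have mE := @measurable_exp_enorm R n t.
rewrite integral_wmeasure.
- by rewrite /dual_volume_exp /dual_volume integral_weight0.
- exact/measurable_EFinP.
- by move=> x; rewrite lee_fin expR_ge0.
Qed.

Lemma exp_integral_gt0 (t : R) : 0 < t -> 0 < exp_integral (wmeasure hw) t.
Proof.
move=> t0; have mE := @measurable_exp_enorm R n t.
have E : (\int[wmeasure hw]_x (expR (- (t * enorm x)))%:E = (exp_integral (wmeasure hw) t)%:E)%E.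
  rewrite fineK// ge0_fin_numE; first exact: wmeasure_exp_lty.
  by apply: integral_ge0 => x _; rewrite lee_fin expR_ge0.
rewrite -lte_fin -E.
have mc := @measurable_cube R n 1.
apply: (@lt_le_trans _ _ (\int[wmeasure hw]_(x in @cube R n 1) (expR (- (t * n%:R)))%:E)%E).
  by rewrite integral_cst// mule_gt0// ?lte_fin ?expR_gt0//; exact: wmeasure_cube_gt0.
apply: (@le_trans _ _ (\int[wmeasure hw]_(x in @cube R n 1) (expR (- (t * enorm x)))%:E)%E).
  apply: ge0_le_integral => //.
  - by apply: measurable_funTS; apply/measurable_EFinP.
  - move=> x cx; rewrite lee_fin ler_expR lerN2 ler_pM2l//.
    apply: le_trans (enorm_le_sum _) _.
    apply: (@le_trans _ _ (\sum_(i < n) 1)); last by rewrite sumr_const card_ord.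
    by apply: ler_sum => i _; rewrite ler_norml; exact: cx.
apply: ge0_subset_integral => //; first by apply/measurable_EFinP.
Qed.

Lemma exp_integral_le (s t : R) : 0 < s -> s <= t ->
  exp_integral (wmeasure hw) t <= exp_integral (wmeasure hw) s.
Proof.
move=> s0 st.
have mE u : measurable_fun setT (fun x : V => (expR (- (u * enorm x)))%:E).
  by apply/measurable_EFinP; exact: measurable_exp_enorm.
have fin u : 0 < u -> (\int[wmeasure hw]_x (expR (- (u * enorm x)))%:E \is a fin_num)%E.
  move=> u0; rewrite ge0_fin_numE; first exact: wmeasure_exp_lty.
  by apply: integral_ge0 => x _; rewrite lee_fin expR_ge0.
apply: fine_le; rewrite ?fin ?(lt_le_trans s0 st)//.
apply: ge0_le_integral => //.
- by move=> x _; rewrite lee_fin ler_expR lerN2 ler_wpM2r ?enorm_ge0.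
Qed.

Context (mu : {finite_measure set V -> \bar R}) (mu_neq0 : mu setT != 0%E)
  (mu1 : finite_first_moment mu)
  (hinf : limf_einf
    (fun t : R => dual_volume_exp w t *
       (expR (- (fine (zeta mu) / (2 * fine (mu setT) * t))))%:E)%E 0^'+ = 0%E).
Local Notation a := (fine (mu setT)).

Lemma small_exp_integral (e d : R) : 0 < e -> 0 < d -> exists2 t, 0 < t < d &
  exp_integral (wmeasure hw) t * expR (- (fine (zeta mu) / (2 * a * t))) < e.
Proof.
move=> e0 d0.
have N : (0 : R)^'+ [set t | 0 < t < d].
  by near=> t => /=; apply/andP; split; near: t; [exact: nbhs_right_gt|exact: nbhs_right_lt].
have e0' : (0 < e%:E)%E by rewrite lte_fin.
rewrite -hinf in e0'; have [t /= t0d] := limf_einf_lt e0' N.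
have /andP[t0 _] := t0d.
by rewrite dual_volume_expE// -EFinM lte_fin => h; exists t.
Unshelve. all: by end_near. Qed.

(** F_w is positive and nonincreasing, so it stays above F_w(1) on (0, 1). Were zeta zero, the
    exponential factor would be 1 and the lower limit could not vanish. *)
Lemma zeta_gt0 : 0 < fine (zeta mu).
Proof.
rewrite lt0r fine_ge0 ?zeta_ge0// andbT; apply/eqP => z0.
have [t /andP[t0 t1]] := small_exp_integral (exp_integral_gt0 ltr01) ltr01.
by rewrite z0 mul0r oppr0 expR0 mulr1 ltNge exp_integral_le// ltW.
Qed.

Lemma exp_integral_frequently (e T : R) : 0 < e -> exists2 M, T < M &
  exp_integral (wmeasure hw) (fine (zeta mu) / a / (2 * M)) * expR (- M) < e.
Proof.
move=> e0; have a0 := mass_gt0 mu_neq0; have z0 := zeta_gt0.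
pose c := fine (zeta mu) / a; have c0 : 0 < c by rewrite divr_gt0.
(* The maximum with 1 makes the threshold for t positive; t < c / (2 S) then says S < c / (2 t) =
   M. *)
pose S := Num.max T 1; have S0 : 0 < S by rewrite lt_max ltr01 orbT.
have d0 : 0 < c / (2 * S) by rewrite divr_gt0// mulr_gt0.
have [t /andP[t0 td] h] := small_exp_integral e0 d0.
exists (c / (2 * t)).
  apply: (@le_lt_trans _ _ S); first by rewrite le_max lexx.
  rewrite ltr_pdivlMr ?mulr_gt0//; move: td; rewrite ltr_pdivlMr ?mulr_gt0//; lra.
have -> : fine (zeta mu) / a / (2 * (c / (2 * t))) = t.
  by rewrite -/c; field; rewrite !gt_eqF.
have -> : c / (2 * t) = fine (zeta mu) / (2 * a * t) by rewrite /c; field; rewrite !gt_eqF.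
by [].
Qed.

End weight_integrals.

(** * The function e^(-phi) and its curvature measure *)

Section curvature.
Context (R : realType) (n : nat) (n_ge1 : (1 <= n)%N).
Local Notation V := 'rV[R]_n.
Local Notation leb := (lebesgue_rV R n).
Context (w : V -> R) (hw : weight w).
Context (psi : V -> \bar R) (legN : forall x, legendre psi x != -oo%E).
Local Notation Phi := (legendre psi).

Definition gibbs_fun (x : V) : R := fine (expeR (- Phi x)).

Lemma gibbs_fun_ge0 x : 0 <= gibbs_fun x.
Proof. by rewrite fine_ge0// expeR_ge0. Qed.

Lemma EFin_gibbs_fun x : (gibbs_fun x)%:E = expeR (- Phi x).
Proof. by rewrite /gibbs_fun; move: (legN x); case: (Phi x). Qed.

Lemma measurable_gibbs_fun : measurable_fun setT gibbs_fun.
Proof. by apply: measurableT_comp => //; exact: measurable_gibbs. Qed.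

Lemma neg_log_gibbs_fun : neg_log gibbs_fun = Phi.
Proof. by apply/funext => x; rewrite /neg_log EFin_gibbs_fun expeRK oppeK. Qed.

Lemma gibbs_fun_lt (s : R) x : 0 < s -> (gibbs_fun x < s) = ((- ln s)%:E < Phi x)%E.
Proof.
move=> s0; rewrite /gibbs_fun; move: (legN x); case: (Phi x) => [r| |]//= _.
  by rewrite lte_fin -{1}(lnK s0) ltr_expR ltrNl.
by rewrite ltry.
Qed.

Lemma gibbs_fun_usc : upper_semicontinuous gibbs_fun.
Proof.
move=> x b; rewrite lte_fin ltrNr => xb.
have b0 : 0 < - b := le_lt_trans (gibbs_fun_ge0 x) xb.
have [U xU hU] := @legendre_lsc _ _ psi x (- ln (- b)) (etrans (esym (gibbs_fun_lt x b0)) xb).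
by exists U => // y /hU; rewrite -gibbs_fun_lt// lte_fin ltrNr.
Qed.

(** The conjugate is convex, so its points with a gradient are exactly the smooth ones; [w] and
    [weight0] differ at most at the origin, a null set. *)
Lemma gradient_measure_wmeasure (E : set V) : measurable E ->
  gradient_measure (wmeasure hw) legN E = curvature_measure w gibbs_fun E.
Proof.
move=> mE; rewrite /curvature_measure neg_log_gibbs_fun.
have cPhi : epi_convex Phi := @legendre_convex _ _ psi.
have mPhi : measurable_fun setT Phi := @measurable_legendre _ _ psi.
have msm := measurable_smooth mPhi.
have msg := measurable_smooth_gradient legN cPhi mPhi.
pose B := smooth_gradient Phi @^-1` E.
have mB : measurable B by rewrite -[B]setTI; exact: msg.
have -> : [set x | has_gradient Phi x /\ E (gradient Phi x)] = smooth Phi `&` B.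
  apply/seteqP; split => [x [/has_gradient_smooth sx Ex]|x [sx Bx]].
    by split => //; rewrite /B /= /smooth_gradient mem_set.
  have [gx _] := smooth_gradientP legN cPhi sx.
  by split => //; move: Bx; rewrite /B /= /smooth_gradient mem_set.
have mD : measurable (smooth Phi `&` B) by exact: measurableI.
have mf := measurable_gibbs_fun.
rewrite integral_weight0// [RHS]integral_mkcond.
rewrite /gradient_measure /= /pushforward /= /density integral_mkcond.
rewrite integral_wmeasure.
- apply: eq_integral => x _; rewrite !patchE in_setI -/B /gibbs_density indicE.
  by case: (x \in smooth Phi); case: (x \in B); rewrite /= ?mulr1 ?mulr0 ?mul0e ?EFinM.
- apply/(measurable_restrictT _ mB); apply: measurable_funTS; apply/measurable_EFinP.
  exact: measurable_gibbs_density.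
- by move=> x; rewrite patchE; case: ifP => // _; rewrite lee_fin gibbs_density_ge0.
Qed.

End curvature.

Lemma expeR_shift (R : realType) (x : \bar R) (t : R) :
  expeR (- (x - t%:E)) = ((expR t)%:E * expeR (- x))%E.
Proof.
case: x => [r| |] /=; last 2 first.
- by rewrite mule0.
- by rewrite gt0_muley// lte_fin expR_gt0.
by rewrite -EFinM -expRD; congr (expR _)%:E; ring.
Qed.

(** * Perturbed potentials and their means *)

Section perturbation.
Context (R : realType) (n : nat).
Local Notation V := 'rV[R]_n.
Context (mu : {finite_measure set V -> \bar R}) (mu_neq0 : mu setT != 0%E).
Local Notation a := (fine (mu setT)).

Lemma even_potential_perturb (psi : V -> \bar R) (g : V -> R) (m : nat) :
  even_potential mu psi -> continuous g -> (forall x, g (- x) = g x) ->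
  (forall x, 0 <= g x <= 1) ->
  even_potential mu (fun y => psi y + (g y / m.+1%:R)%:E)%E /\
  mean mu (fun y => psi y + (g y / m.+1%:R)%:E)%E =
    mean mu psi + fine (\int[mu]_y (g y)%:E)%E / a / m.+1%:R.
Proof.
move=> ep cg gN g01; have [ev mpsi psi0 psioo] := ep.
have g0 x : 0 <= g x by have /andP[] := g01 x.
have mg := continuous_measurableV cg.
have gle : (\int[mu]_y (g y)%:E <= a%:E)%E.
  rewrite -massE -[leRHS]mul1e -integral_cst//; apply: ge0_le_integral => //.
  - by move=> y _; rewrite lee_fin.
  - by apply/measurable_EFinP.
  - by move=> y _; rewrite lee_fin; have /andP[] := g01 y.
have gge : (0 <= \int[mu]_y (g y)%:E)%E by apply: integral_ge0 => y _; rewrite lee_fin.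
have [I IE] : exists I : R, (\int[mu]_y (g y)%:E)%E = I%:E.
  by move: gle gge; case: (integral _ _ _) => // r _ _; exists r.
have E : (\int[mu]_y (psi y + (g y / m.+1%:R)%:E) = (a * mean mu psi + I / m.+1%:R)%:E)%E.
  rewrite ge0_integralD//; last 2 first.
  - by move=> y _; rewrite lee_fin divr_ge0.
  - by apply/measurable_EFinP; exact: measurable_funM.
  rewrite integral_mean// EFinD; congr (_ + _)%E.
  under eq_integral do rewrite mulrC EFinM.
  rewrite ge0_integralZl_EFin//; last 2 first.
  - by move=> y _; rewrite lee_fin.
  - exact/measurable_EFinP.
  by rewrite IE -EFinM mulrC.
split; first split.
- by move=> y; rewrite ev gN.
- apply: emeasurable_funD => //; apply/measurable_EFinP; exact: measurable_funM.
- by move=> y; rewrite adde_ge0// lee_fin divr_ge0.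
- by rewrite E ltry.
rewrite {1}/mean E IE /=; field.
by rewrite !gt_eqF ?mass_gt0.
Qed.

End perturbation.

(** * Normalization of the maximizer and membership in [LC] *)

Theorem theorem1p2 (R : realType) (n : nat) (n_ge1 : (1 <= n)%N)
    (w : 'rV[R]_n -> R) (mu : {finite_measure set 'rV[R]_n -> \bar R}) :
  weight w -> even_fun w ->
  mu setT != 0%E -> even_measure mu ->
  (forall W : {vspace 'rV[R]_n}, W != fullv -> ~ concentrated_in mu W) ->
  finite_first_moment mu ->
  limf_einf
    (fun t : R => dual_volume_exp w t *
       (expR (- (fine (zeta mu) / (2 * fine (mu setT) * t))))%:E)%E
    0^'+ = 0%E ->
  exists f : 'rV[R]_n -> R,
    LC f /\
    forall E : set 'rV[R]_n, measurable E -> mu E = curvature_measure w f E.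
Proof.
move=> hw ew mu_neq0 muN _ mu1 hinf.
pose sigma := wmeasure hw; pose a := fine (mu setT).
have a0 : 0 < a by exact: mass_gt0.
have z0 := zeta_gt0 n_ge1 hw hinf.
pose c := fine (zeta mu) / a; have c0 : 0 < c by rewrite divr_gt0.
have hc x : ((a * (c * enorm x))%:E <= \int[mu]_y `|inner y x|%:E)%E.
  rewrite mulrA [a * c]mulrC divfK ?gt_eqF//; exact: zeta_enorm_le.
have sexp := @wmeasure_exp_lty _ _ _ hw.
have ssm := @wmeasure_small _ _ _ hw.
have scube := wmeasure_cube_gt0 hw n_ge1 ltr01.
have hlim e T : 0 < e -> exists2 M, T < M & exp_integral sigma (c / (2 * M)) * expR (- M) < e.
  exact: exp_integral_frequently.
have [psi0 [ep max0]] := maximizer n_ge1 sexp ssm scube mu_neq0 mu1 c0 hc hlim.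
have best0 := best_gt0 sexp scube mu_neq0 mu1 c0 hc.
have I0 : 0 < gibbs sigma psi0 by apply: lt_le_trans max0; rewrite mulr_gt0// expR_gt0.
(* Adding t to psi0 multiplies the Gibbs integral by e^t, which brings it to |mu|. *)
pose t := ln (a / gibbs sigma psi0).
have tE : expR t = a / gibbs sigma psi0 by rewrite lnK// posrE divr_gt0.
pose psi y := (psi0 y + t%:E)%E.
have l0N x : legendre psi0 x != -oo%E := legendre_neqNy mu_neq0 hc x ep.
have legE (phi : 'rV[R]_n -> \bar R) x :
    expeR (- legendre (fun y => phi y + t%:E)%E x) = ((expR t)%:E * expeR (- legendre phi x))%E.
  by rewrite legendre_addr expeR_shift.
have legN x : legendre psi x != -oo%E.
  by rewrite legendre_addr; move: (l0N x); case: (legendre psi0 x).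
have psiN y : psi (- y) = psi y by have [ev _ _ _] := ep; rewrite /psi ev.
have totE phi : even_potential mu phi ->
    (\int[sigma]_x expeR (- legendre (fun y => phi y + t%:E)%E x) =
     (expR t * gibbs sigma phi)%:E)%E.
  move=> ephi; under eq_integral do rewrite legE.
  rewrite ge0_integralZl_EFin ?expR_ge0//; last 2 first.
  - by move=> x _; exact: expeR_ge0.
  - exact: measurable_gibbs.
  by rewrite (integral_gibbs sexp mu_neq0 c0 hc ephi).
have total : (\int[sigma]_x expeR (- legendre psi x))%E = a%:E.
  by rewrite totE// tE divfK// gt_eqF.
have opt (g : 'rV[R]_n -> R) : continuous g -> (forall x, g (- x) = g x) ->
    (forall x, 0 <= g x <= 1) -> forall m : nat,
    (\int[sigma]_x expeR (- legendre (fun y => psi y + (g y / m.+1%:R)%:E) x) <=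
     (a * expR (fine (\int[mu]_y (g y)%:E) / a / m.+1%:R))%:E)%E.
  move=> cg gN g01 m.
  have [epm meanE] := even_potential_perturb mu_neq0 m ep cg gN g01.
  have -> : (fun y => psi y + (g y / m.+1%:R)%:E)%E =
      (fun y => (psi0 y + (g y / m.+1%:R)%:E) + t%:E)%E.
    by apply/funext => y; rewrite /psi addeAC.
  rewrite totE// lee_fin.
  (* Maximality of psi0 replaces [best] e^(mean psi0) by the Gibbs integral of psi0, which the
     factor e^t turns into a. *)
  have := gibbs_le_best sexp scube mu_neq0 mu1 c0 hc epm; rewrite meanE expRD mulrA => h.
  have aE : expR t * gibbs sigma psi0 = a by rewrite tE divfK// gt_eqF.
  apply: (@le_trans _ _ (expR t * (gibbs sigma psi0 *
      expR (fine (\int[mu]_y (g y)%:E) / a / m.+1%:R)))); last by rewrite mulrA aE.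
  by rewrite ler_pM2l ?expR_gt0//; apply: le_trans h _; rewrite ler_wpM2r ?expR_ge0.
exists (gibbs_fun psi); split; last first.
  move=> E mE; rewrite -(gradient_measure_wmeasure n_ge1 hw legN)//.
  by rewrite (gradient_measure_eq (@wmeasure_null _ _ _ hw)
    (fun A mA => wmeasureN hw ew mA) muN mu_neq0 psiN legN total opt mE).
have mf := @measurable_gibbs_fun _ _ psi.
have f0 := @gibbs_fun_ge0 _ _ psi.
split.
- split; first exact: f0.
  rewrite neg_log_gibbs_fun//; apply: epi_convex_efun => //; exact: legendre_convex.
- exact: gibbs_fun_usc.
rewrite Lnorm1 (@eq_integral _ _ _ _ _ (EFin \o gibbs_fun psi)); last first.
  by move=> x _ /=; rewrite ger0_norm.
apply/andP; split.
  rewrite lt0e; apply/andP; split; last by apply: integral_ge0 => x _; rewrite lee_fin.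
  (* A vanishing norm would make f zero almost everywhere, hence its sigma-integral 0 instead of a >
     0. *)
  apply/eqP => f00.
  have : ae_eq (lebesgue_rV R n) setT (EFin \o gibbs_fun psi) (cst 0%E).
    apply/ae_eq_integral_abs => //; first exact/measurable_EFinP.
    by rewrite -[RHS]f00; apply: eq_integral => x _ /=; rewrite ger0_norm.
  move=> f0ae; move: total; rewrite integral_wmeasure; last 2 first.
  - exact: measurable_gibbs.
  - by move=> x; exact: expeR_ge0.
  have mw0 : measurable_fun setT (EFin \o weight0 w).
    by apply/measurable_EFinP; exact: measurable_weight0.
  rewrite (@ae_eq_integral _ _ _ _ _ (cst 0%E)) ?integral0//.
  - by move=> /esym/eqP; rewrite eqe gt_eqF.
  - by apply: emeasurable_funM => //; exact: measurable_gibbs.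
  - case: f0ae => N [mN N0 cN]; exists N; split => //; apply: subset_trans cN => x /= nx h.
    by apply: nx => _; rewrite -EFin_gibbs_fun// h// mul0e.
have mE u : measurable_fun setT (fun x : 'rV[R]_n => (expR (- (u * enorm x)))%:E).
  by apply/measurable_EFinP; exact: measurable_exp_enorm.
(* The bound phi(x) >= c |x| - m(psi0) - t dominates f by an integrable exponential. *)
apply: (@le_lt_trans _ _ (\int[lebesgue_rV R n]_x
    ((expR (t + mean mu psi0))%:E * (expR (- (c * enorm x)))%:E))%E).
  apply: ge0_le_integral => //.
  - by move=> x _; rewrite lee_fin.
  - exact/measurable_EFinP.
  - exact: measurable_funeM.
  - move=> x _; rewrite /= EFin_gibbs_fun// legE -EFinM -!expRD.
    have := legendre_ge mu_neq0 hc x ep; move: (l0N x).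
    case: (legendre psi0 x) => [r| |]//= _; last by rewrite mule0 lee_fin expR_ge0.
    by rewrite lee_fin => h; rewrite -EFinM -expRD lee_fin ler_expR; lra.
rewrite ge0_integralZl_EFin ?expR_ge0//.
by rewrite lte_mul_pinfty ?lee_fin ?expR_ge0//; exact: integral_exp_enorm_lty.
Qed.
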